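(* Let $f\in W^{-1,s}(\Omega)$ and $f_D\in W^{1-1/s,s}(\tilde\Gamma)$. Let $q>\frac{2s}{s-2}$ and let $\tilde q>\tilde q_*(q):=\frac{2s}{s-2}+\frac{2s\,q}{q(s-2)-2s}$. Let $u\in U_{\mathrm{ad}}$. Then the map $S':(U_{\mathrm{ad}},\|\cdot\|_{L^{\tilde q}(\Omega)})\to\mathcal{L}(L^{\tilde q}(\Omega),W^{1,2}(\Omega))$ is Fréchet differentiable at $u$ with respect to feasible variations. Specifically, with $z_{u,\phi}=S'(u)[\phi]$, $z_{u,\psi}=S'(u)[\psi]$, let $z_{u,\phi,\psi}\in W^{1,2}_{\tilde\Gamma}(\Omega)$ be the unique solution to $$\int_\Omega u\nabla z_{u,\phi,\psi}\cdot\nabla v\,dx=-\int_\Omega\psi\nabla z_{u,\phi}\cdot\nabla v\,dx-\int_\Omega\phi\nabla z_{u,\psi}\cdot\nabla v\,dx\quad\text{for all }v\in W^{1,2}_{\tilde\Gamma}(\Omega).$$ Then the second derivative of $S$ at $u$ is $S''(u)[\phi,\psi]=z_{u,\phi,\psi}$ for $\phi,\psi$ with $u+\phi,u+\psi\in U_{\mathrm{ad}}$, and $$\lim_{\substack{\|\phi\|_{L^{\tilde q}}\to0\\ u+\phi\in U_{\mathrm{ad}}}}\ \sup_{\psi\in L^{\tilde q}(\Omega)\setminus\{0\}}\frac{\|S'(u+\phi)[\psi]-S'(u)[\psi]-z_{u,\phi,\psi}\|_{W^{1,2}}}{\|\phi\|_{L^{\tilde q}}\|\psi\|_{L^{\tilde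 q}}}=0 .$$ In addition, there exists $C>0$ such that $\|z_{u,\phi,\psi}\|_{W^{1,2}}\le C\|\phi\|_{L^{\hat q}}\|\psi\|_{L^{\hat q}}$ for $\hat q=4s/(s-2)$.
   Context: Setting. $\Omega\subset\mathbb{R}^d$, $d\ge2$, is a bounded domain with Lipschitz boundary of class $C^{1,\alpha}$; $\tilde\Gamma,\Gamma\subset\partial\Omega$ (Dirichlet and Neumann part of the boundary) are nonempty, closed and of positive surface measure. The set $\Omega\cup\Gamma$ is regular in the sense of Gröger: a bounded set $G\subset\mathbb{R}^d$ is regular if for each $x\in\partial G$ there are an open neighbourhood $U$ of $x$ and a bi-Lipschitz map $\Phi$ from $U$ onto an open subset of $\mathbb{R}^d$ with $\Phi(x)=0$ such that $\Phi(U\cap G)$ is one of $E_1=\{|z|<1,z_d<0\}$, $E_2=\{|z|<1,z_d\le0\}$, $E_3=\{z\in E_2: z_d<0\text{ or }z_1>0\}$. Spaces. $W^{1,p}_{\tilde\Gamma}(\Omega)$ is the closed subspace of $W^{1,p}(\Omega)$ of functions with vanishing trace on $\tilde\Gamma$; $W^{-1,p}(\Omega)$ is the dual of $W^{1,p'}_{\tilde\Gamma}(\Omega)$, $p'=p/(p-1)$. $0<u_\ell\le u_u$ are fixed scalars and $U_{\mathrm{ad}}=\{u\in BV(\Omega): u_\ell\le u(x)\le u_u\text{ for a.e. }x\in\Omega\}$. Dirichlet lift. The boundary setting is such that for every $p>1$ and $f_D\in W^{1-1/p,p}(\tilde\Gamma)$ the problem $-\Delta w=0$ in $\Omega$, $w=f_D$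 on $\tilde\Gamma$, $\nabla w\cdot\nu=0$ on $\Gamma$ has a unique solution $\tilde f_D\in W^{1,p}(\Omega)$, with $\|\tilde f_D\|_{W^{1,p}}\le C(p)\|f_D\|_{W^{1-1/p,p}(\tilde\Gamma)}$. Control-to-state operator. For $u\in U_{\mathrm{ad}}$, $S(u)$ is the unique $y\in W^{1,2}(\Omega)$ with $y-\tilde f_D\in W^{1,2}_{\tilde\Gamma}(\Omega)$ and $\int_\Omega u\nabla y\cdot\nabla v\,dx=\langle f,v\rangle$ for all $v\in W^{1,2}_{\tilde\Gamma}(\Omega)$. The exponent $s$. $s>2$ is a fixed exponent (it exists by Gröger's regularity theory) such that for every $\sigma\in[2,s]$ there is $C(\sigma)\ge0$ such that for all $f\in W^{-1,\sigma}(\Omega)$, $f_D\in W^{1-1/\sigma,\sigma}(\tilde\Gamma)$, $u\in U_{\mathrm{ad}}$: $\|S(u)\|_{W^{1,\sigma}}\le C(\sigma)(\|f_D\|_{W^{1-1/\sigma,\sigma}(\tilde\Gamma)}+\|f\|_{W^{-1,\sigma}})$. First derivative. For $u\in U_{\mathrm{ad}}$, $y=S(u)$ and a direction $\phi\in L^{\tilde q}(\Omega)$, $S'(u)[\phi]=z_{u,\phi}\in W^{1,2}_{\tilde\Gamma}(\Omega)$ is the unique solution of $\int_\Omega u\nabla z_{u,\phi}\cdot\nabla v\,dx=-\int_\Omega\phi\nabla y\cdot\nabla v\,dx$ for all $v\in W^{1,2}_{\tilde\Gamma}(\Omega)$. A map $T:U_{\mathrm{ad}}\to Z$ into a Banach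 space $Z$ is Fréchet differentiable at $u$ with respect to feasible variations and a norm $\|\cdot\|_X$ if there is $T'(u)\in\mathcal{L}(X,Z)$ with $\|T(u+\phi)-T(u)-T'(u)\phi\|_Z/\|\phi\|_X\to0$ as $\|\phi\|_X\to0$ with $u+\phi\in U_{\mathrm{ad}}$. *)

(* Defs.v *)
From HB Require Import structures.
From mathcomp Require Import all_boot all_order all_algebra.
From mathcomp Require Import all_classical all_reals all_analysis.

Set Implicit Arguments.
Unset Strict Implicit.
Unset Printing Implicit Defensive.

Import Order.TTheory GRing.Theory Num.Theory.
Import numFieldNormedType.Exports.

Local Open Scope classical_set_scope.
Local Open Scope ring_scope.

Definition cover_outer (R : realType) (T : Type) (tau : set T -> \bar R)
    (A : set T) : \bar R :=
  ereal_inf [set (\sum_(k <oo) tau (F k))%E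
            | F in [set F : (set T)^nat | A `<=` \bigcup_k F k]].

Section cover_outer_theory.
Variables (R : realType) (T : pointedType) (tau : set T -> \bar R).

Definition discrete_alias : Type := T.
HB.instance Definition _ := Pointed.on discrete_alias.
HB.instance Definition _ := @isMeasurable.Build default_measure_display
  discrete_alias discrete_measurable discrete_measurable0
  discrete_measurableC discrete_measurableU.

Lemma cover_outer_mu_ext :
  cover_outer tau = mu_ext (tau : set discrete_alias -> \bar R).
Proof.
apply/funext => A; rewrite /cover_outer /mu_ext; congr ereal_inf.
by apply/seteqP; split => [x [F AF <-]|x [F [_ AF] <-]]; exists F.
Qed.

Hypotheses (tau0 : tau set0 = 0%E) (tau_ge0 : forall A, (0 <= tau A)%E).

Lemma cover_outer0 : cover_outer tau set0 = 0%E.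
Proof. by rewrite cover_outer_mu_ext; exact: mu_ext0. Qed.

Lemma cover_outer_ge0 A : (0 <= cover_outer tau A)%E.
Proof. by rewrite cover_outer_mu_ext; exact: mu_ext_ge0. Qed.

Lemma cover_outer_le : {homo cover_outer tau : A B / A `<=` B >-> (A <= B)%E}.
Proof.
rewrite cover_outer_mu_ext => A B AB.
exact: (le_mu_ext (tau : set discrete_alias -> \bar R) AB).
Qed.

Lemma cover_outer_sigma_subadditive : sigma_subadditive (cover_outer tau).
Proof.
by rewrite cover_outer_mu_ext => F; exact: mu_ext_sigma_subadditive.
Qed.

End cover_outer_theory.

(* The norm [`|x|] of the library on row vectors is the sup norm, hence
   [enorm]. *)

Definition dot (R : realType) (n : nat) (x y : 'rV[R]_n) : R :=
  \sum_i x 0 i * y 0 i.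

Definition enorm (R : realType) (n : nat) (x : 'rV[R]_n) : R :=
  Num.sqrt (dot x x).

Definition cbox (R : realType) (n : nat) (a b : 'rV[R]_n) : set 'rV[R]_n :=
  [set x | forall i, a 0 i <= x 0 i <= b 0 i].

(* Volume of the smallest closed box containing A, +oo if A is unbounded:
   covers by arbitrary sets weighted in this way amount to covers by boxes. *)
Definition box_volume (R : realType) (n : nat) (A : set 'rV[R]_n) : \bar R :=
  ereal_inf [set (\prod_i (ab.2 0 i - ab.1 0 i))%:E | ab in
    [set ab : 'rV[R]_n * 'rV[R]_n |
      (forall i, ab.1 0 i <= ab.2 0 i) /\ A `<=` cbox ab.1 ab.2]].

Definition lebesgue_outer (R : realType) (n : nat)
  : set 'rV[R]_n.+1 -> \bar R := cover_outer (@box_volume R n.+1).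

Section lebesgue_outer_theory.
Variables (R : realType) (n : nat).

Let box_volume_ge0 (A : set 'rV[R]_n.+1) : (0 <= box_volume A)%E.
Proof.
apply: le_ereal_inf_tmp => _ [[a b] [/= ab _] <-].
by rewrite lee_fin prodr_ge0// => i _; rewrite subr_ge0.
Qed.

Let box_volume0 : box_volume (set0 : set 'rV[R]_n.+1) = 0%E.
Proof.
apply/eqP; rewrite eq_le box_volume_ge0 andbT; apply: ereal_inf_lbound.
exists (0, 0); first by split => // i.
by rewrite big_ord_recl /= subrr mul0r.
Qed.

HB.instance Definition _ := @isOuterMeasure.Build R 'rV[R]_n.+1
  (@lebesgue_outer R n)
  (cover_outer0 box_volume0 box_volume_ge0)
  (cover_outer_ge0 box_volume_ge0)
  (@cover_outer_le _ _ _)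
  (cover_outer_sigma_subadditive box_volume_ge0).

End lebesgue_outer_theory.

(* R^n.+1 with the (complete) sigma-algebra of Lebesgue measurable sets *)
Definition lebT (R : realType) (n : nat) : measurableType _ :=
  caratheodory_type
    (@lebesgue_outer R n : {outer_measure set 'rV[R]_n.+1 -> \bar R}).

Definition leb (R : realType) (n : nat) : {measure set (lebT R n) -> \bar R} :=
  (@lebesgue_outer R n : {outer_measure set 'rV[R]_n.+1 -> \bar R}).

Definition ediam (R : realType) (n : nat) (A : set 'rV[R]_n) : \bar R :=
  maxe 0%E (ereal_sup [set (enorm (xy.1 - xy.2))%:E | xy in
                      [set xy | A xy.1 /\ A xy.2]]).

(* [hausdorff_outer] is the Hausdorff measure of dimension k = n.+1 on R^n.+2.
   The constant is omega_k / 2 ^ k, with omega_k the volume of the unit ball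
   of R^k, which makes it the usual surface area. *)
Definition hausdorff_const (R : realType) (n : nat) : \bar R :=
  (lebesgue_outer [set x : 'rV[R]_n.+1 | (enorm x <= 1)%R] *
   ((2 ^- n.+1 : R)%:E))%E.

Definition hausdorff_gauge (R : realType) (n : nat) (delta : R)
    (A : set 'rV[R]_n.+2) : \bar R :=
  if (ediam A <= delta%:E)%E
  then (hausdorff_const R n * ediam A ^+ n.+1)%E else +oo%E.

Definition hausdorff_outer (R : realType) (n : nat) (A : set 'rV[R]_n.+2)
    : \bar R :=
  ereal_sup [set cover_outer (hausdorff_gauge delta) A
            | delta in [set delta | 0 < delta]].

Section hausdorff_outer_theory.
Variables (R : realType) (n : nat).

Let ediam_ge0 (A : set 'rV[R]_n.+2) : (0 <= ediam A)%E.
Proof. by rewrite /ediam le_max lexx. Qed.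

Let ediam0 : ediam (set0 : set 'rV[R]_n.+2) = 0%E.
Proof.
rewrite /ediam (_ : [set _ | _ in _] = set0) ?ereal_sup0 ?maxeNy//.
by apply/seteqP; split => // x [y [[]]].
Qed.

Let gauge_ge0 delta (A : set 'rV[R]_n.+2) : (0 <= hausdorff_gauge delta A)%E.
Proof.
rewrite /hausdorff_gauge; case: ifPn => // _.
rewrite mule_ge0 ?expe_ge0// mule_ge0 ?lee_fin ?invr_ge0 ?exprn_ge0//.
exact: outer_measure_ge0.
Qed.

Let gauge0 delta : 0 < delta ->
  hausdorff_gauge delta (set0 : set 'rV[R]_n.+2) = 0%E.
Proof.
by move=> d0; rewrite /hausdorff_gauge ediam0 lee_fin ltW// expeS mul0e mule0.
Qed.

Let hausdorff_outer_ge0 (A : set 'rV[R]_n.+2) : (0 <= hausdorff_outer A)%E.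
Proof.
apply: (@le_trans _ _ (cover_outer (hausdorff_gauge 1) A)).
  exact: cover_outer_ge0.
by apply: ereal_sup_ubound; exists 1 => //=.
Qed.

Let hausdorff_outer0 : hausdorff_outer (set0 : set 'rV[R]_n.+2) = 0%E.
Proof.
apply/eqP; rewrite eq_le hausdorff_outer_ge0 andbT.
apply: ge_ereal_sup => _ [d /= d0 <-].
by rewrite (cover_outer0 (gauge0 d0)).
Qed.

Let hausdorff_outer_le :
  {homo @hausdorff_outer R n : A B / A `<=` B >-> (A <= B)%E}.
Proof.
move=> A B AB; apply: ge_ereal_sup => _ [d /= d0 <-].
apply: (le_trans (@cover_outer_le R _ (hausdorff_gauge d) _ _ AB)).
by apply: ereal_sup_ubound; exists d.
Qed.

Let hausdorff_outer_sigma_subadditive :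
  sigma_subadditive (@hausdorff_outer R n).
Proof.
move=> F; apply: ge_ereal_sup => _ [d /= d0 <-].
apply: (le_trans (cover_outer_sigma_subadditive (gauge_ge0 d) F)).
apply: lee_nneseries => k _; first by move=> _; exact: cover_outer_ge0.
by apply: ereal_sup_ubound; exists d.
Qed.

HB.instance Definition _ := @isOuterMeasure.Build R 'rV[R]_n.+2
  (@hausdorff_outer R n) hausdorff_outer0 hausdorff_outer_ge0
  hausdorff_outer_le hausdorff_outer_sigma_subadditive.

End hausdorff_outer_theory.

Definition surfT (R : realType) (n : nat) : measurableType _ :=
  caratheodory_type
    (@hausdorff_outer R n : {outer_measure set 'rV[R]_n.+2 -> \bar R}).

Definition surf (R : realType) (n : nat)
    : {measure set (surfT R n) -> \bar R} :=
  (@hausdorff_outer R n : {outer_measure set 'rV[R]_n.+2 -> \bar R}).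

Definition partial (R : realType) (n : nat) (i : 'I_n) (f : 'rV[R]_n -> R)
    : 'rV[R]_n -> R :=
  fun x => 'D_(delta_mx 0 i) f x.

Fixpoint Ck (R : realType) (n k : nat) (f : 'rV[R]_n -> R) : Prop :=
  match k with
  | 0 => continuous f
  | k'.+1 => [/\ continuous f,
       (forall i x, derivable f x (delta_mx 0 i)) &
       (forall i, Ck k' (partial i f))]
  end.

Definition smooth (R : realType) (n : nat) (f : 'rV[R]_n -> R) : Prop :=
  forall k, Ck k f.

Definition compactly_supported_in (R : realType) (n : nat)
    (Om : set 'rV[R]_n) (f : 'rV[R]_n -> R) : Prop :=
  let supp := closure [set x | f x != 0] in compact supp /\ supp `<=` Om.

Definition boundary (R : realType) (n : nat) (A : set 'rV[R]_n)
    : set 'rV[R]_n :=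
  closure A `\` interior A.

Definition domain (R : realType) (n : nat) (Om : set 'rV[R]_n) : Prop :=
  [/\ open Om, connected Om & Om !=set0].

Definition C1holder (R : realType) (n : nat) (alpha : R) (g : 'rV[R]_n -> R)
    : Prop :=
  Ck 1 g /\ exists L : R, forall i x y,
    `|partial i g x - partial i g y| <= L * enorm (x - y) `^ alpha.

(* The boundary of Om is, locally and after a rigid motion y = (z - x) Q, the
   graph of a C^{1,alpha} function, with Om lying on one side of it. *)
Definition C1holder_boundary (R : realType) (n : nat) (alpha : R)
    (Om : set 'rV[R]_n.+1) : Prop :=
  forall x, boundary Om x ->
  exists (Q : 'M[R]_n.+1) (r : R) (g : 'rV[R]_n -> R),
  [/\ Q *m Q^T = 1%:M, 0 < r, C1holder alpha g &
      forall z, enorm (z - x) < r ->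
        let y := (z - x) *m Q in
        (Om z <-> g (\row_(i < n) y 0 (lift ord_max i)) < y 0 ord_max)].

Definition groger_model (R : realType) (n : nat) (j : 'I_3)
    : set 'rV[R]_n.+2 :=
  let E2 := [set z : 'rV[R]_n.+2 | enorm z < 1 /\ z 0 ord_max <= 0] in
  match val j with
  | 0 => [set z | enorm z < 1 /\ z 0 ord_max < 0]
  | 1 => E2
  | _ => E2 `&` [set z | z 0 ord_max < 0 \/ 0 < z 0 ord0]
  end.

Definition bilipschitz_on (R : realType) (n : nat) (U : set 'rV[R]_n)
    (Phi : 'rV[R]_n -> 'rV[R]_n) : Prop :=
  exists2 L : R, 0 < L & forall x y, U x -> U y ->
    L^-1 * enorm (x - y) <= enorm (Phi x - Phi y) <= L * enorm (x - y).

Definition groger_regular (R : realType) (n : nat) (G : set 'rV[R]_n.+2)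
    : Prop :=
  bounded_set G /\
  forall x, boundary G x ->
  exists (U : set 'rV[R]_n.+2) (Phi : 'rV[R]_n.+2 -> 'rV[R]_n.+2),
  [/\ open U, U x, bilipschitz_on U Phi, open (Phi @` U) &
      Phi x = 0 /\ exists j : 'I_3, Phi @` (U `&` G) = groger_model j].

(* Functions are not identified a.e.: [Lpnorm] is a seminorm. *)

Definition Lpnorm d (T : measurableType d) (R : realType)
    (mu : {measure set T -> \bar R}) (A : set T) (p : R) (f : T -> R)
    : \bar R :=
  'N[mu]_p%:E[EFin \o (f \_ A)].

Definition Lp d (T : measurableType d) (R : realType)
    (mu : {measure set T -> \bar R}) (A : set T) (p : R) : set (T -> R) :=
  [set f | measurable_fun A f /\ (Lpnorm mu A p f < +oo)%E].

(* An element of W^{1,p}(Om) is the pair of a function and its weak gradient,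
   which that function determines up to a null set. *)

Definition sob (R : realType) (n : nat) : lmodType R :=
  (('rV[R]_n.+1 -> R) * ('rV[R]_n.+1 -> 'rV[R]_n.+1))%type.

Definition sfun (R : realType) (n : nat) (w : sob R n) : 'rV[R]_n.+1 -> R :=
  w.1.

Definition sgrad (R : realType) (n : nat) (w : sob R n)
    : 'rV[R]_n.+1 -> 'rV[R]_n.+1 :=
  w.2.

Definition weak_gradient (R : realType) (n : nat) (Om : set 'rV[R]_n.+1)
    (w : 'rV[R]_n.+1 -> R) (g : 'rV[R]_n.+1 -> 'rV[R]_n.+1) : Prop :=
  forall phi, smooth phi -> compactly_supported_in Om phi -> forall i,
    (\int[leb R n]_(x in Om) (w x * partial i phi x)%:E =
     - \int[leb R n]_(x in Om) (g x 0 i * phi x)%:E)%E.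

Definition W1 (R : realType) (n : nat) (Om : set 'rV[R]_n.+1) (p : R)
    : set (sob R n) :=
  [set w : sob R n |
     [/\ Lp (leb R n) Om p (sfun w),
         forall i, Lp (leb R n) Om p (fun x => sgrad w x 0 i) &
         weak_gradient Om (sfun w) (sgrad w)]].

Definition W1norm (R : realType) (n : nat) (Om : set 'rV[R]_n.+1) (p : R)
    (w : sob R n) : \bar R :=
  ((Lpnorm (leb R n) Om p (sfun w) `^ p +
    Lpnorm (leb R n) Om p (fun x => enorm (sgrad w x)) `^ p) `^ p^-1)%E.

Definition classical_sob (R : realType) (n : nat) (phi : 'rV[R]_n.+1 -> R)
    : sob R n :=
  (phi, fun x => \row_i partial i phi x).

(* h is the trace of w on a part G of the boundary: the trace operator is the
   continuous extension, from W^{1,1}(Om) to L^1(G), of the restriction to G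
   of functions smooth up to the boundary. *)
Definition is_trace (R : realType) (n : nat) (Om G : set 'rV[R]_n.+2)
    (w : sob R n.+1) (h : 'rV[R]_n.+2 -> R) : Prop :=
  [/\ W1 Om 1 w, Lp (surf R n) G 1 h &
   exists phi : nat -> 'rV[R]_n.+2 -> R,
   [/\ forall k, smooth (phi k),
       W1norm Om 1 (w - classical_sob (phi k)) @[k --> \oo] --> 0%E &
       Lpnorm (surf R n) G 1 (fun x => phi k x - h x) @[k --> \oo] --> 0%E]].

Definition W1D (R : realType) (n : nat) (Om Gt : set 'rV[R]_n.+2) (p : R)
    : set (sob R n.+1) :=
  [set w | W1 Om p w /\ is_trace Om Gt w (fun=> 0)].

Definition conj_exp (R : realType) (p : R) : R := p / (p - 1).

Definition dual_norm (R : realType) (n : nat) (Om Gt : set 'rV[R]_n.+2)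
    (p : R) (f : sob R n.+1 -> R) : \bar R :=
  ereal_sup [set `|f v|%:E | v in
    [set v | W1D Om Gt (conj_exp p) v /\ (W1norm Om (conj_exp p) v <= 1)%E]].

(* W^{-1,p}(Om) *)
Definition Wdual (R : realType) (n : nat) (Om Gt : set 'rV[R]_n.+2) (p : R)
    : set (sob R n.+1 -> R) :=
  [set f | (forall (a : R) (v w : sob R n.+1),
              W1D Om Gt (conj_exp p) v -> W1D Om Gt (conj_exp p) w ->
              f (a *: v + w) = a * f v + f w) /\
           (dual_norm Om Gt p f < +oo)%E].

(* Sobolev-Slobodeckij norm of W^{theta,p}(G), theta = 1 - 1/p, for G of
   dimension n.+1 *)
Definition slob_norm (R : realType) (n : nat) (G : set 'rV[R]_n.+2) (p : R)
    (h : 'rV[R]_n.+2 -> R) : \bar R :=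
  let theta := 1 - p^-1 in
  ((\int[surf R n]_(x in G) (`|h x| `^ p)%:E +
    \int[surf R n]_(x in G) \int[surf R n]_(y in G)
      (`|h x - h y| `^ p / enorm (x - y) `^ (n.+1%:R + theta * p))%:E)
   `^ p^-1)%E.

Definition Wtrace (R : realType) (n : nat) (G : set 'rV[R]_n.+2) (p : R)
    : set ('rV[R]_n.+2 -> R) :=
  [set h | measurable_fun (G : set (surfT R n)) (h : surfT R n -> R) /\
           (slob_norm G p h < +oo)%E].

Definition total_variation (R : realType) (n : nat) (Om : set 'rV[R]_n.+1)
    (u : 'rV[R]_n.+1 -> R) : \bar R :=
  ereal_sup [set (\int[leb R n]_(x in Om)
                    (u x * \sum_i partial i (Phi i) x)%:E)%E | Phi in
    [set Phi : 'I_n.+1 -> 'rV[R]_n.+1 -> R |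
      (forall i, Ck 1 (Phi i) /\ compactly_supported_in Om (Phi i)) /\
      (forall x, \sum_i Phi i x ^+ 2 <= 1)]].

Definition BV (R : realType) (n : nat) (Om : set 'rV[R]_n.+1)
    : set ('rV[R]_n.+1 -> R) :=
  [set u | Lp (leb R n) Om 1 u /\ (total_variation Om u < +oo)%E].

Definition Uad (R : realType) (n : nat) (Om : set 'rV[R]_n.+1) (ul uu : R)
    : set ('rV[R]_n.+1 -> R) :=
  [set u | BV Om u /\ {ae leb R n, forall x, Om x -> ul <= u x <= uu}].

Definition dform (R : realType) (n : nat) (Om : set 'rV[R]_n.+1)
    (c : 'rV[R]_n.+1 -> R) (w v : sob R n) : \bar R :=
  (\int[leb R n]_(x in Om) (c x * dot (sgrad w x) (sgrad v x))%:E)%E.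

(* Harmonic functions with value fD on Gt. As the test functions vanish on Gt
   only, the weak formulation contains the homogeneous Neumann condition on
   the rest of the boundary. *)
Definition is_lift (R : realType) (n : nat) (Om Gt : set 'rV[R]_n.+2) (p : R)
    (fD : 'rV[R]_n.+2 -> R) (w : sob R n.+1) : Prop :=
  [/\ W1 Om p w, is_trace Om Gt w fD &
      forall v, W1D Om Gt (conj_exp p) v -> dform Om (fun=> 1) w v = 0%E].

Definition lift_wellposed (R : realType) (n : nat)
    (Om Gt : set 'rV[R]_n.+2) : Prop :=
  forall p : R, 1 < p ->
    (forall fD, Wtrace Gt p fD ->
       exists2 w, is_lift Om Gt p fD w &
       forall w', is_lift Om Gt p fD w' -> W1norm Om p (w' - w) = 0%E) /\
    exists C : R, forall fD w, Wtrace Gt p fD -> is_lift Om Gt p fD w ->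
      (W1norm Om p w <= C%:E * slob_norm Gt p fD)%E.

Definition is_state (R : realType) (n : nat) (Om Gt : set 'rV[R]_n.+2)
    (ft : sob R n.+1) (f : sob R n.+1 -> R) (u : 'rV[R]_n.+2 -> R)
    (y : sob R n.+1) : Prop :=
  [/\ W1 Om 2 y, W1D Om Gt 2 (y - ft) &
      forall v, W1D Om Gt 2 v -> dform Om u y v = (f v)%:E].

(* [state], [dstate] and [d2state] are S(u), S'(u)[phi] = z_{u,phi} and
   z_{u,phi,psi}: the solution (unique up to a null set) picked by [xget]. *)
Definition state (R : realType) (n : nat) (Om Gt : set 'rV[R]_n.+2)
    (ft : sob R n.+1) (f : sob R n.+1 -> R) (u : 'rV[R]_n.+2 -> R)
    : sob R n.+1 :=
  xget 0 [set y | is_state Om Gt ft f u y].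

Definition is_dstate (R : realType) (n : nat) (Om Gt : set 'rV[R]_n.+2)
    (u : 'rV[R]_n.+2 -> R) (y : sob R n.+1) (phi : 'rV[R]_n.+2 -> R)
    (z : sob R n.+1) : Prop :=
  W1D Om Gt 2 z /\
  forall v, W1D Om Gt 2 v -> dform Om u z v = (- dform Om phi y v)%E.

Definition dstate (R : realType) (n : nat) (Om Gt : set 'rV[R]_n.+2)
    (ft : sob R n.+1) (f : sob R n.+1 -> R) (u phi : 'rV[R]_n.+2 -> R)
    : sob R n.+1 :=
  xget 0 [set z | is_dstate Om Gt u (state Om Gt ft f u) phi z].

Definition is_d2state (R : realType) (n : nat) (Om Gt : set 'rV[R]_n.+2)
    (u : 'rV[R]_n.+2 -> R) (zphi zpsi : sob R n.+1)
    (phi psi : 'rV[R]_n.+2 -> R) (z : sob R n.+1) : Prop :=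
  W1D Om Gt 2 z /\
  forall v, W1D Om Gt 2 v ->
    dform Om u z v = (- dform Om psi zphi v - dform Om phi zpsi v)%E.

Definition d2state (R : realType) (n : nat) (Om Gt : set 'rV[R]_n.+2)
    (ft : sob R n.+1) (f : sob R n.+1 -> R) (u phi psi : 'rV[R]_n.+2 -> R)
    : sob R n.+1 :=
  xget 0 [set z | is_d2state Om Gt u (dstate Om Gt ft f u phi)
                    (dstate Om Gt ft f u psi) phi psi z].

Definition regularity_exponent (R : realType) (n : nat)
    (Om Gt : set 'rV[R]_n.+2) (ul uu s : R) : Prop :=
  2 < s /\
  forall sg : R, 2 <= sg <= s -> exists2 C : R, 0 <= C &
  forall f fD ft u y, Wdual Om Gt sg f -> Wtrace Gt sg fD ->
    is_lift Om Gt sg fD ft -> Uad Om ul uu u -> is_state Om Gt ft f u y ->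
    (W1norm Om sg y <=
       C%:E * (slob_norm Gt sg fD + dual_norm Om Gt sg f))%E.

(* A normed space is presented by a vector
   space [sn_car], the subspace [sn_dom] of its representatives and a seminorm
   [sn_norm], two representatives being identified when the seminorm of their
   difference vanishes. *)

Record seminormed (R : realType) := Seminormed {
  sn_car :> lmodType R;
  sn_dom : set sn_car;
  sn_norm : sn_car -> \bar R }.

Definition LpS (R : realType) (n : nat) (Om : set 'rV[R]_n.+1) (p : R)
    : seminormed R :=
  @Seminormed R ('rV[R]_n.+1 -> R : lmodType R)
    (Lp (leb R n) Om p) (Lpnorm (leb R n) Om p).

Definition W1S (R : realType) (n : nat) (Om : set 'rV[R]_n.+1) (p : R)
    : seminormed R :=
  @Seminormed R (sob R n) (W1 Om p) (W1norm Om p).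

Definition bounded_linear_op (R : realType) (X Y : seminormed R)
    : set (X -> Y) :=
  [set L | [/\ forall x, sn_dom x -> sn_dom (L x),
     forall (a : R) (x y : X), sn_dom x -> sn_dom y ->
       sn_norm (L (a *: x + y) - (a *: L x + L y)) = 0%E &
     exists C : R, forall x, sn_dom x ->
       (sn_norm (L x) <= C%:E * sn_norm x)%E]].

Definition op_norm (R : realType) (X Y : seminormed R) (L : X -> Y)
    : \bar R :=
  ereal_sup [set sn_norm (L x) | x in
              [set x : X | sn_dom x /\ (sn_norm x <= 1)%E]].

(* L(X, Y) *)
Definition opS (R : realType) (X Y : seminormed R) : seminormed R :=
  @Seminormed R (X -> Y : lmodType R) (@bounded_linear_op R X Y)
    (@op_norm R X Y).

(* The filter ||phi|| -> 0 along phi != 0 with u + phi in U *)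
Definition feasible_to0 (R : realType) (X : seminormed R) (U : set X) (u : X)
    : set_system X :=
  filter_from [set d : R | 0 < d]
    (fun d => [set phi : X | U (u + phi) /\
                             (0 < sn_norm phi)%E /\ (sn_norm phi < d%:E)%E]).

Definition frechet_feasible (R : realType) (X Z : seminormed R) (U : set X)
    (T : X -> Z) (u : X) (T' : X -> Z) : Prop :=
  [/\ forall v, U v -> sn_dom (T v),
      bounded_linear_op T' &
      (sn_norm (T (u + phi) - T u - T' phi)%R / sn_norm phi)%E
        @[phi --> feasible_to0 U u] --> 0%E].

(* Main.v *)
(* Let y = S(u). Data in L^p with 2 <= p <= s give gradients in L^p, by the
   regularity estimate, and grad y is in L^s. A gradient in L^p times
   a function in L^m is data in L^r, 1/r = 1/p + 1/m, which is admissible as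
   long as 1/r <= 1/2. The remainder
     r = S'(u + phi)[psi] - S'(u)[psi] - z_{u,phi,psi}
   solves the equation at u with data
     psi grad (S(u + phi) - y - z_{u,phi}) + phi grad (S'(u + phi)[psi] - z_{u,psi}),
   and each of the two terms is a product of the form phi phi psi grad. Hence
     ||r|| <= K ||phi||_m ||phi||_qt ||psi||_qt  if  1/m + 2/qt + 1/s <= 1/2.
   As qt > 4s/(s - 2), that is 2/qt + 1/s < 1/2, there is such an m >= qt.
   Feasible increments are bounded by uu, so that interpolation gives
   ||phi||_m <= C ||phi||_qt^(qt/m), which tends to 0.
   The solutions exist by the theorem of Lax and Milgram; the regularity estimate
   contains the Poincare inequality that coercivity in W^{1,2} requires. *)

Require Import Defs.
From HB Require Import structures.
From mathcomp Require Import all_boot all_order all_algebra.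
From mathcomp Require Import all_classical all_reals all_analysis.
From mathcomp Require Import measurable_realfun.
From mathcomp Require Import lra ring.
Set Implicit Arguments.
Unset Strict Implicit.
Unset Printing Implicit Defensive.

Import Order.TTheory GRing.Theory Num.Theory.
Import numFieldNormedType.Exports.

Local Open Scope classical_set_scope.
Local Open Scope ring_scope.

(** * Lebesgue spaces *)

(** In the difference quotient one factor ||phi||_qt and the factor ||psi||_qt cancel, and what is
    left has to tend to 0. Three factors in L^qt would require 3/qt + 1/s <= 1/2, that is qt >=
    6s/(s - 2), whereas the second derivative itself gets by with 2/qt + 1/s <= 1/2. So the surplus
    factor has to be cheaper: it is measured in L^m with m large. This is possible for phi, which is
    bounded as a difference of admissible controls, but not for the arbitrary direction psi. The
    regularity estimate speaks of states only. It reaches the derivatives because they are states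
    for zero boundary values and a functional v -> - <h, grad v>. Its constant does not depend on
    the control, so that it holds at u + phi as well. Functions are not identified almost everywhere
    and solutions are chosen representatives. Linearity and uniqueness are therefore statements
    about seminorms of differences, and the Hilbert space argument is run for a semidefinite form.
    Traces are limits of smooth functions, so that continuous functions have to be measurable for
    the volume and for the surface measure, both built from outer measures. *)

Section Lp_spaces.
Context d (T : measurableType d) (R : realType).
Variables (mu : {measure set T -> \bar R}) (A : set T).
Hypothesis mA : measurable A.
Implicit Types (f g : T -> R) (p q r : R).

Lemma Lpnorm_ge0 p f : (0 <= Lpnorm mu A p f)%E.
Proof. exact: Lnorm_ge0. Qed.

Lemma LpnormE p f : p != 0 -> (Lpnorm mu A p f =
  (\int[mu]_(x in A) (`|f x| `^ p)%:E) `^ p^-1)%E.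
Proof.
move=> p0; rewrite /Lpnorm unlock [in RHS]integral_mkcond; congr poweR.
apply: eq_integral => x _; rewrite /= !patchE.
by case: ifPn => // _; rewrite normr0 powR0.
Qed.

Lemma measurable_norm_powR p f :
  measurable_fun A f -> measurable_fun A (fun x => `|f x| `^ p).
Proof.
move=> mf; apply: (measurableT_comp (measurable_powR p)).
exact: measurableT_comp.
Qed.

Lemma Lpnorm_pow p f : p != 0 ->
  (Lpnorm mu A p f `^ p = \int[mu]_(x in A) (`|f x| `^ p)%:E)%E.
Proof.
move=> p0; rewrite LpnormE// -poweRrM mulVf// poweRe1//.
by apply: integral_ge0 => x _; rewrite lee_fin powR_ge0.
Qed.

Lemma le_Lpnorm_ae p f g : 0 < p -> measurable_fun A f -> measurable_fun A g ->
  {ae mu, forall x, A x -> `|f x| <= `|g x|} ->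
  (Lpnorm mu A p f <= Lpnorm mu A p g)%E.
Proof.
move=> p0 mf mg fg; have pN0 : p != 0 by rewrite gt_eqF.
rewrite !(LpnormE _ pN0).
have i0 (h : T -> R) : (0 <= \int[mu]_(x in A) (`|h x| `^ p)%:E)%E.
  by apply: integral_ge0 => x _; rewrite lee_fin powR_ge0.
apply: gt0_ler_poweR; first by rewrite invr_ge0 ltW.
- by rewrite in_itv/= i0 leey.
- by rewrite in_itv/= i0 leey.
apply: ae_ge0_le_integral; first exact: mA.
- by move=> x _; rewrite lee_fin powR_ge0.
- by apply/measurable_EFinP; exact: measurable_norm_powR.
- by move=> x _; rewrite lee_fin powR_ge0.
- by apply/measurable_EFinP; exact: measurable_norm_powR.
apply: filterS fg => x fg Ax; rewrite lee_fin.
by apply: ge0_ler_powR; rewrite ?nnegrE ?normr_ge0 ?(ltW p0)//; exact: fg.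
Qed.

Lemma eq_Lpnorm p f g : (forall x, A x -> `|f x| = `|g x|) ->
  p != 0 -> Lpnorm mu A p f = Lpnorm mu A p g.
Proof.
move=> fg p0; rewrite !(LpnormE _ p0).
by apply: (f_equal (fun z => poweR z p^-1)); apply: eq_integral => x /set_mem /fg ->.
Qed.

Lemma Lpnorm_cst0 p : p != 0 -> Lpnorm mu A p (fun=> 0) = 0%E.
Proof.
move=> p0; rewrite LpnormE// integral0_eq ?poweR0r ?invr_neq0// => x _.
by rewrite normr0 powR0.
Qed.

Lemma LpnormZ p a f : 0 < p -> measurable_fun A f ->
  (Lpnorm mu A p (fun x => a * f x)%R = `|a|%:E * Lpnorm mu A p f)%E.
Proof.
move=> p0 mf; have pN0 : p != 0 by rewrite gt_eqF.
rewrite !(LpnormE _ pN0).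
under eq_integral do rewrite normrM powRM// EFinM.
rewrite ge0_integralZl//; last first.
  by apply/measurable_EFinP; exact: measurable_norm_powR.
rewrite poweRM ?lee_fin ?powR_ge0//; last first.
  by apply: integral_ge0 => x _; rewrite lee_fin powR_ge0.
by rewrite poweR_EFin -powRrM mulfV ?gt_eqF// powRr1.
Qed.

Lemma LpnormD p f g : 1 <= p -> measurable_fun A f -> measurable_fun A g ->
  (Lpnorm mu A p (fun x => (f x + g x)%R) <=
   Lpnorm mu A p f + Lpnorm mu A p g)%E.
Proof.
move=> p1 /(measurable_restrictT _ mA) mf /(measurable_restrictT _ mA) mg.
rewrite /Lpnorm (_ : (fun x => _) \_ A = (f \_ A \+ g \_ A)%R).
  exact: minkowski_EFin.
by apply/funext => x; rewrite /= !patchE; case: ifPn => // _; rewrite addr0.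
Qed.

(** Hölder's inequality for the conjugate exponents [p / r] and [q / r], applied to [|f| ^ r] and
    [|g| ^ r]. *)
Lemma LpnormM r p q f g : 0 < r -> 0 < p -> 0 < q -> p^-1 + q^-1 = r^-1 ->
  measurable_fun A f -> measurable_fun A g ->
  (Lpnorm mu A r (fun x => (f x * g x)%R) <=
   Lpnorm mu A p f * Lpnorm mu A q g)%E.
Proof.
move=> r0 p0 q0 pq mf mg.
have pr0 : 0 < p / r by rewrite divr_gt0.
have qr0 : 0 < q / r by rewrite divr_gt0.
have pqr : (p / r)^-1 + (q / r)^-1 = 1.
  by rewrite !invf_div -mulrDr pq divff// gt_eqF.
have m1 := (measurable_restrictT _ mA).1 (measurable_norm_powR r mf).
have m2 := (measurable_restrictT _ mA).1 (measurable_norm_powR r mg).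
have key (h : T -> R) (t : R) : 0 < t ->
    ('N[mu]_(t / r)%:E[EFin \o ((fun x => `|h x| `^ r)%R \_ A)] =
     Lpnorm mu A t h `^ r)%E.
  move=> t0; rewrite -[LHS]/(Lpnorm mu A (t / r) (fun x => `|h x| `^ r)).
  rewrite !LpnormE ?gt_eqF// ?divr_gt0// -poweRrM invf_div [(_ / t)%R]mulrC.
  apply: (f_equal (fun z => poweR z _)); apply: eq_integral => x _.
  by rewrite ger0_norm ?powR_ge0// -powRrM mulrC divfK ?gt_eqF.
have := hoelder mu m1 m2 pr0 qr0 pqr.
rewrite !key// -poweRM ?Lpnorm_ge0// Lnorm1.
rewrite (_ : (\int[mu]_x _)%E = Lpnorm mu A r (fun x => (f x * g x)%R) `^ r)%E.
  move=> H.
  have /(gt0_ler_poweR (r := r^-1)) := H; rewrite -!poweRrM !mulfV ?gt_eqF//.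
  rewrite !poweRe1 ?mule_ge0 ?Lpnorm_ge0//; apply.
  - by rewrite invr_ge0 ltW.
  - by rewrite in_itv/= leey poweR_ge0.
  - by rewrite in_itv/= leey poweR_ge0.
rewrite Lpnorm_pow ?gt_eqF// [RHS]integral_mkcond; apply: eq_integral => x _.
rewrite /= !patchE; case: ifPn => _; last by rewrite mul0r normr0.
by rewrite ger0_norm ?mulr_ge0 ?powR_ge0// normrM powRM.
Qed.

Lemma LpD p f g : 1 <= p -> Lp mu A p f -> Lp mu A p g ->
  Lp mu A p (fun x => f x + g x).
Proof.
move=> p1 [mf fp] [mg gp]; split; first exact: measurable_funD.
by apply: le_lt_trans (LpnormD p1 mf mg) _; rewrite lte_add_pinfty.
Qed.

Lemma LpZ p a f : 0 < p -> Lp mu A p f -> Lp mu A p (fun x => a * f x).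
Proof.
move=> p0 [mf fp]; split; first exact: measurable_funM.
by rewrite LpnormZ// lte_mul_pinfty.
Qed.

Lemma Lp0 p : p != 0 -> Lp mu A p (fun=> 0).
Proof. by move=> p0; split; [exact: measurable_cst|rewrite Lpnorm_cst0]. Qed.

Lemma LpM r p q f g : 0 < r -> 0 < p -> 0 < q -> p^-1 + q^-1 = r^-1 ->
  Lp mu A p f -> Lp mu A q g -> Lp mu A r (fun x => f x * g x).
Proof.
move=> r0 p0 q0 pqr [mf fp] [mg gq]; split; first exact: measurable_funM.
apply: le_lt_trans (LpnormM r0 p0 q0 pqr mf mg) _.
by rewrite lte_mul_pinfty// ?Lpnorm_ge0// ge0_fin_numE// Lpnorm_ge0.
Qed.

Lemma Lp_le_ae p f g : 0 < p -> measurable_fun A f -> Lp mu A p g ->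
  {ae mu, forall x, A x -> `|f x| <= `|g x|} -> Lp mu A p f.
Proof.
move=> p0 mf [mg gp] fg; split => //.
exact: le_lt_trans (le_Lpnorm_ae p0 mf mg fg) gp.
Qed.

Lemma Lpnorm_fin_num p f : Lp mu A p f -> Lpnorm mu A p f \is a fin_num.
Proof. by move=> [_ fp]; rewrite ge0_fin_numE// Lpnorm_ge0. Qed.

Lemma Lpnorm1 f : Lpnorm mu A 1 f = (\int[mu]_(x in A) `|f x|%:E)%E.
Proof.
rewrite LpnormE ?oner_neq0// invr1 poweRe1; last first.
  by apply: integral_ge0 => x _; rewrite lee_fin powR_ge0.
by apply: eq_integral => x _; rewrite powRr1.
Qed.

Lemma Lp1_integrable f : Lp mu A 1 f -> mu.-integrable A (EFin \o f).
Proof.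
move=> [mf f1]; apply/integrableP; split; first exact/measurable_EFinP.
by rewrite Lpnorm1 in f1.
Qed.

Lemma integrable_Lp1 f : mu.-integrable A (EFin \o f) -> Lp mu A 1 f.
Proof.
move=> /integrableP[mf f1]; split; first exact/measurable_EFinP.
by rewrite Lpnorm1.
Qed.

Lemma normr_fine_integral_le f : Lp mu A 1 f ->
  `|fine (\int[mu]_(x in A) (f x)%:E)| <= fine (Lpnorm mu A 1 f).
Proof.
move=> f1; have if1 := Lp1_integrable f1.
have Ifin := integrable_fin_num mA if1.
rewrite -lee_fin -fine_abse// fineK ?abse_fin_num// fineK ?Lpnorm_fin_num//.
by rewrite Lpnorm1; apply: le_abse_integral => //; exact/measurable_EFinP/f1.1.
Qed.

Hypothesis finA : (mu A < +oo)%E.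

Lemma Lpnorm_cst p (a : R) : 0 < p ->
  (Lpnorm mu A p (fun=> a) = `|a|%:E * mu A `^ p^-1)%E.
Proof.
move=> p0; rewrite LpnormE ?gt_eqF// integral_cst// poweRM ?lee_fin ?powR_ge0//.
by rewrite poweR_EFin -powRrM mulfV ?gt_eqF// powRr1.
Qed.

(** Hölder against the constant 1, whose exponent is [(p^-1 - q^-1)^-1]; for [p = q] this exponent
    would be infinite, hence the separate case. *)
Lemma Lpnorm_subset p q f : 0 < p -> p <= q -> measurable_fun A f ->
  (Lpnorm mu A p f <=
   Lpnorm mu A q f * (fine (mu A) `^ (p^-1 - q^-1))%:E)%E.
Proof.
move=> p0; rewrite le_eqVlt => /predU1P[<- mf|pq mf].
  by rewrite subrr powRr0 mule1.
have q0 := lt_trans p0 pq.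
have t0 : 0 < p^-1 - q^-1 by rewrite subr_gt0 ltf_pV2.
have := LpnormM (r := p) (p := q) (q := (p^-1 - q^-1)^-1) p0 q0 _ _ mf
  (measurable_cst (1 : R)).
rewrite invrK subrKC invr_gt0 => /(_ t0 erefl).
rewrite Lpnorm_cst ?invr_gt0// normr1 mul1e invrK.
rewrite -fine_poweR fineK//; last by rewrite fin_num_poweR// ge0_fin_numE.
apply: le_trans; rewrite le_eqVlt; apply/orP; left; apply/eqP.
by apply: eq_Lpnorm => [x _|]; rewrite ?mulr1 ?gt_eqF.
Qed.

Lemma Lp_subset p q f : 0 < p -> p <= q -> Lp mu A q f -> Lp mu A p f.
Proof.
move=> p0 pq [mf fq]; split => //.
apply: le_lt_trans (Lpnorm_subset p0 pq mf) _.
by rewrite lte_mul_pinfty ?Lpnorm_ge0// ?ltry// ge0_fin_numE// Lpnorm_ge0.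
Qed.

(** Pointwise [|f| ^ q <= M ^ (q - p) * |f| ^ p]. For bounded functions a small norm in L^p thus
    makes the norm in the smaller space L^q small, which Hölder alone cannot do. *)
Lemma Lpnorm_interpolation p q (M : R) f : 0 < p -> p <= q -> 0 <= M ->
  measurable_fun A f -> {ae mu, forall x, A x -> `|f x| <= M} ->
  (Lpnorm mu A q f <= (M `^ (1 - p / q))%:E * Lpnorm mu A p f `^ (p / q))%E.
Proof.
move=> p0 pq M0 mf fM; have q0 := lt_le_trans p0 pq.
have -> : (1 - p / q = (q - p) * q^-1)%R by rewrite mulrBl divff ?gt_eqF.
rewrite powRrM -poweR_EFin poweRrM -poweRM ?poweR_ge0 ?lee_fin ?powR_ge0//.
rewrite Lpnorm_pow ?gt_eqF// LpnormE ?gt_eqF//.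
have i0 t : (0 <= \int[mu]_(x in A) (`|f x| `^ t)%:E)%E.
  by apply: integral_ge0 => x _; rewrite lee_fin powR_ge0.
have mfp t : measurable_fun A (fun x => (`|f x| `^ t)%:E).
  by apply/measurable_EFinP; exact: measurable_norm_powR.
apply: gt0_ler_poweR; rewrite ?in_itv/= ?leey ?i0 ?invr_ge0 ?(ltW q0)//.
  by rewrite mule_ge0// lee_fin powR_ge0.
rewrite -ge0_integralZl//; last by rewrite lee_fin powR_ge0.
apply: ae_ge0_le_integral => //.
- by move=> x _; rewrite mule_ge0// lee_fin powR_ge0.
- exact: measurable_funeM.
apply: filterS fM => x fM /fM{}fM; rewrite -EFinM lee_fin.
have [f0|f0] := eqVneq `|f x| 0.
  by rewrite f0 powR0 ?gt_eqF// mulr_ge0// powR_ge0.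
have -> : `|f x| `^ q = `|f x| `^ (q - p) * `|f x| `^ p.
  by rewrite -powRD ?subrK// f0 implybT.
rewrite ler_wpM2r ?powR_ge0//.
by rewrite ge0_ler_powR// ?nnegrE// subr_ge0.
Qed.

End Lp_spaces.

(** * Open sets are Lebesgue and Hausdorff measurable *)

Section caratheodory_halfspaces.
Context (R : realType) (m : nat)
  (mu : {outer_measure set 'rV[R]_m.+1 -> \bar R}).
Hypothesis mu_halfspace : forall i c, mu.-caratheodory [set x | x 0 i < c].

Let cube (q : 'rV[rat]_m.+1) (k : nat) : set 'rV[R]_m.+1 :=
  \bigcap_(i in [set: 'I_m.+1])
    ([set x | x 0 i < ratr (q 0 i) + k.+1%:R^-1] `&`
     ~` [set x | x 0 i < ratr (q 0 i) - k.+1%:R^-1]).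

Let measurable_cube q k : mu.-cara.-measurable (cube q k).
Proof.
apply: fin_bigcap_measurable => // i _; apply: measurableI.
  exact: mu_halfspace.
by apply: measurableC; exact: mu_halfspace.
Qed.

(** An open set is the union of the half-open cubes with rational centre and radius [1 / (k + 1)]
    that it contains. They form a countable family, and each is a finite intersection of half-spaces
    and complements of half-spaces. *)
Lemma open_caratheodory (U : set 'rV[R]_m.+1) :
  open U -> mu.-cara.-measurable U.
Proof.
move=> oU.
pose F (qk : 'rV[rat]_m.+1 * nat) : set 'rV[R]_m.+1 :=
  if `[< cube qk.1 qk.2 `<=` U >] then cube qk.1 qk.2 else set0.
have -> : U = \bigcup_qk F qk.
  apply/seteqP; split => [x Ux|x [qk _]]; last first.
    by rewrite /F; case: ifPn => // /asboolP; apply.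
  have [e /= e0 xeU] : nbhs_ball x U.
    by apply/nbhs_ballP; apply: open_nbhs_nbhs.
  (* The centre will be within the radius of [x], so a radius below [e / 2] keeps the whole cube in
     the ball of radius [e]. *)
  have [k ke] : exists k, (k.+1%:R^-1 : R) < e / 2.
    have e20 : 0 < (e / 2)^-1 by rewrite invr_gt0 divr_gt0.
    exists (Num.truncn (e / 2)^-1).
    rewrite invf_plt ?posrE ?divr_gt0//.
    by rewrite truncnS_gt.
  have qP i : exists q, ratr q \in `](x 0 i - k.+1%:R^-1), (x 0 i + k.+1%:R^-1)[.
    by apply: rat_in_itvoo; rewrite ltrBlDr -addrA ltrDl addr_gt0 ?invr_gt0.
  have {qP}[q qP] := choice qP.
  exists (\row_i q i, k) => //; rewrite /F ifT/=; last first.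
    apply/asboolP => y yC; apply: xeU.
    split => // a i; rewrite ord1 /ball/=.
    have := qP i; rewrite in_itv/= => /andP[q1 q2].
    have [/=] := yC i Logic.I; rewrite mxE => y1 /negP; rewrite -leNgt => y2.
    move: (x 0 i) (y 0 i) (ratr _) (_^-1) ke q1 q2 y1 y2 => x0 y0 q0 r.
    by move=> *; rewrite ltr_norml; apply/andP; split; lra.
  move=> i _ /=; have := qP i; rewrite in_itv/= mxE => /andP[q1 q2].
  by split; [rewrite -ltrBlDr|apply/negP; rewrite -leNgt lerBlDr ltW].
apply: countable_bigcupT_measurable; first exact: countableP.
by move=> qk; rewrite /F; case: ifPn => // _; exact: measurable_cube.
Qed.

Lemma continuous_caratheodory (f : 'rV[R]_m.+1 -> R) :
  continuous f -> measurable_fun setT (f : caratheodory_type mu -> R).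
Proof.
move=> cf mT; apply: (measurability _ (RGenOInfty.measurableE R)) => //.
move=> _ [_ [c ->] <-]; rewrite setTI; apply: open_caratheodory.
by apply: open_comp => [x _|]; [exact: cf|exact: interval_open].
Qed.

End caratheodory_halfspaces.

(** Cutting each member of a cover of [X] along [H] gives a cover of each of the two parts. *)
Lemma cover_outer_split (R : realType) (T : pointedType) (tau : set T -> \bar R)
    (H : set T) : (forall A, (0 <= tau A)%E) ->
  (forall A, (tau (A `&` H) + tau (A `&` ~` H) <= tau A)%E) ->
  forall X, (cover_outer tau (X `&` H) + cover_outer tau (X `&` ~` H) <=
             cover_outer tau X)%E.
Proof.
move=> tau_ge0 tauH X; apply: le_ereal_inf_tmp => _ [F XF <-].
apply: (@le_trans _ _
    (\sum_(k <oo) (tau (F k `&` H) + tau (F k `&` ~` H)))%E); last first.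
  by apply: lee_nneseries => // k _ _; rewrite adde_ge0.
rewrite nneseriesD//; apply: leeD.
  apply: ereal_inf_lbound; exists (fun k => F k `&` H) => // x [Xx Hx].
  by have [k _ Fx] := XF _ Xx; exists k.
apply: ereal_inf_lbound; exists (fun k => F k `&` ~` H) => // x [Xx Hx].
by have [k _ Fx] := XF _ Xx; exists k.
Qed.

Section lebesgue_borel.
Context (R : realType) (m : nat).
Implicit Types A : set 'rV[R]_m.+1.

Lemma box_volume_ge0 A : (0 <= box_volume A)%E.
Proof.
apply: le_ereal_inf_tmp => _ [[a b] [/= ab _] <-].
by rewrite lee_fin prodr_ge0// => i _; rewrite subr_ge0.
Qed.

Lemma box_volume_split (i : 'I_m.+1) (c : R) A :
  (box_volume (A `&` [set x | (x 0 i < c)%R]) +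
   box_volume (A `&` ~` [set x | (x 0 i < c)%R]) <= box_volume A)%E.
Proof.
apply: le_ereal_inf_tmp => _ [[a b] [/= ab Aab] <-].
(* The cut is clamped to the side of the box, so that both pieces are boxes even if the hyperplane
   misses it; one of them then has volume 0. *)
pose c' := Num.max (a 0 i) (Num.min (b 0 i) c).
pose upd (v : 'rV[R]_m.+1) := \row_j if j == i then c' else v 0 j.
have ac : a 0 i <= c' by rewrite le_max lexx.
have cb : c' <= b 0 i by rewrite ge_max ab ge_min lexx.
have upd_i v : upd v 0 i = c' by rewrite mxE eqxx.
have upd_j v j : j != i -> upd v 0 j = v 0 j by rewrite mxE => /negPf ->.
pose P := \prod_(j < m.+1 | j != i) (b 0 j - a 0 j).
have -> : (\prod_j (b 0 j - a 0 j) =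
    (\prod_j (upd b 0 j - a 0 j)) + \prod_j (b 0 j - upd a 0 j))%R.
  rewrite (bigD1 i)//= [X in _ = X + _](bigD1 i)//=.
  rewrite [X in _ = _ + X](bigD1 i)//= !upd_i -/P.
  rewrite (eq_bigr (fun j => b 0 j - a 0 j)) -/P; last first.
    by move=> j ji; rewrite upd_j.
  rewrite [in X in _ = _ + _ * X](eq_bigr (fun j => b 0 j - a 0 j)) -/P; last first.
    by move=> j ji; rewrite upd_j.
  by rewrite -mulrDl; congr (_ * _); ring.
rewrite EFinD; apply: leeD; apply: ereal_inf_lbound.
  exists (a, upd b) => //; split => /= [j|x [Ax /= xc] j].
    by have [->|ji] := eqVneq j i; rewrite ?upd_i ?upd_j.
  have /andP[ax xb] := Aab _ Ax j; rewrite ax/=.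
  have [ji|ji] := eqVneq j i; last by rewrite upd_j.
  by subst j; rewrite upd_i le_max le_min xb (ltW xc) orbT.
exists (upd a, b) => //; split => /= [j|x [Ax /negP]].
  by have [->|ji] := eqVneq j i; rewrite ?upd_i ?upd_j.
rewrite -leNgt => cx j; have /andP[ax xb] := Aab _ Ax j; rewrite xb andbT.
have [ji|ji] := eqVneq j i; last by rewrite upd_j.
by subst j; rewrite upd_i ge_max ax ge_min cx orbT.
Qed.

Lemma lebesgue_halfspace (i : 'I_m.+1) (c : R) :
  (@lebesgue_outer R m : {outer_measure set 'rV[R]_m.+1 -> \bar R}).-caratheodory
    [set x | x 0 i < c].
Proof.
apply: le_caratheodory_measurable => X.
by apply: cover_outer_split; [exact: box_volume_ge0|exact: box_volume_split].
Qed.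

Lemma open_lebesgue_measurable (U : set 'rV[R]_m.+1) :
  open U -> measurable (U : set (lebT R m)).
Proof. exact/open_caratheodory/lebesgue_halfspace. Qed.

Lemma continuous_lebesgue_measurable (f : 'rV[R]_m.+1 -> R) (A : set (lebT R m)) :
  continuous f -> measurable A -> measurable_fun A (f : lebT R m -> R).
Proof.
move=> cf mA; apply: (measurable_funS measurableT (@subsetT _ _)).
by apply: continuous_caratheodory; [exact: lebesgue_halfspace|exact: cf].
Qed.

Lemma bounded_lebesgue_lty (A : set 'rV[R]_m.+1) :
  bounded_set A -> (leb R m A < +oo)%E.
Proof.
move=> /ex_strict_bound_gt0[M M0 AM].
apply: (@le_lt_trans _ _ (\prod_(i < m.+1) (M - - M))%:E); last exact: ltry.
apply: (@le_trans _ _ (box_volume A)); last first.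
  apply: ereal_inf_lbound.
  exists (const_mx (- M), const_mx M) => /=; last first.
    by congr EFin; apply: eq_bigr => i _; rewrite !mxE.
  split => [i|x Ax i]; first by rewrite !mxE; lra.
  rewrite !mxE -ler_norml; apply: le_trans (ltW (AM _ Ax)).
  by rewrite [leRHS]/Num.norm/= mx_normrE; apply/bigmax_geP; right; exists (0, i).
pose F (k : nat) : set 'rV[R]_m.+1 := if k is 0 then A else set0.
have -> : box_volume A = (\sum_(k <oo) box_volume (F k))%E.
  rewrite nneseries_recl//; last by move=> k _; exact: box_volume_ge0.
  rewrite eseries_cond/= eseries0 ?adde0// => -[|k]//= _ _.
  apply/eqP; rewrite eq_le box_volume_ge0 andbT; apply: ereal_inf_lbound.
  exists (0, 0); first by split => // i.
  by rewrite big_ord_recl /= subrr mul0r.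
by apply: ereal_inf_lbound; exists F => // x Ax; exists 0%N.
Qed.

End lebesgue_borel.

(** * Metric outer measures and the Hausdorff measure *)

Section metric_outer_measure.
Context (R : realType) (T : Type) (nu : {outer_measure set T -> \bar R}).
Variable g : T -> R.
Hypothesis nu_separated : forall (A B : set T) (e : R), 0 < e ->
  (forall x y, A x -> B y -> g x + e <= g y) -> (nu A + nu B <= nu (A `|` B))%E.

(* Caratheodory's criterion: the sublevel set is exhausted by the sets
   [g <= c - 1/k] and the rings between them, every second ring being at
   positive distance from the previous ones. *)
Lemma metric_sublevel_caratheodory (c : R) :
  nu.-caratheodory [set x | g x < c].
Proof.
apply: le_caratheodory_measurable => X.
have [->|/eqP Xfin] := eqVneq (nu X) +oo%E; first by rewrite leey.
have {}Xfin : (nu X < +oo)%E by rewrite ltey; exact/eqP.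
pose a (k : nat) : R := c - k.+1%:R^-1.
have a_lt k : a k < a k.+1.
  by rewrite ltrD2l ltrN2 ltf_pV2 ?posrE// ltr_nat.
have a_le : {homo a : k l / (k <= l)%N >-> k <= l}.
  by apply: homo_leq => [x|x y z|k]; [exact: lexx|exact: le_trans|exact/ltW].
pose B k : set T := X `&` [set x | a k < g x <= a k.+1].
have rings p k : (\sum_(0 <= j < k) nu (B (j.*2 + p)%N) <=
    nu (X `&` [set x | (exists2 j, (j < k)%N &
                          a (j.*2 + p)%N < g x <= a (j.*2 + p).+1)%R]))%E.
  elim: k => [|k IH]; first by rewrite big_geq// outer_measure_ge0.
  rewrite big_nat_recr//=; apply: le_trans (leeD IH (lexx _)) _.
  (* At index 0 the predecessor is 0 again and there is no gap; but then no earlier ring exists, and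
     the first set is empty. *)
  have gap : 0 < a (k.*2 + p)%N - a (k.*2 + p).-1 \/ (k.*2 + p = 0)%N.
    case: (k.*2 + p)%N => [|l]; [by right|left; rewrite subr_gt0; exact: a_lt].
  have [{}gap|kp0] := gap.
    apply: le_trans (nu_separated (e := a (k.*2 + p)%N - a (k.*2 + p).-1) _ _) _.
    - exact: gap.
    - move=> x y [_ [j jk /andP[_ xj]]] [_ /andP[yk _]].
      have : a (j.*2 + p).+1 <= a (k.*2 + p).-1.
        apply: a_le; rewrite -ltnS prednK; last first.
          by rewrite lt0n; apply: contraTneq gap => ->; rewrite subrr ltxx.
        by rewrite -2!addSn -doubleS leq_add2r leq_double.
      by move: xj yk gap; move: (a _) (a _) (a _) => ? ? ?; lra.
    apply: le_outer_measure => x [[Xx [j jk xj]]|[Xx xk]]; split => //.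
      by exists j => //; rewrite ltnS ltnW.
    by exists k.
  have k0 : k = 0%N by move: kp0 => /eqP; rewrite addn_eq0 double_eq0 => /andP[/eqP].
  rewrite [X in (nu X + _)%E](_ : _ = set0) ?outer_measure0 ?add0e; last first.
    by apply/seteqP; split => // x [_ [j]]; rewrite k0.
  by apply: le_outer_measure => x [Xx xk]; split => //; exists k.
have ringsX p k : (\sum_(0 <= j < k) nu (B (j.*2 + p)%N) <= nu X)%E.
  by apply: le_trans (rings p k) _; apply: le_outer_measure => x [].
have sumB : (\sum_(0 <= k <oo) nu (B k) < +oo)%E.
  apply: (@le_lt_trans _ _ (nu X + nu X)%E); last by rewrite lte_add_pinfty.
  apply: lime_le.
    by apply: is_cvg_nneseries => k _ _; exact: outer_measure_ge0.
  apply: nearW => k.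
  apply: (@le_trans _ _ (\sum_(0 <= j < k.*2) nu (B j))%E).
    rewrite [leRHS](big_cat_nat (n := k))//=; last by rewrite -addnn leq_addr.
    by rewrite leeDl// sume_ge0// => j _; exact: outer_measure_ge0.
  have -> : (\sum_(0 <= j < k.*2) nu (B j) =
      \sum_(0 <= j < k) nu (B (j.*2 + 0)%N) +
      \sum_(0 <= j < k) nu (B (j.*2 + 1)%N))%E.
    elim: k => [|k IH]; first by rewrite !big_geq// adde0.
    rewrite doubleS !big_nat_recr//= IH addn0 addn1.
    by rewrite -!addeA; congr (_ + _)%E; rewrite [RHS]addeCA.
  by apply: leeD.
(* Since the ring series converges, its tail from a large [k] on is at most [e]. The tail bounds the
   part of [X] where [a k < g < c], and what remains, [g <= a k] and [c <= g], is separated by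
   [1 / (k + 1)]. *)
apply/lee_addgt0Pr => e e0.
have := nneseries_tail_cvg sumB (fun k _ => outer_measure_ge0 nu (B k)).
move=> /fine_cvgP[tfin /cvgrPdist_lt /(_ _ e0)] [N _ tN].
case: tfin => N' _ tfin'.
pose k := maxn N N'.
have tke : (\sum_(k <= j <oo) nu (B j) <= e%:E)%E.
  have kN : (N <= k)%N by rewrite leq_maxl.
  have kN' : (N' <= k)%N by rewrite leq_maxr.
  have := tN _ kN; rewrite /= sub0r normrN => tk.
  have tkf := tfin' _ kN'.
  by rewrite -(fineK tkf) lee_fin (le_trans (ler_norm _))// ltW.
apply: (@le_trans _ _ (nu (X `&` [set x | (g x <= a k)%R]) +
   nu (X `&` ~` [set x | (g x < c)%R]) + \sum_(k <= j <oo) nu (B j))%E); last first.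
  apply: leeD => //; apply: le_trans (nu_separated (e := k.+1%:R^-1) _ _) _.
  - by rewrite invr_gt0.
  - move=> x y [_ /= xa] [_ /negP]; rewrite -leNgt => /(le_trans _); apply.
    by rewrite -lerBrDr.
  - by apply: le_outer_measure => x [[]|[]].
rewrite addeAC; apply: leeD => //.
apply: le_trans (leeD (lexx _) (outer_measure_sigma_subadditive_tail nu k B)).
apply: le_trans (outer_measureU2 _ _ _); apply: le_outer_measure => x [Xx /= xc].
have [xa|xa] := leP (g x) (a k); [by left|right].
have /ex_minnP[l xl lmin] : exists l, g x <= a l.
  have cx : 0 < c - g x by rewrite subr_gt0.
  exists (Num.truncn (c - g x)^-1).
  rewrite lerBrDr addrC -lerBrDr -[leRHS]invrK lef_pV2 ?posrE ?invr_gt0//.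
  by rewrite ltW// truncnS_gt.
have kl : (k < l)%N.
  by rewrite ltnNge; apply/negP => lk; move: xa; rewrite ltNge (le_trans xl)// a_le.
exists l.-1; first by move=> /=; apply/negP; rewrite -leqNgt -ltnS prednK// (leq_ltn_trans _ kl).
split => //=; rewrite prednK ?(leq_ltn_trans _ kl)// xl andbT ltNge.
apply/negP => /lmin; rewrite leqNgt ltn_predL.
by rewrite (leq_ltn_trans _ kl).
Qed.

End metric_outer_measure.

Lemma coord_le_enorm (R : realType) (m : nat) (x : 'rV[R]_m) i :
  `|x 0 i| <= enorm x.
Proof.
rewrite -sqrtr_sqr; apply: ler_wsqrtr.
by rewrite /dot (bigD1 i)//= -expr2 lerDl sumr_ge0// => j _; rewrite -expr2 sqr_ge0.
Qed.

Section hausdorff_borel.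
Context (R : realType) (m : nat).
Implicit Types A B : set 'rV[R]_m.+2.

Let ediam_ge0 A : (0 <= ediam A)%E.
Proof. by rewrite /ediam le_max lexx. Qed.

Lemma hausdorff_gauge_ge0 delta A : (0 <= hausdorff_gauge delta A)%E.
Proof.
rewrite /hausdorff_gauge; case: ifPn => // _.
rewrite mule_ge0 ?expe_ge0// mule_ge0 ?lee_fin ?invr_ge0 ?exprn_ge0//.
exact: outer_measure_ge0.
Qed.

Lemma hausdorff_gauge0 delta : 0 < delta ->
  hausdorff_gauge delta (set0 : set 'rV[R]_m.+2) = 0%E.
Proof.
move=> d0; have e0 : ediam (set0 : set 'rV[R]_m.+2) = 0%E.
  rewrite /ediam (_ : [set _ | _ in _] = set0) ?ereal_sup0 ?maxeNy//.
  by apply/seteqP; split => // x [y [[]]].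
by rewrite /hausdorff_gauge e0 lee_fin ltW// expeS mul0e mule0.
Qed.

Lemma le_cover_hausdorff_gauge (d e : R) A : e <= d ->
  (cover_outer (hausdorff_gauge d) A <= cover_outer (hausdorff_gauge e) A)%E.
Proof.
move=> ed; apply: le_ereal_inf_tmp => _ [F AF <-].
apply: (@le_trans _ _ (\sum_(k <oo) hausdorff_gauge d (F k))%E).
  by apply: ereal_inf_lbound; exists F.
apply: lee_nneseries => k _; first by move=> _; exact: hausdorff_gauge_ge0.
rewrite /hausdorff_gauge; case: ifPn => [_|dF].
  by case: ifPn => // _; rewrite leey.
by rewrite ifF//; apply/negP => /le_trans; move: dF => /negP dF h; apply: dF; exact: h.
Qed.

(** A set of diameter at most [d < e] cannot meet both [A] and [B]. The members meeting [A] and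
    those meeting [B] are therefore disjoint subfamilies of the cover. *)
Lemma cover_hausdorff_separated (d e : R) A B : 0 < d -> d < e ->
  (forall x y, A x -> B y -> e <= enorm (x - y)) ->
  (cover_outer (hausdorff_gauge d) A + cover_outer (hausdorff_gauge d) B <=
   cover_outer (hausdorff_gauge d) (A `|` B))%E.
Proof.
move=> d0 de AB; apply: le_ereal_inf_tmp => _ [F ABF <-].
pose G C (k : nat) : set 'rV[R]_m.+2 := if `[< F k `&` C !=set0 >] then F k else set0.
have GC C : C `<=` A `|` B ->
    (cover_outer (hausdorff_gauge d) C <= \sum_(k <oo) hausdorff_gauge d (G C k))%E.
  move=> CAB; apply: ereal_inf_lbound; exists (G C) => // x Cx.
  have [k _ Fx] := ABF _ (CAB _ Cx); exists k => //.
  by rewrite /G ifT//; apply/asboolP; exists x.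
apply: le_trans (leeD (GC A _) (GC B _)) _; [by left|by right|].
rewrite -nneseriesD; last 2 first.
- by move=> k _ _; exact: hausdorff_gauge_ge0.
- by move=> k _ _; exact: hausdorff_gauge_ge0.
apply: lee_nneseries => k _.
  by move=> _; rewrite adde_ge0// hausdorff_gauge_ge0.
rewrite /G; case: ifPn => FA; case: ifPn => FB; rewrite ?hausdorff_gauge0//;
  rewrite ?adde0 ?add0e ?hausdorff_gauge_ge0//.
move: FA FB => /asboolP[x [Fx Ax]] /asboolP[y [Fy By]].
rewrite {3}/hausdorff_gauge ifF ?leey//; apply/negP => Fd.
have : ((enorm (x - y))%:E <= d%:E)%E.
  apply: le_trans Fd; rewrite /ediam le_max; apply/orP; right.
  by apply: ereal_sup_ubound; exists (x, y).
by rewrite lee_fin leNgt (lt_le_trans de)// AB.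
Qed.

Lemma hausdorff_separated (e : R) A B : 0 < e ->
  (forall x y, A x -> B y -> e <= enorm (x - y)) ->
  (hausdorff_outer A + hausdorff_outer B <= hausdorff_outer (A `|` B))%E.
Proof.
move=> e0 AB.
have cover_le (C : set 'rV[R]_m.+2) (d : R) : 0 < d ->
    (cover_outer (hausdorff_gauge d) C <= hausdorff_outer C)%E.
  by move=> d0; apply: ereal_sup_ubound; exists d.
have cover_ge0 (C : set 'rV[R]_m.+2) (d : R) : (0 <= cover_outer (hausdorff_gauge d) C)%E.
  by apply: cover_outer_ge0; exact: hausdorff_gauge_ge0.
have H d1 d2 : 0 < d1 -> 0 < d2 ->
    (cover_outer (hausdorff_gauge d1) A + cover_outer (hausdorff_gauge d2) B <=
     hausdorff_outer (A `|` B))%E.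
  (* A common scale, finer than both and below the distance; refining the scale only increases the
     two summands. *)
  move=> d10 d20; pose d := Num.min (e / 2) (Num.min d1 d2).
  have d0 : 0 < d by rewrite !lt_min d10 d20 divr_gt0.
  have de : d < e by rewrite gt_min ltr_pdivrMr// ltr_pMr// ltr1n.
  apply: le_trans (cover_le _ _ d0).
  apply: le_trans (cover_hausdorff_separated d0 de AB).
  by apply: leeD; apply: le_cover_hausdorff_gauge; rewrite !ge_min lexx ?orbT.
have [/eqP ABy|ABfin] := eqVneq (hausdorff_outer (A `|` B)) +oo%E.
  by rewrite (eqP ABy) leey.
have fin (C : set 'rV[R]_m.+2) (d : R) : 0 < d -> C `<=` A `|` B ->
    cover_outer (hausdorff_gauge d) C \is a fin_num.
  move=> d0 CAB; rewrite ge0_fin_numE// ltey.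
  apply: contra ABfin => /eqP Cy; rewrite -leye_eq -Cy.
  by apply: le_trans (cover_le _ _ d0) _; exact: le_outer_measure.
(* The two suprema over scales are taken one after the other. Each time the other summand is moved
   to the right by a subtraction, which is legitimate because it is finite. *)
suff AH : (hausdorff_outer A <= hausdorff_outer (A `|` B) - hausdorff_outer B)%E.
  apply: le_trans (leeD AH (lexx _)) _; rewrite subeK//.
  rewrite ge0_fin_numE ?outer_measure_ge0// ltey.
  apply: contra ABfin => /eqP By; rewrite -leye_eq -By.
  by apply: le_outer_measure; right.
apply: ge_ereal_sup => _ [d1 /= d10 <-].
rewrite leeBrDr; last first.
  rewrite ge0_fin_numE ?outer_measure_ge0// ltey.
  apply: contra ABfin => /eqP By; rewrite -leye_eq -By.
  by apply: le_outer_measure; right.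
rewrite addeC -leeBrDr; last by apply: fin => //; left.
apply: ge_ereal_sup => _ [d2 /= d20 <-].
rewrite leeBrDr; last by apply: fin => //; left.
by rewrite addeC H.
Qed.

Lemma hausdorff_halfspace (i : 'I_m.+2) (c : R) :
  (@hausdorff_outer R m : {outer_measure set 'rV[R]_m.+2 -> \bar R}).-caratheodory
    [set x | x 0 i < c].
Proof.
apply: (metric_sublevel_caratheodory (g := fun x : 'rV[R]_m.+2 => x 0 i)).
move=> A B e e0 AB; apply: (hausdorff_separated e0) => x y Ax By.
apply: le_trans (coord_le_enorm _ i); rewrite !mxE distrC.
by apply: le_trans (ler_norm _); rewrite lerBrDl AB.
Qed.

Lemma open_surf_measurable (U : set 'rV[R]_m.+2) :
  open U -> measurable (U : set (surfT R m)).
Proof. exact/open_caratheodory/hausdorff_halfspace. Qed.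

Lemma continuous_surf_measurable (f : 'rV[R]_m.+2 -> R) (A : set (surfT R m)) :
  continuous f -> measurable A -> measurable_fun A (f : surfT R m -> R).
Proof.
move=> cf mA; apply: (measurable_funS measurableT (@subsetT _ _)).
by apply: continuous_caratheodory; [exact: hausdorff_halfspace|exact: cf].
Qed.

End hausdorff_borel.

(** * Hilbert space methods and completeness *)

Section riesz.
Context (R : realType) (E : lmodType R) (V : set E) (B : E -> E -> R).
Hypotheses (V0 : V 0)
  (VP : forall a v w, V v -> V w -> V (a *: v + w))
  (BP : forall a v w z, V v -> V w -> V z ->
     B (a *: v + w) z = a * B v z + B w z)
  (BC : forall v w, V v -> V w -> B v w = B w v)
  (B_ge0 : forall v, V v -> 0 <= B v v).

Let VZ a v : V v -> V (a *: v).
Proof. by move=> Vv; rewrite -[_ *: _]addr0; exact: VP. Qed.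

Let VD v w : V v -> V w -> V (v + w).
Proof. by move=> Vv Vw; rewrite -(scale1r v); exact: VP. Qed.

Let VB v w : V v -> V w -> V (v - w).
Proof. by move=> Vv Vw; rewrite -scaleN1r addrC; exact: VP. Qed.

Let expand t v w : V v -> V w ->
  B (t *: w + v) (t *: w + v) = B v v + 2 * t * B v w + t ^+ 2 * B w w.
Proof.
move=> Vv Vw; have Vt := VZ t Vw; have Vs := VP t Vw Vv.
rewrite BP// (BC Vw Vs) (BC Vv Vs) !BP// (BC Vw Vv); ring.
Qed.

(** The quadratic [B (v + t w) (v + t w)] is nonnegative for all [t]. As [B] may be degenerate, its
    leading coefficient [B w w] can vanish. *)
Lemma form_cauchy_schwarz v w : V v -> V w ->
  B v w ^+ 2 <= B v v * B w w.
Proof.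
move=> Vv Vw; have [b0|b0] := eqVneq (B w w) 0.
  suff -> : B v w = 0 by rewrite b0 mulr0 expr0n.
  apply/eqP/negPn/negP => x0.
  (* The quadratic is then affine in [t], and this [t] would give it the value -1. *)
  pose t := - (B v v + 1) / (2 * B v w).
  have := B_ge0 (VP t Vw Vv); rewrite expand// b0 mulr0 addr0.
  have -> : 2 * t * B v w = - (B v v + 1) by rewrite /t; field.
  by rewrite opprD addrA subrr sub0r oppr_ge0 lt_geF.
have bpos : 0 < B w w by rewrite lt_def b0 B_ge0.
have := B_ge0 (VP (- (B v w / B w w)) Vw Vv); rewrite expand//.
have -> : B v v + 2 * - (B v w / B w w) * B v w +
   (- (B v w / B w w)) ^+ 2 * B w w = (B v v * B w w - B v w ^+ 2) / B w w.
  by field.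
by rewrite pmulr_lge0 ?invr_gt0// subr_ge0.
Qed.

(* The minimiser of [B v v - 2 * F v]. *)
Lemma riesz_representation (F : E -> R) (M : R) : 0 <= M ->
  (forall a v w, V v -> V w -> F (a *: v + w) = a * F v + F w) ->
  (forall v, V v -> F v ^+ 2 <= M * B v v) ->
  (forall v_ : nat -> E, (forall k, V (v_ k)) ->
     (forall j k, B (v_ j - v_ k) (v_ j - v_ k) <= 4 ^- j + 4 ^- k) ->
     exists2 v, V v & B (v_ k - v) (v_ k - v) @[k --> \oo] --> 0) ->
  exists2 v, V v & forall w, V w -> B v w = F w.
Proof.
move=> M0 FP FM complete.
pose J v := B v v - 2 * F v.
(* From [F v ^+ 2 <= M * B v v] and the inequality of the arithmetic and geometric means,
   [2 * |F v| <= B v v + M]. *)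
have J_lb v : V v -> - M <= J v.
  move=> Vv; have Bv := B_ge0 Vv; have Fv := FM _ Vv.
  rewrite /J lerBrDl addrC -lerBrDl opprK; apply: le_trans (ler_norm _) _.
  rewrite -(@ler_pXn2r _ 2)// ?nnegrE ?addr_ge0// real_normK ?num_real//.
  rewrite -subr_ge0 in Fv; rewrite -subr_ge0.
  have -> : (B v v + M) ^+ 2 - (2 * F v) ^+ 2 =
      (B v v - M) ^+ 2 + 4 * (M * B v v - F v ^+ 2) by ring.
  by rewrite addr_ge0 ?sqr_ge0// mulr_ge0.
have Jhas : has_inf [set J v | v in V].
  split; first by exists (J 0); exists 0.
  by exists (- M) => _ [v Vv <-]; exact: J_lb.
set mu := inf [set J v | v in V].
have J_ge v : V v -> mu <= J v.
  by move=> Vv; apply: (ge_inf Jhas.2); exists v.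
(* By the parallelogram identity [B (v - w) (v - w)] equals [2 J v + 2 J w] minus four times [J] at
   the midpoint. The excess over the infimum is thus doubled, and half of [4 ^- k] yields the bound
   asked by [complete]. *)
have eps_gt0 k : 0 < 4 ^- k / 2 :> R by rewrite divr_gt0// invr_gt0 exprn_gt0.
have vP k : exists v, V v /\ J v < mu + 4 ^- k / 2.
  by have [_ [v Vv <-] Jv] := inf_adherent (eps_gt0 k) Jhas; exists v.
have {vP}[v_ vP] := choice vP.
have Vv k : V (v_ k) := (vP k).1.
have [v VvL vlim] : exists2 v, V v & B (v_ k - v) (v_ k - v) @[k --> \oo] --> 0.
  apply: complete => // j k.
  have Vh : V (2^-1 *: (v_ j + v_ k)) by apply/VZ/VD.
  have Jh := J_ge _ Vh; have [_ Jj] := vP j; have [_ Jk] := vP k.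
  have BZ : B (2^-1 *: (v_ j + v_ k)) (2^-1 *: (v_ j + v_ k)) =
      4^-1 * (B (v_ j) (v_ j) + 2 * B (v_ j) (v_ k) + B (v_ k) (v_ k)).
    have Vs := VD (Vv j) (Vv k).
    have := expand 2^-1 V0 Vs; rewrite addr0 => ->.
    have B0 w : V w -> B 0 w = 0.
      by move=> Vw; have := BP (-1) V0 V0 Vw; rewrite scaler0 addr0; lra.
    rewrite (B0 _ V0) (B0 _ Vs).
    have := expand 1 (Vv k) (Vv j); rewrite scale1r => ->.
    by rewrite (BC (Vv k) (Vv j)); field.
  have FZ : F (2^-1 *: (v_ j + v_ k)) = 2^-1 * (F (v_ j) + F (v_ k)).
    have F0 : F 0 = 0 by have := FP (-1) _ _ V0 V0; rewrite scaler0 addr0; lra.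
    rewrite -[_ *: _]addr0 FP//; last exact: VD.
    by rewrite F0 addr0 -(scale1r (v_ j)) FP// mul1r scale1r.
  have := expand (-1) (Vv j) (Vv k); rewrite scaleN1r addrC => ->.
  by move: Jh Jj Jk; rewrite /J BZ FZ; lra.
exists v => // w Vw.
pose x k := B (v_ k - v) w.
have xlim : x k @[k --> \oo] --> (0 : R).
  have lim0 : Num.sqrt (B (v_ k - v) (v_ k - v) * B w w) @[k --> \oo] --> (0 : R).
    rewrite -[X in _ --> X]sqrtr0; apply: continuous_cvg.
      exact: sqrt_continuous.
    by rewrite -[X in _ --> X](mul0r (B w w)); apply: cvgMl.
  apply: norm_cvg0; apply: squeeze_cvgr lim0; last exact: cvg_cst.
  apply: nearW => k; rewrite normr_ge0/= -sqrtr_sqr; apply: ler_wsqrtr.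
  by apply: form_cauchy_schwarz => //; exact: VB.
have Bx k : B (v_ k) w = B v w + x k.
  have := BP 1 (VB (Vv k) VvL) VvL Vw.
  by rewrite scale1r subrK mul1r addrC.
(* First variation: minimality is tested at [v_ k + t w], and the inequality is passed to the limit,
   so that [J v] itself need not be computed. *)
have key t : 0 <= 2 * t * (B v w - F w) + t ^+ 2 * B w w.
  have ineq k : 0 <= 4 ^- k / 2 + 2 * t * (B v w - F w + x k) + t ^+ 2 * B w w.
    have [_ Jk] := vP k; have := J_ge _ (VP t Vw (Vv k)); move: Jk.
    by rewrite /J expand// FP// Bx; lra.
  have lim1 : (4 ^- k / 2 + 2 * t * (B v w - F w + x k) + t ^+ 2 * B w w)
      @[k --> \oo] --> 0 / 2 + 2 * t * (B v w - F w + 0) + t ^+ 2 * B w w.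
    apply: cvgD; last exact: cvg_cst.
    apply: cvgD.
      apply: cvgMl; rewrite (_ : (fun k => _) = (fun k => (4^-1) ^+ k)).
        by apply: cvg_expr; rewrite gtr0_norm ?invf_lt1// ltr1n.
      by apply/funext => k; rewrite exprVn.
    by apply: cvgMr; apply: cvgD => //; exact: cvg_cst.
  rewrite mul0r add0r addr0 in lim1.
  rewrite -(cvg_lim _ lim1)//; apply: limr_ge; first by apply/cvg_ex; eexists; exact: lim1.
  exact: nearW.
have b0 := B_ge0 Vw; set dl := B v w - F w in key.
apply/eqP; rewrite -subr_eq0 -/dl; apply/negPn/negP => dl0.
have b1 : 0 < B w w + 1 by rewrite ltr_wpDl.
(* The optimal [t] is [- dl / B w w]; the added 1 keeps the denominator positive when [B w w]
   vanishes. *)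
have := key (- dl / (B w w + 1)).
have -> : 2 * (- dl / (B w w + 1)) * dl + (- dl / (B w w + 1)) ^+ 2 * B w w =
    - ((dl / (B w w + 1)) ^+ 2 * (B w w + 2)).
  by field; rewrite gt_eqF.
by rewrite oppr_ge0 leNgt mulr_gt0// ?ltr_wpDl// exprn_even_gt0//= mulf_neq0// invr_neq0// gt_eqF.
Qed.

End riesz.

Lemma geometric_sum_le (R : realFieldType) (K : R) (j k : nat) : 0 <= K ->
  (j <= k)%N -> \sum_(j <= i < k) K * 2 ^- i <= 2 * K * 2 ^- j.
Proof.
move=> K0 jk; apply: (@le_trans _ _ (2 * K * 2 ^- j - 2 * K * 2 ^- k)).
  rewrite -(subnKC jk); elim: (k - j)%N => [|l IH].
    by rewrite addn0 big_geq// subrr.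
  rewrite addnS big_nat_recr ?leq_addr//=.
  have -> : 2 ^- (j + l).+1 = 2^-1 * 2 ^- (j + l) :> R by rewrite exprS invfM.
  by move: IH; move: (2 ^- (j + l)) (2 ^- j) (\sum_(_ <= _ < _) _) => *; lra.
by rewrite gerBl mulr_ge0// ?mulr_ge0// invr_ge0 exprn_ge0.
Qed.

(** Continuity is drawn from differentiability of the power, which is available at positive points
    only; the limit 0 is treated by hand. *)
Lemma cvg_norm_powR (R : realType) (p l : R) (u : nat -> R) : 0 < p ->
  u k @[k --> \oo] --> l -> `|u k| `^ p @[k --> \oo] --> `|l| `^ p.
Proof.
move=> p0 ul; have [l0|l0] := eqVneq l 0.
  rewrite l0 normr0 powR0 ?gt_eqF//; apply/cvgrPdist_lt => e e0.
  move: ul; rewrite l0 => /cvgrPdist_lt/(_ (e `^ p^-1) (powR_gt0 _ e0)).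
  apply: filterS => k; rewrite !sub0r !normrN => uk.
  rewrite ger0_norm ?powR_ge0//.
  have -> : e = (e `^ p^-1) `^ p by rewrite -powRrM mulVf ?gt_eqF// powRr1// ltW.
  by apply: gt0_ltr_powR => //; rewrite nnegrE ?powR_ge0.
have cp : {for `|l|, continuous (fun t : R => t `^ p)}.
  apply: differentiable_continuous; apply/derivable1_diffP.
  by apply: derivable_powR; rewrite in_itv/= andbT normr_gt0.
exact: (cvg_comp _ _ (cvg_norm ul) cp).
Qed.

(** * Completeness of Lebesgue spaces, with a rate *)

Section Lp_complete.
Context d (T : measurableType d) (R : realType).
Variables (mu : {measure set T -> \bar R}) (A : set T).
Hypotheses (mA : measurable A) (finA : (mu A < +oo)%E).

(** On a set of finite measure the increments are summable in L^1, hence almost everywhere, which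
    gives a pointwise limit. Fatou's lemma carries the geometric bound from [f_ k - f_ n] over to
    [f_ k - f]. *)
Lemma Lp_complete (p K : R) (f_ : nat -> T -> R) : 1 <= p -> 0 <= K ->
  (forall k, Lp mu A p (f_ k)) ->
  (forall k, (Lpnorm mu A p (fun x => (f_ k.+1 x - f_ k x)%R) <=
              (K * 2 ^- k)%:E)%E) ->
  exists2 f, Lp mu A p f &
    forall k, (Lpnorm mu A p (fun x => (f_ k x - f x)%R) <=
               (2 * K * 2 ^- k)%:E)%E.
Proof.
move=> p1 K0 f_p df; have p0 := lt_le_trans ltr01 p1.
have mf k : measurable_fun A (f_ k) by have [] := f_p k.
have mB j k : measurable_fun A (fun x => f_ j x - f_ k x) by exact: measurable_funB.
pose c := fine (mu A) `^ (1^-1 - p^-1).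
have c0 : 0 <= c by exact: powR_ge0.
have sum_lty : (\int[mu]_(x in A) (\sum_(k <oo) `|f_ k.+1 x - f_ k x|%:E) < +oo)%E.
  rewrite integral_nneseries//; last first.
    by move=> k; apply/measurable_EFinP/measurableT_comp.
  apply: (@le_lt_trans _ _ (2 * (K * c))%:E); last exact: ltry.
  apply: lime_le.
    by apply: is_cvg_nneseries => k _ _; exact: integral_ge0.
  apply: nearW => n.
  apply: (@le_trans _ _ (\sum_(0 <= i < n) (K * c * 2 ^- i)%:E)%E).
    apply: lee_sum => i _; rewrite -Lpnorm1.
    apply: le_trans (Lpnorm_subset mA finA ltr01 p1 (mB _ _)) _.
    by rewrite mulrAC EFinM -/c lee_wpmul2r ?lee_fin.
  rewrite sumEFin lee_fin; apply: le_trans (geometric_sum_le _ (leq0n n)) _.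
    exact: mulr_ge0.
  by rewrite expr0 invr1 mulr1.
have f_cvg : {ae mu, forall x, A x -> cvgn (f_ ^~ x)}.
  have : mu.-integrable A (fun x => \sum_(k <oo) `|f_ k.+1 x - f_ k x|%:E)%E.
    apply/integrableP; split.
      apply: ge0_emeasurable_sum => [k x _ _|k _]; first by rewrite lee_fin.
      by apply/measurable_EFinP/measurableT_comp.
    under eq_integral => x _.
      rewrite gee0_abs; last by apply: nneseries_ge0 => k _ _; rewrite lee_fin.
      over.
    by [].
  move=> /(integrable_ae mA); apply: filterS => x /[apply] xfin.
  have s_cvg : cvgn (series (telescope (f_ ^~ x))).
    apply: normed_cvg; apply: nnseries_is_cvg => [k|]; first exact: normr_ge0.
    by move: xfin; rewrite ge0_fin_numE// nneseries_ge0.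
  have -> : f_ ^~ x = (fun k => series (telescope (f_ ^~ x)) k + f_ 0%N x).
    by apply/funext => k; rewrite telescopeK /= subrK.
  by apply: is_cvgD => //; exact: is_cvg_cst.
(* The upper limit is measurable wherever the sequence behaves badly too, and equals the limit
   almost everywhere. *)
pose f x := fine (limn_esup (fun k => (f_ k x)%:E)).
have f_lim : {ae mu, forall x, A x -> f_ k x @[k --> \oo] --> f x}.
  apply: filterS f_cvg => x /[apply] cvgx.
  have : (f_ k x)%:E @[k --> \oo] --> (limn (f_ ^~ x))%:E.
    by apply: cvg_EFin => //; exact: nearW.
  by rewrite /f => /cvg_limn_einf_sup[_ ->].
have mf_lim : measurable_fun A f.
  apply: (@measurableT_comp _ _ _ _ _ _ fine); first exact: fine_measurable.
  by apply: measurable_fun_limn_esup => k; exact/measurable_EFinP.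
have f_le j k : (j <= k)%N ->
    (Lpnorm mu A p (fun x => (f_ j x - f_ k x)%R) <= (2 * K * 2 ^- j)%:E)%E.
  move=> jk; apply: (@le_trans _ _ (\sum_(j <= i < k) K * 2 ^- i)%:E); last first.
    by rewrite lee_fin; exact: geometric_sum_le.
  rewrite -(subnKC jk); elim: (k - j)%N => [|l IH].
    rewrite addn0 big_geq// (eq_Lpnorm mu (g := fun=> 0)) ?Lpnorm_cst0 ?gt_eqF//.
    by move=> x _; rewrite subrr.
  rewrite addnS big_nat_recr ?leq_addr//= EFinD.
  have df' : (Lpnorm mu A p (fun x => (f_ (j + l)%N x - f_ (j + l).+1 x)%R) <=
              (K * 2 ^- (j + l))%:E)%E.
    rewrite (eq_Lpnorm mu (g := fun x => f_ (j + l).+1 x - f_ (j + l)%N x)) ?df//.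
      by move=> x _; rewrite distrC.
    by rewrite gt_eqF.
  apply: le_trans (leeD IH df').
  apply: le_trans (LpnormD mu mA p1 (mB _ _) (mB _ _)).
  rewrite le_eqVlt; apply/orP; left; apply/eqP.
  apply: eq_Lpnorm; last by rewrite gt_eqF.
  by move=> x _; rewrite addrA subrK.
have mdf k : measurable_fun A (fun x => f_ k x - f x) by exact: measurable_funB.
have f_fatou k : (Lpnorm mu A p (fun x => (f_ k x - f x)%R) <= (2 * K * 2 ^- k)%:E)%E.
  have b0 : 0 <= 2 * K * 2 ^- k by rewrite !mulr_ge0// invr_ge0 exprn_ge0.
  pose F (n : nat) x : \bar R := (`|f_ k x - f_ n x| `^ p)%:E.
  have mF n : measurable_fun A (F n).
    by apply/measurable_EFinP; apply: measurable_norm_powR.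
  have : (\int[mu]_(x in A) (`|f_ k x - f x| `^ p)%:E <=
          ((2 * K * 2 ^- k) `^ p)%:E)%E.
    rewrite (_ : (\int[mu]_(x in A) _)%E =
       (\int[mu]_(x in A) limn_einf (F ^~ x))%E); last first.
      apply: ae_eq_integral => //.
      - by apply/measurable_EFinP; apply: measurable_norm_powR.
      - rewrite (_ : (fun x => _) = (fun x => - limn_esup (-%E \o F ^~ x))%E).
          apply: measurableT_comp => //; apply: measurable_fun_limn_esup => n.
          exact: measurableT_comp.
        by apply/funext => x; rewrite limn_esupN oppeK.
      apply: filterS f_lim => x + Ax => /(_ Ax) fx.
      suff /cvg_limn_einf_sup[-> //] : F n x @[n --> \oo] --> (`|f_ k x - f x| `^ p)%:E.
      apply: cvg_EFin; first exact: nearW.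
      by apply: cvg_norm_powR => //; apply: cvgB => //; exact: cvg_cst.
    apply: le_trans (fatou mu mA mF _) _; first by move=> n x _; rewrite lee_fin powR_ge0.
    rewrite limn_einf_lim; apply: lime_le; first exact: is_cvg_einfs.
    (* The infimum over the indices from [n] on is bounded by its value at [maxn n k], an index to
       which [f_le] applies. *)
    apply: nearW => n; apply: ge_ereal_inf.
    exists (\int[mu]_(x in A) F (maxn n k) x)%E.
      by exists (maxn n k) => //=; rewrite leq_maxl.
    rewrite -Lpnorm_pow ?gt_eqF// -poweR_EFin.
    apply: gt0_ler_poweR; rewrite ?in_itv/= ?leey ?Lpnorm_ge0 ?lee_fin ?(ltW p0) ?b0//.
    by apply: f_le; rewrite leq_maxr.
  rewrite LpnormE ?gt_eqF// => H.
  rewrite -[leRHS](_ : ((2 * K * 2 ^- k) `^ p)%:E `^ p^-1 = _)%E; last first.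
    by rewrite poweR_EFin -powRrM mulfV ?gt_eqF// powRr1.
  apply: gt0_ler_poweR => //; first by rewrite invr_ge0 ltW.
    by rewrite in_itv/= leey andbT integral_ge0// => x _; rewrite lee_fin powR_ge0.
  by rewrite in_itv/= leey andbT lee_fin powR_ge0.
exists f => //.
have := LpD mA p1 (f_p 0%N) (LpZ mA (-1) p0 (f := fun x => f_ 0%N x - f x) _).
rewrite (_ : (fun x => f_ 0%N x + -1 * (f_ 0%N x - f x)) = f) => [|]; last first.
  by apply/funext => x; ring.
by apply; split => //; apply: le_lt_trans (f_fatou 0%N) _; exact: ltry.
Qed.

End Lp_complete.

(** * Vector fields *)

Section euclidean.
Context (R : realType) (m : nat).
Implicit Types x y z : 'rV[R]_m.

Lemma dotC x y : dot x y = dot y x.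
Proof. by apply: eq_bigr => i _; rewrite mulrC. Qed.

Lemma dotP a x y z : dot (a *: x + y) z = a * dot x z + dot y z.
Proof.
rewrite /dot mulr_sumr -big_split/=; apply: eq_bigr => i _.
by rewrite !mxE mulrDl mulrA.
Qed.

Lemma dotZl a x y : dot (a *: x) y = a * dot x y.
Proof. by rewrite /dot mulr_sumr; apply: eq_bigr => i _; rewrite mxE mulrA. Qed.

Lemma dotDl x y z : dot (x + y) z = dot x z + dot y z.
Proof. by have := dotP 1 x y z; rewrite scale1r mul1r. Qed.

Lemma dot0l x : dot 0 x = 0.
Proof. by rewrite /dot big1// => i _; rewrite mxE mul0r. Qed.

Lemma dot_ge0 x : 0 <= dot x x.
Proof. by apply: sumr_ge0 => i _; rewrite -expr2 sqr_ge0. Qed.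

Lemma enorm_ge0 x : 0 <= enorm x. Proof. exact: sqrtr_ge0. Qed.

Lemma enorm_sqr x : enorm x ^+ 2 = dot x x.
Proof. exact/sqr_sqrtr/dot_ge0. Qed.

Lemma enorm0 : enorm (0 : 'rV[R]_m) = 0.
Proof. by rewrite /enorm dot0l sqrtr0. Qed.

Lemma enormZ a x : enorm (a *: x) = `|a| * enorm x.
Proof.
by rewrite /enorm dotZl dotC dotZl mulrA -expr2 sqrtrM ?sqr_ge0// sqrtr_sqr.
Qed.

Lemma dot_le x y : `|dot x y| <= enorm x * enorm y.
Proof.
rewrite -sqrtr_sqr /enorm -sqrtrM ?dot_ge0//; apply: ler_wsqrtr.
apply: (@form_cauchy_schwarz R 'rV[R]_m setT (@dot R m)) => //.
- by move=> *; exact: dotP.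
- by move=> *; exact: dotC.
- by move=> *; exact: dot_ge0.
Qed.

Lemma enormD x y : enorm (x + y) <= enorm x + enorm y.
Proof.
rewrite -(@ler_pXn2r _ 2)// ?nnegrE ?addr_ge0 ?enorm_ge0// sqrrD !enorm_sqr.
rewrite dotDl !(dotC _ (x + y)) !dotDl (dotC y x).
by have := ler_norm (dot x y); have := dot_le x y; lra.
Qed.

Lemma enorm_le_sum x : enorm x <= \sum_i `|x 0 i|.
Proof.
rewrite {1}(row_sum_delta x).
apply: (big_ind2 (fun y (b : R) => enorm y <= b)) => [|y b z c yb zc|i _].
- by rewrite enorm0.
- by apply: le_trans (enormD _ _) _; exact: lerD.
rewrite enormZ /enorm /dot (bigD1 i)//= big1 => [|j ji].
  by rewrite mxE !eqxx mulr1 addr0 sqrtr1 mulr1.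
by rewrite mxE eqxx/= (negPf ji) mul0r.
Qed.

End euclidean.

Section vector_fields.
Context d (T : measurableType d) (R : realType) (m : nat).
Variables (mu : {measure set T -> \bar R}) (A : set T).
Hypothesis mA : measurable A.
Implicit Types (h k : T -> 'rV[R]_m) (c : T -> R) (p q r : R).

Definition Lv p h := forall i, Lp mu A p (fun x => h x 0 i).

Definition vnorm p h : R := fine (Lpnorm mu A p (fun x => enorm (h x))).

Lemma vnorm_ge0 p h : 0 <= vnorm p h.
Proof. by rewrite fine_ge0// Lpnorm_ge0. Qed.

Lemma measurable_dot h k : (forall i, measurable_fun A (fun x => h x 0 i)) ->
  (forall i, measurable_fun A (fun x => k x 0 i)) ->
  measurable_fun A (fun x => dot (h x) (k x)).
Proof. by move=> mh mk; apply: measurable_sum => i; exact: measurable_funM. Qed.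

Lemma measurable_enorm h : (forall i, measurable_fun A (fun x => h x 0 i)) ->
  measurable_fun A (fun x => enorm (h x)).
Proof.
move=> mh; apply: (@measurableT_comp _ _ _ _ _ _ (Num.sqrt : R -> R)).
  by apply: continuous_measurable_fun; exact: sqrt_continuous.
exact: measurable_dot.
Qed.

Lemma Lp_sum (I : Type) (s : seq I) p (f : I -> T -> R) : 1 <= p ->
  (forall i, Lp mu A p (f i)) -> Lp mu A p (fun x => \sum_(i <- s) f i x).
Proof.
move=> p1 fp; elim: s => [|i s IH].
  under eq_fun do rewrite big_nil.
  by apply: Lp0; rewrite gt_eqF// (lt_le_trans ltr01 p1).
under eq_fun do rewrite big_cons.
exact: LpD.
Qed.

Lemma LvP p h : 1 <= p -> Lv p h <->
  (forall i, measurable_fun A (fun x => h x 0 i)) /\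
  Lp mu A p (fun x => enorm (h x)).
Proof.
move=> p1; have p0 := lt_le_trans ltr01 p1; split=> [hp|[mh hp] i]; last first.
  apply: (Lp_le_ae mA p0 (mh i) hp); apply: aeW => x _.
  by rewrite (ger0_norm (enorm_ge0 _)) coord_le_enorm.
have mh i : measurable_fun A (fun x => h x 0 i) by have [] := hp i.
split => //; have sp : Lp mu A p (fun x => \sum_i `|h x 0 i|).
  apply: Lp_sum => // i; have mhi : measurable_fun A (fun x => `|h x 0 i|).
    exact: measurableT_comp.
  by apply: (Lp_le_ae mA p0 mhi (hp i)); apply: aeW => x _; rewrite normr_id.
apply: (Lp_le_ae mA p0 (measurable_enorm mh) sp); apply: aeW => x _.
by rewrite (ger0_norm (enorm_ge0 _)) ger0_norm ?sumr_ge0// enorm_le_sum.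
Qed.

Lemma Lpnorm_sum_le (I : Type) (l : seq I) p (e : R) (f : I -> T -> R) :
  1 <= p -> (forall i, measurable_fun A (f i)) ->
  (forall i, (Lpnorm mu A p (f i) <= e%:E)%E) ->
  (Lpnorm mu A p (fun x => (\sum_(i <- l) f i x)%R) <= (e *+ size l)%:E)%E.
Proof.
move=> p1 mf fe; elim: l => [|i l IH].
  under eq_fun do rewrite big_nil.
  by rewrite Lpnorm_cst0 ?mulr0n// gt_eqF// (lt_le_trans ltr01 p1).
under eq_fun do rewrite big_cons.
rewrite mulrS EFinD; apply: le_trans (leeD (fe i) IH).
by apply: LpnormD => //; exact: measurable_sum.
Qed.

Lemma Lpnorm_enorm_le p (e : R) h : 1 <= p ->
  (forall i, measurable_fun A (fun x => h x 0 i)) ->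
  (forall i, (Lpnorm mu A p (fun x => h x 0%R i) <= e%:E)%E) ->
  (Lpnorm mu A p (fun x => enorm (h x)) <= (e *+ m)%:E)%E.
Proof.
move=> p1 mh he; have p0 := lt_le_trans ltr01 p1.
have ma i : measurable_fun A (fun x => `|h x 0 i|) by exact: measurableT_comp.
have hae i : (Lpnorm mu A p (fun x => `|h x 0 i|%R) <= e%:E)%E.
  apply: le_trans (he i); apply: le_Lpnorm_ae => //.
  by apply: aeW => x _; rewrite normr_id.
have := Lpnorm_sum_le (index_enum 'I_m) p1 ma hae.
have -> : size (index_enum 'I_m) = m by rewrite -sum1_size sum1_card card_ord.
apply: le_trans.
apply: le_Lpnorm_ae => //; first exact: measurable_enorm.
  exact: measurable_sum.
apply: aeW => x _; rewrite (ger0_norm (enorm_ge0 _)) ger0_norm ?sumr_ge0//.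
exact: enorm_le_sum.
Qed.

Lemma Lv_measurable p h : Lv p h ->
  forall i, measurable_fun A (fun x => h x 0 i).
Proof. by move=> hp i; have [] := hp i. Qed.

Lemma vnormK p h : 1 <= p -> Lv p h ->
  Lpnorm mu A p (fun x => enorm (h x)) = (vnorm p h)%:E.
Proof. by move=> p1 /(LvP _ p1)[_ hp]; rewrite fineK// Lpnorm_fin_num. Qed.

Lemma Lv_le_ae p (c : R) h k : 1 <= p -> 0 <= c ->
  (forall i, measurable_fun A (fun x => h x 0 i)) -> Lv p k ->
  {ae mu, forall x, A x -> enorm (h x) <= c * enorm (k x)} ->
  Lv p h /\ vnorm p h <= c * vnorm p k.
Proof.
move=> p1 c0 mh kp hk; have p0 := lt_le_trans ltr01 p1.
have [mk kp'] := (LvP _ p1).1 kp.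
have me := measurable_enorm mh; have ckp := LpZ mA c p0 kp'.
have hk' : {ae mu, forall x, A x -> `|enorm (h x)| <= `|c * enorm (k x)|}.
  apply: filterS hk => x hk Ax.
  by rewrite !ger0_norm ?mulr_ge0 ?enorm_ge0//; exact: hk.
have hp : Lv p h by apply/(LvP _ p1); split => //; exact: (Lp_le_ae mA p0 me ckp hk').
split => //; rewrite -lee_fin EFinM -!vnormK//.
apply: le_trans (le_Lpnorm_ae mA p0 me ckp.1 hk') _.
by rewrite LpnormZ ?ger0_norm//; exact: measurable_enorm.
Qed.

Lemma LvD p h k : 1 <= p -> Lv p h -> Lv p k -> Lv p (fun x => h x + k x).
Proof.
move=> p1 hp kp i; under eq_fun do rewrite mxE; exact: LpD.
Qed.

Lemma vnormD p h k : 1 <= p -> Lv p h -> Lv p k ->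
  vnorm p (fun x => h x + k x) <= vnorm p h + vnorm p k.
Proof.
move=> p1 hp kp; have p0 := lt_le_trans ltr01 p1.
rewrite -lee_fin EFinD -!vnormK//; last exact: LvD.
have [mh hp'] := (LvP _ p1).1 hp; have [mk kp'] := (LvP _ p1).1 kp.
apply: le_trans (LpnormD _ mA p1 hp'.1 kp'.1).
apply: le_Lpnorm_ae => //.
- exact/measurable_enorm/Lv_measurable/(LvD p1 hp kp).
- exact: (LpD mA p1 hp' kp').1.
- by apply: aeW => x _; rewrite !ger0_norm ?addr_ge0 ?enorm_ge0// enormD.
Qed.

Lemma LvZ p a h : 1 <= p -> Lv p h -> Lv p (fun x => a *: h x).
Proof.
move=> p1 hp i; under eq_fun do rewrite mxE.
by apply: LpZ => //; exact: lt_le_trans ltr01 p1.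
Qed.

Lemma vnormZ p a h : 1 <= p -> Lv p h ->
  vnorm p (fun x => a *: h x) = `|a| * vnorm p h.
Proof.
move=> p1 hp; have p0 := lt_le_trans ltr01 p1.
apply/eqP; rewrite -eqe EFinM -!vnormK//; last exact: LvZ.
rewrite -(ger0_norm (normr_ge0 a)) -LpnormZ//; last first.
  exact/measurable_enorm/Lv_measurable/hp.
apply/eqP; apply: eq_Lpnorm; last by rewrite gt_eqF.
by move=> x _; rewrite enormZ.
Qed.

Lemma LvM r p q c h : 1 <= r -> 0 < p -> 1 <= q -> p^-1 + q^-1 = r^-1 ->
  Lp mu A p c -> Lv q h -> Lv r (fun x => c x *: h x).
Proof.
move=> r1 p0 q1 pqr cp hq i; under eq_fun do rewrite mxE.
apply: (LpM mA _ p0 _ pqr cp (hq i)); first exact: lt_le_trans ltr01 r1.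
exact: lt_le_trans ltr01 q1.
Qed.

Lemma vnormM r p q c h : 1 <= r -> 0 < p -> 1 <= q -> p^-1 + q^-1 = r^-1 ->
  Lp mu A p c -> Lv q h ->
  vnorm r (fun x => c x *: h x) <= fine (Lpnorm mu A p c) * vnorm q h.
Proof.
move=> r1 p0 q1 pqr cp hq; have r0 := lt_le_trans ltr01 r1.
have q0 := lt_le_trans ltr01 q1.
rewrite -lee_fin EFinM -!vnormK//; last exact: LvM pqr cp hq.
rewrite fineK ?Lpnorm_fin_num//; have [mh hq'] := (LvP _ q1).1 hq.
apply: le_trans (LpnormM mu mA r0 p0 q0 pqr cp.1 hq'.1).
rewrite le_eqVlt; apply/orP; left; apply/eqP; apply: eq_Lpnorm.
  by move=> x _; rewrite enormZ normrM normr_id normrM.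
by rewrite gt_eqF.
Qed.

Lemma Lv1_dot p q h k : 1 <= p -> 1 <= q -> p^-1 + q^-1 = 1 ->
  Lv p h -> Lv q k -> Lp mu A 1 (fun x => dot (h x) (k x)).
Proof.
move=> p1 q1 pq hp kq; apply: Lp_sum => // i.
apply: (LpM mA ltr01 _ _ _ (hp i) (kq i)); rewrite ?invr1//.
  exact: lt_le_trans ltr01 p1.
exact: lt_le_trans ltr01 q1.
Qed.

Lemma integrable_dot p q h k : 1 <= p -> 1 <= q -> p^-1 + q^-1 = 1 ->
  Lv p h -> Lv q k -> mu.-integrable A (EFin \o (fun x => dot (h x) (k x))).
Proof. by move=> p1 q1 pq hp kq; apply: Lp1_integrable; exact: Lv1_dot hp kq. Qed.

Lemma Rintegral_dot_le p q h k : 1 <= p -> 1 <= q -> p^-1 + q^-1 = 1 ->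
  Lv p h -> Lv q k ->
  `|\int[mu]_(x in A) dot (h x) (k x)| <= vnorm p h * vnorm q k.
Proof.
move=> p1 q1 pq hp kq.
have p0 := lt_le_trans ltr01 p1; have q0 := lt_le_trans ltr01 q1.
have hk := Lv1_dot p1 q1 pq hp kq.
apply: le_trans (normr_fine_integral_le mA hk) _.
rewrite -lee_fin EFinM -!vnormK// fineK ?Lpnorm_fin_num//.
have [mh hp'] := (LvP _ p1).1 hp; have [mk kq'] := (LvP _ q1).1 kq.
have pq' : p^-1 + q^-1 = 1^-1 by rewrite invr1.
apply: le_trans (LpnormM mu mA ltr01 p0 q0 pq' hp'.1 kq'.1).
apply: le_Lpnorm_ae => //; first exact: hk.1.
  exact: measurable_funM hp'.1 kq'.1.
by apply: aeW => x _; rewrite [leRHS]ger0_norm ?mulr_ge0 ?enorm_ge0// dot_le.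
Qed.

Lemma Rintegral_dotP p q a h1 h2 k : 1 <= p -> 1 <= q -> p^-1 + q^-1 = 1 ->
  Lv p h1 -> Lv p h2 -> Lv q k ->
  \int[mu]_(x in A) dot (a *: h1 x + h2 x) (k x) =
  a * (\int[mu]_(x in A) dot (h1 x) (k x)) + \int[mu]_(x in A) dot (h2 x) (k x).
Proof.
move=> p1 q1 pq h1p h2p kq.
have i1 := integrable_dot p1 q1 pq h1p kq.
have i2 := integrable_dot p1 q1 pq h2p kq.
rewrite -RintegralZl// -RintegralD//.
  by apply: eq_Rintegral => x _; rewrite dotP.
by apply: Lp1_integrable; apply: LpZ => //; exact: integrable_Lp1.
Qed.

Lemma vnorm2_sqr h : Lv 2 h ->
  vnorm 2 h ^+ 2 = \int[mu]_(x in A) dot (h x) (h x).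
Proof.
move=> h2; have l12 : (1 : R) <= 2 by rewrite ler1n.
have e2 : (0 <= (vnorm 2 h)%:E)%E by rewrite lee_fin vnorm_ge0.
apply/EFin_inj; rewrite fineK; last first.
  apply: integrable_fin_num => //.
  by apply: (integrable_dot l12 l12 _ h2 h2); rewrite [RHS]splitr !div1r.
rewrite -powR_mulrn ?vnorm_ge0// -poweR_EFin -vnormK// Lpnorm_pow//.
by apply: eq_integral => x _; rewrite powR_mulrn// real_normK ?num_real// enorm_sqr.
Qed.

Hypothesis finA : (mu A < +oo)%E.

Lemma Lv_subset p q h : 1 <= p -> p <= q -> Lv q h -> Lv p h.
Proof.
move=> p1 pq hq i; apply: (Lp_subset mA finA _ pq) => //.
exact: lt_le_trans ltr01 p1.
Qed.

Lemma vnorm_subset p q h : 1 <= p -> p <= q -> Lv q h ->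
  vnorm p h <= vnorm q h * fine (mu A) `^ (p^-1 - q^-1).
Proof.
move=> p1 pq hq; have q1 := le_trans p1 pq.
rewrite -lee_fin EFinM -!vnormK//; last exact: Lv_subset hq.
apply: Lpnorm_subset => //; first exact: lt_le_trans ltr01 p1.
exact/measurable_enorm/Lv_measurable/hq.
Qed.

End vector_fields.

(** * Sobolev functions *)

Section smooth_functions.
Context (R : realType) (n : nat).
Implicit Types f g : 'rV[R]_n -> R.

Lemma partial_linear (a : R) f g i x : derivable f x (delta_mx 0 i) ->
  derivable g x (delta_mx 0 i) ->
  partial i (fun x => a * f x + g x) x = a * partial i f x + partial i g x.
Proof.
move=> df dg; rewrite /partial.
have -> : (fun x => a * f x + g x) = (a \*: f) + g by apply/funext.
by rewrite (deriveD (derivableZ df) dg) (deriveZ _ df).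
Qed.

Lemma continuous_linear (a : R) f g : continuous f -> continuous g ->
  continuous (fun x => a * f x + g x).
Proof.
move=> cf cg x; apply: (@continuousD _ _ _ (fun x => a * f x) g); last exact: cg.
by apply: (@continuousM _ _ (fun=> a) f); [exact: cst_continuous|exact: cf].
Qed.

Lemma Ck_linear k (a : R) f g : Ck k f -> Ck k g ->
  Ck k (fun x => a * f x + g x).
Proof.
elim: k f g => [|k IH] f g /=.
  exact: continuous_linear.
move=> [cf df kf] [cg dg kg]; split.
- exact: continuous_linear.
- move=> i x; rewrite (_ : (fun x => _) = (a \*: f) + g); last exact/funext.
  by apply: derivableD => //; exact: derivableZ.
move=> i; rewrite (_ : partial i _ = (fun x => a * partial i f x + partial i g x)).
  exact: IH.
by apply/funext => x; rewrite partial_linear.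
Qed.

Lemma smooth_linear (a : R) f g : smooth f -> smooth g ->
  smooth (fun x => a * f x + g x).
Proof. by move=> sf sg k; exact: Ck_linear. Qed.

Lemma smooth_continuous f : smooth f -> continuous f.
Proof. by move=> /(_ 0%N). Qed.

Lemma smooth_partial_continuous f i : smooth f -> continuous (partial i f).
Proof. by move=> /(_ 1%N)[_ _ /(_ i)]. Qed.

Lemma Ck_cst0 k : Ck k (fun _ : 'rV[R]_n => 0 : R).
Proof.
elim: k => [|k IH] /=; first exact: cst_continuous.
split; [exact: cst_continuous|by move=> i x; exact: derivable_cst|move=> i].
rewrite (_ : partial i _ = fun=> 0)//.
by apply/funext => x; rewrite /partial derive_cst.
Qed.

Lemma smooth_cst0 : smooth (fun _ : 'rV[R]_n => 0 : R).
Proof. by move=> k; exact: Ck_cst0. Qed.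

End smooth_functions.

Lemma classical_sob_linear (R : realType) (n : nat) (a : R)
    (f g : 'rV[R]_n.+1 -> R) : smooth f -> smooth g ->
  classical_sob (fun x => a * f x + g x) =
  a *: classical_sob f + classical_sob g.
Proof.
move=> /(_ 1%N)[_ df _] /(_ 1%N)[_ dg _]; congr pair.
apply/funext => x; apply/rowP => i; rewrite !mxE.
by rewrite partial_linear.
Qed.

Lemma classical_sob0 (R : realType) (n : nat) :
  classical_sob (fun _ : 'rV[R]_n.+1 => 0 : R) = 0.
Proof.
congr pair; apply/funext => x; apply/rowP => i; rewrite !mxE.
by rewrite /partial derive_cst.
Qed.

Section sobolev.
Context (R : realType) (n : nat) (Om : set 'rV[R]_n.+1).
Hypotheses (oOm : open Om) (bOm : bounded_set Om).
Local Notation mu := (leb R n).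
Implicit Types (v w : sob R n) (p q : R).

Lemma domain_measurable : measurable (Om : set (lebT R n)).
Proof. exact: open_lebesgue_measurable. Qed.
Let mOm := domain_measurable.

Lemma domain_finite : (mu Om < +oo)%E.
Proof. exact: bounded_lebesgue_lty. Qed.
Let finOm := domain_finite.

Lemma continuous_bounded_on (g : 'rV[R]_n.+1 -> R) : continuous g ->
  exists2 M, 0 < M & forall x, Om x -> `|g x| <= M.
Proof.
move=> cg; have [r r0 Omr] := ex_strict_bound_gt0 bOm.
pose K := [set x : 'rV[R]_n.+1 | `|x| <= r].
have cK : compact K.
  apply: bounded_closed_compact.
    by exists r; split; [exact: num_real|move=> t rt x /le_trans; apply; exact: ltW].
  apply: (@preimage_closed _ _ (fun x : 'rV[R]_n.+1 => `|x|) [set t : R | t <= r]).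
    by move=> x _; exact: norm_continuous.
  exact: closed_le.
have /compact_bounded/ex_strict_bound_gt0[M M0 gM] : compact (g @` K).
  by apply: continuous_compact => //; exact: continuous_subspaceT.
exists M => // x Ox; apply/ltW/(gM (g x)); exists x => //.
exact/ltW/Omr.
Qed.

Lemma LpM_continuous p (w g : 'rV[R]_n.+1 -> R) : 1 <= p -> Lp mu Om p w ->
  continuous g -> Lp mu Om p (fun x => w x * g x).
Proof.
move=> p1 wp cg; have p0 := lt_le_trans ltr01 p1.
have [M M0 gM] := continuous_bounded_on cg.
have mg := continuous_lebesgue_measurable cg mOm.
have mwg : measurable_fun (Om : set (lebT R n)) (fun x : lebT R n => w x * g x).
  exact: measurable_funM wp.1 mg.
apply: (Lp_le_ae mOm p0 mwg (LpZ mOm M p0 wp)); apply: aeW => x Ox.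
by rewrite !normrM mulrC ler_wpM2r// (gtr0_norm M0) gM.
Qed.

Lemma LpnormM_continuous (g : 'rV[R]_n.+1 -> R) : continuous g ->
  exists2 M, 0 < M & forall w : 'rV[R]_n.+1 -> R, Lp mu Om 1 w ->
    `|\int[mu]_(x in Om) (w x * g x)| <= M * fine (Lpnorm mu Om 1 w).
Proof.
move=> cg; have [M M0 gM] := continuous_bounded_on cg; exists M => // w w1.
have wg1 := LpM_continuous (lexx 1) w1 cg.
apply: le_trans (normr_fine_integral_le mOm wg1) _.
rewrite -lee_fin EFinM !fineK ?Lpnorm_fin_num//.
rewrite -(gtr0_norm M0) -LpnormZ//; last exact: w1.1.
apply: (le_Lpnorm_ae mOm ltr01 wg1.1 (LpZ mOm M ltr01 w1).1).
by apply: aeW => x Ox; rewrite !normrM mulrC ler_wpM2r// (gtr0_norm M0) gM.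
Qed.

(** Test functions and their derivatives are bounded on [Om], so both integrals are finite. The
    identity may then be read between real integrals, where linearity and limits are easier to
    handle. *)
Lemma weak_gradientP (w : 'rV[R]_n.+1 -> R) (g : 'rV[R]_n.+1 -> 'rV[R]_n.+1) :
  Lp mu Om 1 w -> (forall i, Lp mu Om 1 (fun x => g x 0 i)) ->
  weak_gradient Om w g <->
  forall phi, smooth phi -> compactly_supported_in Om phi -> forall i,
    \int[mu]_(x in Om) (w x * partial i phi x) =
    - \int[mu]_(x in Om) (g x 0 i * phi x).
Proof.
move=> w1 g1.
have iw phi i : smooth phi ->
    mu.-integrable Om (EFin \o (fun x => w x * partial i phi x)).
  move=> sphi; apply: Lp1_integrable; apply: LpM_continuous => //.
  exact: smooth_partial_continuous.
have ig phi i : smooth phi ->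
    mu.-integrable Om (EFin \o (fun x => g x 0 i * phi x)).
  move=> sphi; apply: Lp1_integrable; apply: LpM_continuous => //.
  exact: smooth_continuous.
split=> H phi sphi cphi i.
  by rewrite /Rintegral H// fineN.
have := H phi sphi cphi i; rewrite /Rintegral -fineN => /eqP.
have f1 := integrable_fin_num mOm (iw _ i sphi).
have f2 := integrable_fin_num mOm (ig _ i sphi).
rewrite -eqe fineK; last exact: f1.
by rewrite fineK ?fin_numN// => /eqP.
Qed.

Lemma sfunP (a : R) v w :
  Defs.sfun (a *: v + w) = (fun x => a * Defs.sfun v x + Defs.sfun w x) :> (_ -> R).
Proof. by []. Qed.

Lemma sgradP (a : R) v w :
  sgrad (a *: v + w) = (fun x => a *: sgrad v x + sgrad w x) :> (_ -> 'rV[R]_n.+1).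
Proof. by []. Qed.

Lemma W1_Lp p w : W1 Om p w -> Lp mu Om p (Defs.sfun w).
Proof. by case. Qed.

Lemma W1_Lv p w : W1 Om p w -> Lv mu Om p (sgrad w).
Proof. by case. Qed.

Lemma W1_Lp1 p w : 1 <= p -> W1 Om p w -> Lp mu Om 1 (Defs.sfun w).
Proof. by move=> p1 [wp _ _]; exact: (Lp_subset mOm finOm _ p1). Qed.

Lemma W1_Lv1 p w : 1 <= p -> W1 Om p w -> Lv mu Om 1 (sgrad w).
Proof. by move=> p1 [_ gp _] i; apply: (Lp_subset mOm finOm _ p1). Qed.

Lemma W1_subset p q w : 1 <= p -> p <= q -> W1 Om q w -> W1 Om p w.
Proof.
move=> p1 pq [wq gq wg]; have p0 := lt_le_trans ltr01 p1.
split; last exact: wg.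
  exact: (Lp_subset mOm finOm p0 pq wq).
by move=> i; exact: (Lp_subset mOm finOm p0 pq (gq i)).
Qed.

Lemma W1_linear p (a : R) v w : 1 <= p -> W1 Om p v -> W1 Om p w ->
  W1 Om p (a *: v + w).
Proof.
move=> p1 Wv Ww; have p0 := lt_le_trans ltr01 p1.
have [vp gvp wgv] := Wv; have [wp gwp wgw] := Ww.
have avw : Lp mu Om p (Defs.sfun (a *: v + w)).
  by rewrite sfunP; exact: (LpD mOm p1 (LpZ mOm a p0 vp) wp).
have gavw i : Lp mu Om p (fun x => sgrad (a *: v + w) x 0 i).
  rewrite sgradP; under eq_fun do rewrite !mxE.
  exact: (LpD mOm p1 (LpZ mOm a p0 (gvp i)) (gwp i)).
split; [exact: avw|exact: gavw|].
have v1 := W1_Lp1 p1 Wv; have w1 := W1_Lp1 p1 Ww.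
have gv1 := W1_Lv1 p1 Wv; have gw1 := W1_Lv1 p1 Ww.
have avw1 : Lp mu Om 1 (Defs.sfun (a *: v + w)).
  by rewrite sfunP; exact: (LpD mOm (lexx 1) (LpZ mOm a ltr01 v1) w1).
have gavw1 i : Lp mu Om 1 (fun x => sgrad (a *: v + w) x 0 i).
  rewrite sgradP; under eq_fun do rewrite !mxE.
  exact: (LpD mOm (lexx 1) (LpZ mOm a ltr01 (gv1 i)) (gw1 i)).
apply/(weak_gradientP avw1 gavw1) => phi sphi cphi i.
have split_int f g h : Lp mu Om 1 f -> Lp mu Om 1 g -> continuous h ->
    \int[mu]_(x in Om) ((a * f x + g x) * h x) =
    a * (\int[mu]_(x in Om) (f x * h x)) + \int[mu]_(x in Om) (g x * h x).
  move=> f1 g1 ch.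
  have fh := LpM_continuous (lexx 1) f1 ch.
  have gh := LpM_continuous (lexx 1) g1 ch.
  rewrite -RintegralZl//; last exact: Lp1_integrable.
  rewrite -RintegralD//; last 2 first.
  - by apply: Lp1_integrable; exact: LpZ.
  - exact: Lp1_integrable.
  by apply: eq_Rintegral => x _; rewrite mulrDl mulrA.
rewrite sfunP split_int//; last exact: smooth_partial_continuous.
rewrite (_ : \int[mu]_(x in Om) (sgrad _ x 0 i * _) =
  \int[mu]_(x in Om) ((a * sgrad v x 0 i + sgrad w x 0 i) * phi x)); last first.
  by apply: eq_Rintegral => x _; rewrite sgradP !mxE.
rewrite split_int//; last exact: smooth_continuous.
have /(weak_gradientP v1 gv1) -> // := wgv.
by have /(weak_gradientP w1 gw1) -> // := wgw; ring.
Qed.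

(** Weak gradients are closed already under convergence in L^1, because they are tested against
    bounded functions only. *)
Lemma W1_limit p (w_ : nat -> sob R n) w (e_ : nat -> R) : 1 <= p ->
  (forall k, W1 Om p (w_ k)) -> Lp mu Om p (Defs.sfun w) ->
  (forall i, Lp mu Om p (fun x => sgrad w x 0 i)) ->
  e_ k @[k --> \oo] --> (0 : R) ->
  (forall k, (Lpnorm mu Om 1 (fun x => Defs.sfun (w_ k) x - Defs.sfun w x)%R <= (e_ k)%:E)%E) ->
  (forall k i, (Lpnorm mu Om 1 (fun x => sgrad (w_ k) x 0 i - sgrad w x 0 i)%R
                <= (e_ k)%:E)%E) ->
  W1 Om p w.
Proof.
move=> p1 Ww wp gp e0 we ge; split; [exact: wp|exact: gp|].
have w1 : Lp mu Om 1 (Defs.sfun w) by exact: (Lp_subset mOm finOm _ p1).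
have g1 i : Lp mu Om 1 (fun x => sgrad w x 0 i).
  exact: (Lp_subset mOm finOm _ p1).
apply/(weak_gradientP w1 g1) => phi sphi cphi i.
have conv (f_ : nat -> 'rV[R]_n.+1 -> R) f h : continuous h ->
    (forall k, Lp mu Om 1 (f_ k)) -> Lp mu Om 1 f ->
    (forall k, (Lpnorm mu Om 1 (fun x => f_ k x - f x)%R <= (e_ k)%:E)%E) ->
    \int[mu]_(x in Om) (f_ k x * h x) @[k --> \oo] -->
    \int[mu]_(x in Om) (f x * h x).
  move=> ch f_1 f1 fe; have [M M0 hM] := LpnormM_continuous ch.
  apply/subr_cvg0; apply: norm_cvg0.
  have Me0 : M * e_ k @[k --> \oo] --> (0 : R).
    by rewrite -[X in _ --> X](mulr0 M); exact: cvgMr.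
  apply: squeeze_cvgr Me0; last exact: cvg_cst.
  apply: nearW => k; rewrite normr_ge0/=.
  have df1 : Lp mu Om 1 (fun x => f_ k x - f x).
    have := LpD mOm (lexx 1) (f_1 k) (LpZ mOm (-1) ltr01 f1).
    by under eq_fun do rewrite mulN1r.
  rewrite -RintegralB//; last 2 first.
  - exact/Lp1_integrable/LpM_continuous.
  - exact/Lp1_integrable/LpM_continuous.
  under eq_Rintegral do rewrite -mulrBl.
  apply: le_trans (hM _ df1) _; rewrite ler_wpM2l ?(ltW M0)//.
  by rewrite -lee_fin fineK// Lpnorm_fin_num.
have lim1 := conv _ _ _ (smooth_partial_continuous (i := i) sphi)
  (fun k => W1_Lp1 p1 (Ww k)) w1 we.
have lim2 := conv _ _ _ (smooth_continuous sphi)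
  (fun k => W1_Lv1 p1 (Ww k) i) (g1 i) (fun k => ge k i).
apply: cvg_unique lim1 _ => //.
rewrite (_ : (fun k => _) =
  (fun k => - \int[mu]_(x in Om) (sgrad (w_ k) x 0 i * phi x))).
  exact: cvgN.
apply/funext => k; have [_ _ wg] := Ww k.
exact: (weak_gradientP (W1_Lp1 p1 (Ww k)) (W1_Lv1 p1 (Ww k))).1.
Qed.

Lemma W10 p : 0 < p -> W1 Om p 0.
Proof.
move=> p0; have c0 : Lp mu Om p (fun=> 0) by apply: Lp0; rewrite gt_eqF.
split => //.
  by move=> i; under eq_fun do rewrite mxE.
move=> phi sphi cphi i.
rewrite integral0_eq => [|x _]; last by rewrite mul0r.
by rewrite integral0_eq ?oppe0// => x _; rewrite mxE mul0r.
Qed.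

Lemma W1norm_ge0 p w : (0 <= W1norm Om p w)%E.
Proof. exact: poweR_ge0. Qed.

Lemma W1norm1E w : W1norm Om 1 w =
  (Lpnorm mu Om 1 (Defs.sfun w) + Lpnorm mu Om 1 (fun x => enorm (sgrad w x)))%E.
Proof.
by rewrite /W1norm invr1 !poweRe1 ?adde_ge0 ?Lpnorm_ge0.
Qed.

Let poweRK p (a : \bar R) : 0 < p -> (0 <= a)%E -> ((a `^ p) `^ p^-1)%E = a.
Proof. by move=> p0 a0; rewrite -poweRrM mulfV ?gt_eqF// poweRe1. Qed.

Let le_poweR p (a b : \bar R) : 0 < p -> (0 <= a)%E -> (a <= b)%E ->
  (a `^ p^-1 <= b `^ p^-1)%E.
Proof.
move=> p0 a0 ab; have b0 := le_trans a0 ab.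
by apply: gt0_ler_poweR; rewrite ?in_itv/= ?a0 ?b0 ?leey// invr_ge0 ltW.
Qed.

Lemma Lpnorm_le_W1norm p w : 0 < p ->
  (Lpnorm mu Om p (Defs.sfun w) <= W1norm Om p w)%E.
Proof.
move=> p0; rewrite -[leLHS](poweRK p0) ?Lpnorm_ge0//.
by apply: le_poweR; rewrite ?poweR_ge0// leeDl// poweR_ge0.
Qed.

Lemma Lpnorm_grad_le_W1norm p w : 0 < p ->
  (Lpnorm mu Om p (fun x => enorm (sgrad w x)) <= W1norm Om p w)%E.
Proof.
move=> p0; rewrite -[leLHS](poweRK p0) ?Lpnorm_ge0//.
by apply: le_poweR; rewrite ?poweR_ge0// leeDr// poweR_ge0.
Qed.

Lemma W1norm0 p : 0 < p -> W1norm Om p 0 = 0%E.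
Proof.
move=> p0; have pN0 : p != 0 by rewrite gt_eqF.
rewrite /W1norm (_ : Defs.sfun _ = fun=> 0)// Lpnorm_cst0//.
rewrite (_ : (fun x => enorm _) = fun=> 0); last first.
  by apply/funext => x; exact: enorm0.
by rewrite Lpnorm_cst0// poweR0r// adde0 poweR0r// invr_neq0.
Qed.

(** Traces put smooth functions into the W^{1,1} norm. Measurability is all that its triangle
    inequality asks of them, so their classical gradients never have to be identified as weak
    ones. *)
Definition sob_measurable w :=
  measurable_fun (Om : set (lebT R n)) (Defs.sfun w : lebT R n -> R) /\
  forall i, measurable_fun (Om : set (lebT R n))
    ((fun x => sgrad w x 0 i) : lebT R n -> R).

Lemma W1_measurable p w : W1 Om p w -> sob_measurable w.
Proof. by case=> wp gp _; split=> [|i]; [exact: wp.1|exact: (gp i).1]. Qed.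

Lemma sob_measurable_linear (a : R) v w :
  sob_measurable v -> sob_measurable w -> sob_measurable (a *: v + w).
Proof.
move=> [mv gv] [mw gw]; split.
  rewrite sfunP; apply: measurable_funD; last exact: mw.
  by apply: measurable_funM; [exact: measurable_cst|exact: mv].
move=> i; rewrite sgradP; under eq_fun do rewrite !mxE.
apply: measurable_funD; last exact: gw.
by apply: measurable_funM; [exact: measurable_cst|exact: gv].
Qed.

Lemma sob_measurable0 : sob_measurable 0.
Proof.
have c0 : measurable_fun (Om : set (lebT R n)) (fun=> 0 : R).
  exact: measurable_cst.
by split; [exact: c0|move=> i; under eq_fun do rewrite mxE; exact: c0].
Qed.

Lemma sob_measurableZ (a : R) v : sob_measurable v -> sob_measurable (a *: v).
Proof.
by move=> mv; have := sob_measurable_linear a mv sob_measurable0; rewrite addr0.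
Qed.

Lemma sob_measurableB v w :
  sob_measurable v -> sob_measurable w -> sob_measurable (v - w).
Proof.
by move=> mv mw; rewrite -scaleN1r addrC; exact: sob_measurable_linear.
Qed.

Lemma smooth_sob_measurable phi : smooth phi ->
  sob_measurable (classical_sob phi).
Proof.
move=> sphi; split.
  apply: continuous_lebesgue_measurable => //; exact: smooth_continuous.
move=> i; under eq_fun do rewrite mxE.
apply: continuous_lebesgue_measurable => //; exact: smooth_partial_continuous.
Qed.

Lemma W1norm1D v w : sob_measurable v -> sob_measurable w ->
  (W1norm Om 1 (v + w) <= W1norm Om 1 v + W1norm Om 1 w)%E.
Proof.
move=> [mv gv] [mw gw]; rewrite !W1norm1E addeACA; apply: leeD.
  exact: (LpnormD mu mOm (lexx 1) mv mw).
have gvw i : measurable_fun (Om : set (lebT R n))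
    ((fun x => (sgrad v x + sgrad w x) 0 i) : lebT R n -> R).
  by under eq_fun do rewrite mxE; exact: measurable_funD.
have mev := measurable_enorm gv; have mew := measurable_enorm gw.
apply: le_trans (LpnormD mu mOm (lexx 1) mev mew).
apply: (le_Lpnorm_ae mOm ltr01 (measurable_enorm gvw) (measurable_funD mev mew)).
by apply: aeW => x _; rewrite !ger0_norm ?addr_ge0 ?enorm_ge0// enormD.
Qed.

Lemma W1norm1Z (a : R) w : sob_measurable w ->
  W1norm Om 1 (a *: w) = (`|a|%:E * W1norm Om 1 w)%E.
Proof.
move=> [mw gw]; rewrite !W1norm1E ge0_muleDr ?Lpnorm_ge0//; congr (_ + _)%E.
  exact: LpnormZ.
have me := measurable_enorm gw.
rewrite -(ger0_norm (normr_ge0 a)) -LpnormZ//.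
by apply: eq_Lpnorm => // x _; rewrite -enormZ.
Qed.

End sobolev.

Lemma cvge0P (R : realType) (T : Type) (F : set_system T) {FF : Filter F}
    (f : T -> \bar R) : (\forall x \near F, 0 <= f x)%E ->
  f @ F --> 0%E <-> forall e, 0 < e -> \forall x \near F, (f x < e%:E)%E.
Proof.
move=> f0; split=> [/fine_cvgP[ffin /cvgrPdist_lt fl] e e0|fe].
  move: f0 ffin (fl _ e0); apply: filterS3 => x f0 ffin.
  rewrite /= sub0r normrN ger0_norm ?fine_ge0// => fxe.
  by rewrite -(fineK ffin) lte_fin.
apply/fine_cvgP; split.
  move: f0 (fe 1 ltr01); apply: filterS2 => x f0 f1.
  by rewrite ge0_fin_numE// (lt_trans f1)// ltry.
apply/cvgrPdist_lt => e e0; move: f0 (fe e e0); apply: filterS2 => x f0 fxe.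
rewrite /= sub0r normrN ger0_norm ?fine_ge0// -lte_fin fineK//.
by rewrite ge0_fin_numE// (lt_trans fxe)// ltry.
Qed.

(** * Functions with zero trace *)

Section traces.
Context (R : realType) (n : nat) (Om Gt : set 'rV[R]_n.+2).
Hypotheses (oOm : open Om) (bOm : bounded_set Om) (cGt : closed Gt).
Implicit Types (v w : sob R n.+1) (p q : R).

Let mOm : measurable (Om : set (lebT R n.+1)).
Proof. exact: open_lebesgue_measurable. Qed.

Let mGt : measurable (Gt : set (surfT R n)).
Proof.
by rewrite -(setCK Gt); apply: measurableC; apply: open_surf_measurable; exact: closed_openC.
Qed.

(** The approximating sequence is replaced by a single approximant for each tolerance, which spares
    diagonal sequences in the closure arguments. *)
Lemma trace0P w : is_trace Om Gt w (fun=> 0) <-> W1 Om 1 w /\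
  forall e, 0 < e -> exists phi, [/\ smooth phi,
    (W1norm Om 1 (w - classical_sob phi) < e%:E)%E &
    (Lpnorm (surf R n) Gt 1 phi < e%:E)%E].
Proof.
split=> [[Ww _ [phi [sphi wphi tphi]]]|[Ww wphi]].
  split => // e e0.
  have /cvge0P := wphi.
  have ge0 : \forall k \near \oo, (0 <= W1norm Om 1 (w - classical_sob (phi k)))%E.
    by apply: nearW => k; exact: W1norm_ge0.
  move=> /(_ ge0 _ e0) n1.
  have /cvge0P := tphi.
  have ge0' : \forall k \near \oo,
      (0 <= Lpnorm (surf R n) Gt 1 (fun x => (phi k x - 0)%R))%E.
    by apply: nearW => k; exact: Lpnorm_ge0.
  move=> /(_ ge0' _ e0) n2.
  have [k [k1 k2]] := filter_ex (filterI n1 n2).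
  exists (phi k); split => //.
  by have -> : phi k = (fun x => phi k x - 0) by apply/funext => x; rewrite subr0.
split => //; first by apply: Lp0; rewrite oner_eq0.
have e0 k : 0 < k.+1%:R^-1 :> R by rewrite invr_gt0.
have phiP k := wphi _ (e0 k); have {phiP}[phi phiP] := choice phiP.
have small (g : nat -> \bar R) : (forall k, 0 <= g k)%E ->
    (forall k, g k < (k.+1%:R^-1)%:E)%E -> g @ \oo --> 0%E.
  move=> g0 gk; apply/cvge0P; first exact: nearW.
  move=> e egt0; near=> k; apply: lt_trans (gk k) _; rewrite lte_fin.
  by near: k; exact: near_infty_natSinv_lt (PosNum egt0).
exists phi; split.
- by move=> k; have [] := phiP k.
- by apply: small => k; [exact: W1norm_ge0|have [] := phiP k].
- apply: small => k; first exact: Lpnorm_ge0.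
  have [_ _] := phiP k.
  by have -> : (fun x => phi k x - 0) = phi k by apply/funext => x; rewrite subr0.
Unshelve. all: by end_near. Qed.

Lemma trace0_linear (a : R) v w : is_trace Om Gt v (fun=> 0) ->
  is_trace Om Gt w (fun=> 0) -> is_trace Om Gt (a *: v + w) (fun=> 0).
Proof.
move=> /trace0P[Wv tv] /trace0P[Ww tw]; apply/trace0P; split.
  exact: (W1_linear oOm bOm a (lexx 1) Wv Ww).
move=> e e0; have a1 : 0 < `|a| + 1 by rewrite ltr_wpDl.
(* The share of [v] is multiplied by [|a|] later; the added 1 covers [a = 0]. *)
have ea : 0 < e / 2 / (`|a| + 1) by rewrite !divr_gt0.
have [phi [sphi vphi tphi]] := tv _ ea.
have [psi [spsi wpsi tpsi]] := tw (e / 2) ltac:(by rewrite divr_gt0).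
exists (fun x => a * phi x + psi x).
have small (x y : \bar R) : (0 <= x)%E -> (x < (e / 2 / (`|a| + 1))%:E)%E ->
    (y < (e / 2)%:E)%E -> (`|a|%:E * x + y < e%:E)%E.
  move=> x0 xe ye; rewrite (splitr e) EFinD; apply: lee_ltD => //.
    by rewrite fin_numM// ge0_fin_numE// (lt_trans xe) ?ltry.
  apply: (@le_trans _ _ (`|a|%:E * (e / 2 / (`|a| + 1))%:E)%E).
    by apply: lee_wpmul2l; [rewrite lee_fin|exact: ltW].
  rewrite -EFinM lee_fin mulrCA ger_pMr ?divr_gt0// ler_pdivrMr// mul1r.
  by rewrite lerDl.
split; first exact: smooth_linear.
- have mv := sob_measurableB (W1_measurable Wv) (smooth_sob_measurable oOm sphi).
  have mw := sob_measurableB (W1_measurable Ww) (smooth_sob_measurable oOm spsi).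
  rewrite classical_sob_linear//.
  have -> : a *: v + w - (a *: classical_sob phi + classical_sob psi) =
     a *: (v - classical_sob phi) + (w - classical_sob psi).
    by rewrite scalerBr opprD addrACA.
  apply: le_lt_trans (W1norm1D oOm (sob_measurableZ a mv) mw) _.
  by rewrite (W1norm1Z oOm a mv); apply: small => //; exact: W1norm_ge0.
have mphi := continuous_surf_measurable (smooth_continuous sphi) mGt.
have mpsi := continuous_surf_measurable (smooth_continuous spsi) mGt.
have maphi : measurable_fun (Gt : set (surfT R n)) ((fun x => a * phi x) : surfT R n -> R).
  by apply: measurable_funM; [exact: measurable_cst|exact: mphi].
apply: le_lt_trans (LpnormD (surf R n) mGt (lexx 1) maphi mpsi) _.
rewrite (LpnormZ (surf R n) mGt a ltr01 mphi).
by apply: small; [exact: Lpnorm_ge0|exact: tphi|exact: tpsi].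
Qed.

Lemma W1D_linear p (a : R) v w : 1 <= p -> W1D Om Gt p v -> W1D Om Gt p w ->
  W1D Om Gt p (a *: v + w).
Proof.
move=> p1 [Wv tv] [Ww tw]; split; first exact: (W1_linear oOm bOm a p1 Wv Ww).
exact: trace0_linear.
Qed.

Lemma W1D_subset p q w : 1 <= p -> p <= q -> W1D Om Gt q w -> W1D Om Gt p w.
Proof.
by move=> p1 pq [Ww tw]; split; [exact: (W1_subset oOm bOm p1 pq Ww)|exact: tw].
Qed.

Lemma trace00 : is_trace Om Gt 0 (fun=> 0).
Proof.
apply/trace0P; split; first exact: W10.
move=> e e0; exists (fun=> 0); split; first exact: smooth_cst0.
  by rewrite classical_sob0 subr0 W1norm0// lte_fin.
by rewrite Lpnorm_cst0 ?oner_eq0// lte_fin.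
Qed.

Lemma W1D0 p : 0 < p -> W1D Om Gt p 0.
Proof. by move=> p0; split; [exact: W10|exact: trace00]. Qed.

(** A smooth approximant of [w_ k] that is small on [Gt] is also one of [w], as soon as [w_ k] is
    close to [w] in W^{1,1}. *)
Lemma W1D_limit p (w_ : nat -> sob R n.+1) w : 1 <= p ->
  (forall k, W1D Om Gt p (w_ k)) -> W1 Om p w ->
  (forall e, 0 < e -> exists k, (W1norm Om 1 (w_ k - w)%R < e%:E)%E) ->
  W1D Om Gt p w.
Proof.
move=> p1 Dw Ww we; split; [exact: Ww|apply/trace0P; split].
  exact: (W1_subset oOm bOm (lexx 1) p1 Ww).
move=> e e0; have e20 : 0 < e / 2 by rewrite divr_gt0.
have [k wk] := we _ e20; have [Wk /trace0P[_ tk]] := Dw k.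
have [phi [sphi wphi tphi]] := tk _ e20; exists phi; split => //; last first.
  by apply: lt_trans tphi _; rewrite lte_fin ltr_pdivrMr// ltr_pMr// ltr1n.
have -> : w - classical_sob phi = (-1) *: (w_ k - w) + (w_ k - classical_sob phi).
  by rewrite scaleN1r opprB addrA subrK.
have m1 := sob_measurableB (W1_measurable Wk) (W1_measurable Ww).
have m2 := sob_measurableB (W1_measurable Wk) (smooth_sob_measurable oOm sphi).
apply: le_lt_trans (W1norm1D oOm (sob_measurableZ (-1) m1) m2) _.
rewrite (W1norm1Z oOm _ m1) normrN1 mul1e (splitr e) EFinD.
by apply: lteD.
Qed.

End traces.

(** * Weak solutions *)

#[global] Instance leb_ae_filter (R : realType) (n : nat) :
  Filter (nbhs (almost_everywhere (leb R n))).
Proof. exact: ae_filter_ringOfSetsType. Qed.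

Section pairing.
Context (R : realType) (n : nat) (Om : set 'rV[R]_n.+1).
Hypotheses (oOm : open Om) (bOm : bounded_set Om).
Local Notation mu := (leb R n).
Local Notation vec := ('rV[R]_n.+1 -> 'rV[R]_n.+1).
Implicit Types (h k : vec) (c : 'rV[R]_n.+1 -> R).

Let mOm := domain_measurable oOm.
Let finOm := domain_finite bOm.

(* Membership of vector fields in [L^p(Om)], their norm, and the norm [SN] of
   scalar functions. [VN] and [SN] are real numbers, 0 if the norm is infinite. *)
Definition VL (p : R) (h : vec) : Prop := Lv mu Om p h.
Definition VN (p : R) (h : vec) : R := vnorm mu Om p h.
Definition SN (p : R) c : R := fine (Lpnorm mu Om p c).
Definition pairing h k : R := \int[mu]_(x in Om) dot (h x) (k x).

Lemma VN_ge0 p h : 0 <= VN p h. Proof. exact: vnorm_ge0. Qed.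

Lemma SN_ge0 p c : 0 <= SN p c. Proof. by apply: fine_ge0; exact: Lpnorm_ge0. Qed.

Lemma SNK p c : Lp mu Om p c -> Lpnorm mu Om p c = (SN p c)%:E.
Proof. by move=> cp; rewrite fineK//; exact: Lpnorm_fin_num cp. Qed.

Lemma VNK p h : 1 <= p -> VL p h ->
  Lpnorm mu Om p (fun x => enorm (h x)) = (VN p h)%:E.
Proof. exact: (vnormK mOm). Qed.

Lemma VL_linear p (a : R) h k : 1 <= p -> VL p h -> VL p k ->
  VL p (fun x => a *: h x + k x).
Proof. by move=> p1 hp kp; exact: (LvD mOm p1 (LvZ mOm a p1 hp) kp). Qed.

Lemma VLD p h k : 1 <= p -> VL p h -> VL p k -> VL p (fun x => h x + k x).
Proof. exact: (LvD mOm). Qed.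

Lemma VND p h k : 1 <= p -> VL p h -> VL p k ->
  VN p (fun x => h x + k x) <= VN p h + VN p k.
Proof. exact: (vnormD mOm). Qed.

Lemma VLZ p (a : R) h : 1 <= p -> VL p h -> VL p (fun x => a *: h x).
Proof. exact: (LvZ mOm). Qed.

Lemma VNZ p (a : R) h : 1 <= p -> VL p h ->
  VN p (fun x => a *: h x) = `|a| * VN p h.
Proof. exact: (vnormZ mOm). Qed.

Lemma VLB p h k : 1 <= p -> VL p h -> VL p k -> VL p (fun x => h x - k x).
Proof.
move=> p1 hp kp; have := VL_linear (-1) p1 kp hp.
by under eq_fun do rewrite scaleN1r addrC.
Qed.

Lemma VLM r p q c h : 1 <= r -> 0 < p -> 1 <= q -> p^-1 + q^-1 = r^-1 ->
  Lp mu Om p c -> VL q h -> VL r (fun x => c x *: h x).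
Proof. exact: (LvM mOm). Qed.

Lemma VNM r p q c h : 1 <= r -> 0 < p -> 1 <= q -> p^-1 + q^-1 = r^-1 ->
  Lp mu Om p c -> VL q h -> VN r (fun x => c x *: h x) <= SN p c * VN q h.
Proof. exact: (vnormM mOm). Qed.

Lemma VL_subset p q h : 1 <= p -> p <= q -> VL q h -> VL p h.
Proof. exact: (Lv_subset mOm finOm). Qed.

Lemma VN_subset p q h : 1 <= p -> p <= q -> VL q h ->
  VN p h <= VN q h * fine (mu Om) `^ (p^-1 - q^-1).
Proof. exact: (vnorm_subset mOm finOm). Qed.

Lemma VL0 p : 1 <= p -> VL p (fun=> 0).
Proof.
move=> p1 i; under eq_fun do rewrite mxE.
by apply: Lp0; rewrite gt_eqF// (lt_le_trans ltr01 p1).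
Qed.

Lemma VN0 p : 1 <= p -> VN p (fun=> 0) = 0.
Proof.
move=> p1; rewrite /VN /vnorm; under eq_fun do rewrite enorm0.
by rewrite Lpnorm_cst0// gt_eqF// (lt_le_trans ltr01 p1).
Qed.

Lemma pairingC h k : pairing h k = pairing k h.
Proof. by apply: eq_Rintegral => x _; exact: dotC. Qed.

Lemma pairingP p q (a : R) h1 h2 k : 1 <= p -> 1 <= q -> p^-1 + q^-1 = 1 ->
  VL p h1 -> VL p h2 -> VL q k ->
  pairing (fun x => a *: h1 x + h2 x) k = a * pairing h1 k + pairing h2 k.
Proof. exact: (Rintegral_dotP mOm). Qed.

Lemma pairing_le p q h k : 1 <= p -> 1 <= q -> p^-1 + q^-1 = 1 ->
  VL p h -> VL q k -> `|pairing h k| <= VN p h * VN q k.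
Proof. exact: (Rintegral_dot_le mOm). Qed.

Lemma VN2_sqr h : VL 2 h -> VN 2 h ^+ 2 = pairing h h.
Proof. exact: (vnorm2_sqr mOm). Qed.

Lemma half_half : 2^-1 + 2^-1 = 1 :> R.
Proof. by rewrite [RHS]splitr !div1r. Qed.

Let l12 : (1 : R) <= 2. Proof. by rewrite ler1n. Qed.

Lemma pairing2P (a : R) h1 h2 k : VL 2 h1 -> VL 2 h2 -> VL 2 k ->
  pairing (fun x => a *: h1 x + h2 x) k = a * pairing h1 k + pairing h2 k.
Proof. exact: (pairingP _ l12 l12 half_half). Qed.

Lemma pairing2D h1 h2 k : VL 2 h1 -> VL 2 h2 -> VL 2 k ->
  pairing (fun x => h1 x + h2 x) k = pairing h1 k + pairing h2 k.
Proof.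
move=> h12 h22 k2; have := pairing2P 1 h12 h22 k2.
by under eq_fun do rewrite scale1r; rewrite mul1r.
Qed.

Lemma pairing2Z (a : R) h k : VL 2 h -> VL 2 k ->
  pairing (fun x => a *: h x) k = a * pairing h k.
Proof.
move=> h2 k2; have := pairing2P a h2 (VL0 l12) k2.
under eq_fun do rewrite addr0.
rewrite [in X in _ = _ + X](_ : pairing _ _ = 0) ?addr0//.
apply/eqP; rewrite -normr_le0; apply: le_trans (pairing_le l12 l12 half_half (VL0 l12) k2) _.
by rewrite (VN0 l12) mul0r.
Qed.

Lemma pairing2_le h k : VL 2 h -> VL 2 k -> `|pairing h k| <= VN 2 h * VN 2 k.
Proof. exact: (pairing_le l12 l12 half_half). Qed.

Lemma pairing_integrable p q h k : 1 <= p -> 1 <= q -> p^-1 + q^-1 = 1 ->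
  VL p h -> VL q k ->
  (\int[mu]_(x in Om) (dot (h x) (k x))%:E)%E = (pairing h k)%:E.
Proof.
move=> p1 q1 pq hp kq; rewrite fineK//; apply: (integrable_fin_num mOm).
exact: (integrable_dot mOm p1 q1 pq hp kq).
Qed.

Lemma dformE c (w v : sob R n) : VL 2 (fun x => c x *: sgrad w x) ->
  VL 2 (sgrad v) ->
  dform Om c w v = (pairing (fun x => c x *: sgrad w x) (sgrad v))%:E.
Proof.
move=> cw v2; rewrite -(pairing_integrable l12 l12 half_half cw v2).
by apply: eq_integral => x _; rewrite dotZl.
Qed.

Section coefficient.
Variables (ul uu : R).
Hypotheses (ul0 : 0 < ul) (ulu : ul <= uu).

Lemma Uad_measurable c : Uad Om ul uu c ->
  measurable_fun (Om : set (lebT R n)) (c : lebT R n -> R).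
Proof. by move=> [[[mc _] _] _]. Qed.

Lemma Uad_norm_le c : Uad Om ul uu c ->
  {ae mu, forall x, Om x -> `|c x| <= uu}.
Proof.
move=> [_ cb]; apply: filterS cb => x cb Ox; have /andP[c1 c2] := cb Ox.
by rewrite ger0_norm// (le_trans (ltW ul0)).
Qed.

Lemma VL_bounded p (M : R) c h : 1 <= p -> 0 <= M ->
  measurable_fun (Om : set (lebT R n)) (c : lebT R n -> R) ->
  {ae mu, forall x, Om x -> `|c x| <= M} -> VL p h ->
  VL p (fun x => c x *: h x) /\ VN p (fun x => c x *: h x) <= M * VN p h.
Proof.
move=> p1 M0 mc cM hp.
have mch i : measurable_fun (Om : set (lebT R n))
    ((fun x => (c x *: h x) 0 i) : lebT R n -> R).
  by under eq_fun do rewrite mxE; apply: measurable_funM; [exact: mc|exact: (hp i).1].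
apply: (Lv_le_ae mOm p1 M0 mch hp).
apply: filterS cM => x cM Ox; rewrite enormZ ler_wpM2r ?enorm_ge0//; exact: cM.
Qed.

Lemma VL_Uad p c h : 1 <= p -> Uad Om ul uu c -> VL p h ->
  VL p (fun x => c x *: h x) /\ VN p (fun x => c x *: h x) <= uu * VN p h.
Proof.
move=> p1 cU; apply: VL_bounded => //.
- exact: (le_trans (ltW ul0)).
- exact: Uad_measurable.
- exact: Uad_norm_le.
Qed.

Lemma Uad_coercive c h : Uad Om ul uu c -> VL 2 h ->
  ul * VN 2 h ^+ 2 <= pairing (fun x => c x *: h x) h.
Proof.
move=> cU h2; have [ch2 _] := VL_Uad l12 cU h2.
have [_ cb] := cU; have mc := Uad_measurable cU.
have mdot := measurable_dot (Lv_measurable h2) (Lv_measurable h2).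
rewrite (VN2_sqr h2) -(pairing2Z ul h2 h2) -lee_fin.
have e1 := pairing_integrable l12 l12 half_half (VLZ ul l12 h2) h2.
have e2 := pairing_integrable l12 l12 half_half ch2 h2.
rewrite -e1 -e2.
under eq_integral do rewrite dotZl.
under [leRHS]eq_integral do rewrite dotZl.
have mf a : measurable_fun (Om : set (lebT R n)) (a : lebT R n -> R) ->
    measurable_fun (Om : set (lebT R n))
      ((fun x => (a x * dot (h x) (h x))%:E) : lebT R n -> \bar R).
  by move=> ma; apply/measurable_EFinP; apply: measurable_funM; [exact: ma|exact: mdot].
(* The bounds on [c] hold almost everywhere only, but the comparison of integrals wants integrands
   that are nonnegative everywhere; [c] is replaced by [|c|]. *)
have mn : measurable_fun (Om : set (lebT R n)) ((fun x => `|c x|) : lebT R n -> R).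
  by apply: (measurableT_comp _ mc); exact: measurable_realfun.normr_measurable.
rewrite [leRHS](ae_eq_integral _ _ mOm (mf _ mc) (mf _ mn)); last first.
  apply: filterS cb => x cb Ox; have /andP[c1 c2] := cb Ox.
  by rewrite ger0_norm// (le_trans (ltW ul0)).
apply: (ae_ge0_le_integral mOm).
- by move=> x _; rewrite lee_fin mulr_ge0 ?dot_ge0// ltW.
- by apply: mf; exact: measurable_cst.
- by move=> x _; rewrite lee_fin mulr_ge0 ?dot_ge0.
- exact: mf.
apply: filterS cb => x cb Ox; have /andP[c1 c2] := cb Ox.
by rewrite lee_fin ler_wpM2r ?dot_ge0// ger0_norm// (le_trans (ltW ul0)).
Qed.

End coefficient.
End pairing.

Lemma slob_norm0 (R : realType) (n : nat) (G : set 'rV[R]_n.+2) (p : R) :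
  0 < p -> slob_norm G p (fun=> 0) = 0%E.
Proof.
move=> p0; have pN0 : p != 0 by rewrite gt_eqF.
rewrite /slob_norm integral0_eq => [|x _]; last by rewrite normr0 powR0.
rewrite integral0_eq => [|x _].
  by rewrite adde0 poweR0r// invr_neq0.
by rewrite integral0_eq// => y _; rewrite subr0 normr0 powR0// mul0r.
Qed.

(** * The linear equation and its regularity estimate *)

Section equations.
Context (R : realType) (n : nat) (Om Gt : set 'rV[R]_n.+2) (ul uu s : R).
Hypotheses (oOm : open Om) (bOm : bounded_set Om) (cGt : closed Gt).
Hypotheses (ul0 : 0 < ul) (ulu : ul <= uu).
Hypothesis reg : regularity_exponent Om Gt ul uu s.
Local Notation mu := (leb R n.+1).
Local Notation vec := ('rV[R]_n.+2 -> 'rV[R]_n.+2).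
Local Notation V := (W1D Om Gt 2).
Local Notation VL := (VL Om).
Local Notation VN := (VN Om).
Local Notation pairing := (pairing Om).
Implicit Types (u : 'rV[R]_n.+2 -> R) (h k : vec) (v w z : sob R n.+1).

Let l12 : (1 : R) <= 2. Proof. by rewrite ler1n. Qed.
Let mOm := domain_measurable oOm.
Let finOm := domain_finite bOm.

(* [- div (u grad z) = div h] in [Om], [z = 0] on [Gt], with the natural
   boundary condition on the rest of the boundary *)
Definition solves u h z := V z /\ forall v, V v ->
  pairing (fun x => u x *: sgrad z x) (sgrad v) = - pairing h (sgrad v).

Lemma W1D_VL p v : W1D Om Gt p v -> VL p (sgrad v).
Proof. by move=> [[_ gv _] _]. Qed.

Lemma flux_VL u v : Uad Om ul uu u -> V v -> VL 2 (fun x => u x *: sgrad v x).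
Proof. by move=> uU /W1D_VL v2; have [] := VL_Uad oOm ul0 ulu l12 uU v2. Qed.

Lemma solves_linear u (a : R) h k z w : Uad Om ul uu u ->
  VL 2 h -> VL 2 k -> solves u h z -> solves u k w ->
  solves u (fun x => a *: h x + k x) (a *: z + w).
Proof.
move=> uU h2 k2 [Vz hz] [Vw kw]; split.
  exact: (W1D_linear oOm bOm cGt a l12 Vz Vw).
move=> v Vv; have v2 := W1D_VL Vv.
rewrite (pairing2P oOm a h2 k2 v2) opprD -mulrN -hz// -kw//.
rewrite -(pairing2P oOm a (flux_VL uU Vz) (flux_VL uU Vw) v2).
apply: (f_equal (fun g => pairing g (sgrad v))); apply/funext => x.
by rewrite sgradP scalerDr !scalerA mulrC.
Qed.

Lemma conj_exp_bounds (p : R) : 2 <= p ->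
  [/\ 1 <= conj_exp p, conj_exp p <= 2 & p^-1 + (conj_exp p)^-1 = 1].
Proof.
move=> p2; have p1 : 0 < p - 1 by rewrite subr_gt0 (lt_le_trans _ p2)// ltr1n.
have p0 : 0 < p by rewrite (lt_le_trans _ p2).
rewrite /conj_exp; split.
- by rewrite ler_pdivlMr// mul1r gerBl.
- by rewrite ler_pdivrMr// mulrBr mulr1 lerBrDr mulr2n mulrDl mul1r lerD2l.
- by rewrite invf_div mulrBl divff ?gt_eqF// mul1r subrKC.
Qed.

(** The bridge to the regularity estimate, which is stated for states: the lift is 0 and the
    right-hand side is the functional induced by [h]. *)
Lemma is_state_of_solves u h z : Uad Om ul uu u -> VL 2 h -> solves u h z ->
  is_state Om Gt 0 (fun v => - pairing h (sgrad v)) u z.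
Proof.
move=> uU h2 [Vz hz]; split; [exact: Vz.1|by rewrite subr0|move=> v Vv].
by rewrite (dformE oOm (flux_VL uU Vz) (W1D_VL Vv)) hz.
Qed.

(** By Hölder; the dual norm is taken over the unit ball of the full W^{1,p'} norm, which dominates
    that of the gradient. *)
Lemma functional_Wdual p h : 2 <= p -> VL p h ->
  Wdual Om Gt p (fun v => - pairing h (sgrad v)) /\
  (dual_norm Om Gt p (fun v => (- pairing h (sgrad v))%R) <= (VN p h)%:E)%E.
Proof.
move=> p2 hp; have [q1 q2 pq] := conj_exp_bounds p2.
have p1 : 1 <= p by exact: le_trans p2.
have q0 : 0 < conj_exp p by exact: lt_le_trans q1.
have dn : (dual_norm Om Gt p (fun v => (- pairing h (sgrad v))%R) <= (VN p h)%:E)%E.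
  apply: ge_ereal_sup => _ [v [Vv v1] <-]; rewrite lee_fin normrN.
  have vq := W1D_VL Vv.
  apply: le_trans (pairing_le oOm p1 q1 pq hp vq) _.
  rewrite ler_piMr ?VN_ge0// -lee_fin -(VNK oOm q1 vq).
  exact: le_trans (Lpnorm_grad_le_W1norm Om v q0) v1.
split; last exact: dn.
split; last exact: le_lt_trans dn (ltry _).
move=> a v w Vv Vw; rewrite !(pairingC Om h).
have qp : (conj_exp p)^-1 + p^-1 = 1 by rewrite addrC.
rewrite sgradP (pairingP oOm a q1 p1 qp (W1D_VL Vv) (W1D_VL Vw) hp).
by rewrite opprD mulrN.
Qed.

Lemma solves_estimate p : 2 <= p <= s -> exists2 C, 0 <= C &
  forall u h z, Uad Om ul uu u -> VL p h -> solves u h z ->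
  (W1norm Om p z <= (C * VN p h)%:E)%E.
Proof.
move=> p2s; have /andP[p2 ps] := p2s; have [_ /(_ p p2s)[C C0 HC]] := reg.
have p0 : 0 < p by exact: lt_le_trans p2.
exists C => // u h z uU hp sz.
have h2 : VL 2 h by exact: (VL_subset oOm bOm l12 p2 hp).
have [Fd Fn] := functional_Wdual p2 hp.
have fD0 : Wtrace Gt p (fun=> 0).
  by split; [exact: measurable_cst|rewrite slob_norm0].
have lift0 : is_lift Om Gt p (fun=> 0) 0.
  split; [exact: W10|exact: trace00|move=> v _].
  by rewrite /dform integral0_eq// => x _; rewrite dot0l mulr0.
apply: le_trans (HC _ _ _ _ _ Fd fD0 lift0 uU (is_state_of_solves uU h2 sz)) _.
by rewrite slob_norm0// add0e EFinM lee_wpmul2l// lee_fin.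
Qed.

Lemma solves_estimate_grad p : 2 <= p <= s -> exists2 C, 0 <= C &
  forall u h z, Uad Om ul uu u -> VL p h -> solves u h z ->
  [/\ (W1norm Om p z <= (C * VN p h)%:E)%E, VL p (sgrad z) &
      VN p (sgrad z) <= C * VN p h].
Proof.
move=> p2s; have [C C0 HC] := solves_estimate p2s; exists C; first exact: C0.
have /andP[p2 ps] := p2s; have p1 : 1 <= p by exact: le_trans p2.
have p0 : 0 < p by exact: lt_le_trans p2.
move=> u h z uU hp sz; have Wz := HC _ _ _ uU hp sz.
have gz := le_trans (Lpnorm_grad_le_W1norm Om z p0) Wz.
have [mz gmz] := W1_measurable sz.1.1.
have zp : VL p (sgrad z).
  apply: (LvP mu mOm (sgrad z) p1).2; split; first exact: gmz.
  split; [exact: (measurable_enorm gmz)|exact: le_lt_trans gz (ltry _)].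
by split; [exact: Wz|exact: zp|rewrite -lee_fin -(VNK oOm p1 zp)].
Qed.

(* [v] solves the equation with data [- u grad v], so that the regularity
   estimate bounds it by its gradient *)
Lemma poincare u : Uad Om ul uu u -> exists2 C, 0 <= C & forall v, V v ->
  (W1norm Om 2 v <= (C * VN 2 (sgrad v))%:E)%E.
Proof.
move=> uU; have s2 : (2 : R) <= 2 <= s by rewrite lexx/= ltW//; case: reg.
have [C C0 HC] := solves_estimate s2; exists (C * uu).
  by rewrite mulr_ge0// (le_trans (ltW ul0)).
move=> v Vv; have [uv2 uvn] := VL_Uad oOm ul0 ulu l12 uU (W1D_VL Vv).
have h2 := VLZ oOm (-1) l12 uv2.
have sv : solves u (fun x => -1 *: (u x *: sgrad v x)) v.
  split; [exact: Vv|move=> w Vw].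
  by rewrite (pairing2Z oOm _ uv2 (W1D_VL Vw)) mulN1r opprK.
apply: le_trans (HC _ _ _ uU h2 sv) _.
by rewrite lee_fin (VNZ oOm _ l12 uv2) normrN1 mul1r -mulrA ler_wpM2l.
Qed.

End equations.

Lemma cvg_geometric_half (R : realType) (K : R) :
  K * 2 ^- k @[k --> \oo] --> (0 : R).
Proof.
rewrite -[X in _ --> X](mulr0 K); apply: cvgMr.
rewrite (_ : (fun k => _) = (fun k => (2^-1) ^+ k)).
  by apply: cvg_expr; rewrite gtr0_norm ?invf_lt1// ltr1n.
by apply/funext => k; rewrite exprVn.
Qed.

(** * Existence of weak solutions *)

Section existence.
Context (R : realType) (n : nat) (Om Gt : set 'rV[R]_n.+2) (ul uu s : R).
Hypotheses (oOm : open Om) (bOm : bounded_set Om) (cGt : closed Gt).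
Hypotheses (ul0 : 0 < ul) (ulu : ul <= uu).
Hypothesis reg : regularity_exponent Om Gt ul uu s.
Local Notation mu := (leb R n.+1).
Local Notation vec := ('rV[R]_n.+2 -> 'rV[R]_n.+2).
Local Notation V := (W1D Om Gt 2).
Local Notation VL := (VL Om).
Local Notation VN := (VN Om).
Local Notation pairing := (pairing Om).
Implicit Types (u : 'rV[R]_n.+2 -> R) (h : vec) (v w z : sob R n.+1).

Let l12 : (1 : R) <= 2. Proof. by rewrite ler1n. Qed.
Let mOm := domain_measurable oOm.
Let finOm := domain_finite bOm.

Lemma Lpnorm_coord_le p h i : 1 <= p -> VL p h ->
  (Lpnorm mu Om p (fun x => h x 0%R i) <= (VN p h)%:E)%E.
Proof.
move=> p1 hp; rewrite -(VNK oOm p1 hp); have p0 := lt_le_trans ltr01 p1.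
apply: (le_Lpnorm_ae mOm p0 (Lv_measurable hp i)
  (measurable_enorm (Lv_measurable hp))).
by apply: aeW => x _; rewrite (ger0_norm (enorm_ge0 _)) coord_le_enorm.
Qed.

Lemma W1D_VLB p v w : 1 <= p -> W1D Om Gt p v -> W1D Om Gt p w ->
  VL p (sgrad (v - w)).
Proof. by move=> p1 Vv Vw; exact: (VLB oOm p1 (W1D_VL Vv) (W1D_VL Vw)). Qed.

Lemma W1DB p v w : 1 <= p -> W1D Om Gt p v -> W1D Om Gt p w ->
  W1D Om Gt p (v - w).
Proof.
move=> p1 Vv Vw; rewrite -scaleN1r addrC.
exact: (W1D_linear oOm bOm cGt (-1) p1 Vw Vv).
Qed.

(** The hypothesis controls gradients only; Poincaré's inequality makes the functions a Cauchy
    sequence as well. Function and gradient components converge separately in L^2, and the pair of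
    limits is in the space because weak gradients and zero traces are closed under convergence in
    L^1. *)
Lemma W1D_complete u (K : R) (v_ : nat -> sob R n.+1) : Uad Om ul uu u ->
  0 <= K -> (forall k, V (v_ k)) ->
  (forall k, VN 2 (sgrad (v_ k.+1 - v_ k)) <= K * 2 ^- k) ->
  exists2 v, V v & exists2 K', 0 <= K' &
    forall k, VN 2 (sgrad (v_ k - v)) <= K' * 2 ^- k.
Proof.
move=> uU K0 Vv_ dv; have [C C0 HC] := poincare oOm bOm ul0 ulu reg uU.
(* One constant for both: [C * K] bounds the increments of the functions and [K] those of the
   gradients. *)
pose K1 := (C + 1) * K.
have K10 : 0 <= K1 by rewrite mulr_ge0// addr_ge0.
have half0 k : 0 <= 2 ^- k :> R by rewrite invr_ge0 exprn_ge0.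
have [f f2 fle] : exists2 f, Lp mu Om 2 f & forall k,
    (Lpnorm mu Om 2 (fun x => (Defs.sfun (v_ k) x - f x)%R) <= (2 * K1 * 2 ^- k)%:E)%E.
  apply: (Lp_complete mOm finOm l12 K10 (fun k => W1_Lp (Vv_ k).1)) => k.
  have Vd := W1DB l12 (Vv_ k.+1) (Vv_ k).
  apply: le_trans (Lpnorm_le_W1norm Om (v_ k.+1 - v_ k) (ltr0n _ 2)) _.
  apply: le_trans (HC _ Vd) _; rewrite lee_fin.
  apply: le_trans (ler_wpM2l C0 (dv k)) _.
  by rewrite mulrA ler_wpM2r// ler_wpM2r// lerDl.
have gP i : exists gi, Lp mu Om 2 gi /\ forall k,
    (Lpnorm mu Om 2 (fun x => (sgrad (v_ k) x 0%R i - gi x)%R) <= (2 * K1 * 2 ^- k)%:E)%E.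
  have gk k : Lp mu Om 2 (fun x => sgrad (v_ k) x 0 i) by exact: (W1D_VL (Vv_ k)).
  have [k|g g2 gle] := Lp_complete mOm finOm l12 K10 gk; last by exists g.
  have hd := W1D_VLB l12 (Vv_ k.+1) (Vv_ k).
  have := Lpnorm_coord_le i l12 hd.
  have -> : (fun x => sgrad (v_ k.+1 - v_ k) x 0 i) =
            (fun x => sgrad (v_ k.+1) x 0 i - sgrad (v_ k) x 0 i).
    by apply/funext => x; rewrite /sgrad !mxE.
  move=> /le_trans; apply; rewrite lee_fin; apply: le_trans (dv k) _.
  by rewrite ler_wpM2r// ler_peMl// lerDr.
have {gP}[g gP] := choice gP.
pose v : sob R n.+1 := (f, fun x => \row_i g i x).
have vi i : (fun x => sgrad v x 0 i) = g i by apply/funext => x; rewrite mxE.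
have vg i : Lp mu Om 2 (fun x => sgrad v x 0 i) by rewrite vi; have [] := gP i.
have dgE k i : (fun x => sgrad (v_ k - v) x 0 i) =
    (fun x => sgrad (v_ k) x 0 i - g i x).
  by apply/funext => x; rewrite /sgrad !mxE.
have dg2 k i : (Lpnorm mu Om 2 (fun x => sgrad (v_ k - v) x 0%R i)
    <= (2 * K1 * 2 ^- k)%:E)%E by rewrite dgE; have [_] := gP i.
pose c := fine (mu Om) `^ (1^-1 - 2^-1).
pose e_ k := (2 * K1 * c) * 2 ^- k.
have e_E k : e_ k = 2 * K1 * 2 ^- k * c by rewrite /e_ mulrAC.
have c0 : (0 <= c%:E)%E by rewrite lee_fin powR_ge0.
have sub12 (a : lebT R n.+1 -> R) k :
    measurable_fun (Om : set (lebT R n.+1)) a ->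
    (Lpnorm mu Om 2 a <= (2 * K1 * 2 ^- k)%:E)%E ->
    (Lpnorm mu Om 1 a <= (e_ k)%:E)%E.
  move=> ma a2; apply: le_trans (Lpnorm_subset mOm finOm ltr01 l12 ma) _.
  by rewrite e_E EFinM; exact: lee_wpmul2r.
have md k : measurable_fun (Om : set (lebT R n.+1))
    ((fun x => Defs.sfun (v_ k) x - f x) : lebT R n.+1 -> R).
  by apply: measurable_funB; [exact: (W1_Lp (Vv_ k).1).1|exact: f2.1].
have mdg k i : measurable_fun (Om : set (lebT R n.+1))
    ((fun x => sgrad (v_ k - v) x 0 i) : lebT R n.+1 -> R).
  rewrite dgE; apply: measurable_funB; last by have [[]] := gP i.
  by have [_ /(_ i)[]] := (Vv_ k).1.
have e1 k := sub12 _ k (md k) (fle k).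
have g1 k i := sub12 _ k (mdg k i) (dg2 k i).
have Wv : W1 Om 2 v.
  apply: (@W1_limit R n.+1 Om oOm bOm 2 v_ v e_ l12 (fun k => (Vv_ k).1) f2 vg).
  - exact: cvg_geometric_half.
  - exact: e1.
  - move=> k i; have := g1 k i; rewrite dgE.
    by under [in X in _ -> X]eq_fun do rewrite mxE.
have Vv : V v.
  apply: (W1D_limit oOm bOm l12 Vv_ Wv) => e egt0.
  (* One summand for the function and [n.+2] for the components of its gradient. *)
  have : \forall k \near \oo, e_ k *+ n.+3 < e.
    have lim : e_ k *+ n.+3 @[k --> \oo] --> (0 : R).
      under eq_fun do rewrite /e_ -mulr_natl mulrA.
      exact: cvg_geometric_half.
    move/cvgrPdist_lt : lim => /(_ e egt0); apply: filterS => k.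
    by rewrite sub0r normrN; exact: le_lt_trans (ler_norm _).
  move=> /filter_ex[k ke]; exists k; have : ((e_ k *+ n.+3)%:E < e%:E)%E.
    by rewrite lte_fin; exact: ke.
  apply: le_lt_trans.
  rewrite W1norm1E mulrS EFinD; apply: leeD; first exact: e1.
  exact: (Lpnorm_enorm_le mOm (lexx 1) (mdg k) (g1 k)).
exists v; first exact: Vv.
exists (2 * K1 *+ n.+2); first by rewrite mulrn_wge0// mulr_ge0.
move=> k; rewrite -lee_fin -(VNK oOm l12 (W1D_VLB l12 (Vv_ k) Vv)).
rewrite (mulrnAl (2 * K1)); exact: (Lpnorm_enorm_le mOm l12 (mdg k) (dg2 k)).
Qed.

(** The coefficient is scalar, so the form is symmetric and minimisation suffices. By coercivity [F
    v ^+ 2 <= M ^+ 2 * VN 2 (sgrad v) ^+ 2 <= M ^+ 2 / ul * B v v], which is the constant passed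
    on. *)
Lemma lax_milgram u (M : R) (F : sob R n.+1 -> R) : Uad Om ul uu u -> 0 <= M ->
  (forall a v w, V v -> V w -> F (a *: v + w) = a * F v + F w) ->
  (forall v, V v -> `|F v| <= M * VN 2 (sgrad v)) ->
  exists2 z, V z & forall v, V v ->
    pairing (fun x => u x *: sgrad z x) (sgrad v) = F v.
Proof.
move=> uU M0 FP FM.
have fl v : V v -> VL 2 (fun x => u x *: sgrad v x).
  exact: (flux_VL oOm ul0 ulu uU).
have co v : V v -> ul * VN 2 (sgrad v) ^+ 2 <=
    pairing (fun x => u x *: sgrad v x) (sgrad v).
  by move=> Vv; exact: (Uad_coercive oOm ul0 ulu uU (W1D_VL Vv)).
have up v : V v -> pairing (fun x => u x *: sgrad v x) (sgrad v) <=
    uu * VN 2 (sgrad v) ^+ 2.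
  move=> Vv; apply: le_trans (ler_norm _) _.
  apply: le_trans (pairing2_le oOm (fl _ Vv) (W1D_VL Vv)) _.
  rewrite expr2 mulrA ler_wpM2r ?VN_ge0//.
  by have [_] := VL_Uad oOm ul0 ulu l12 uU (W1D_VL Vv).
pose B v w := pairing (fun x => u x *: sgrad v x) (sgrad w).
apply: (@riesz_representation R (sob R n.+1) V B _ _ _ _ _ F (M ^+ 2 / ul)).
- exact: W1D0.
- by move=> a v w; exact: (W1D_linear oOm bOm cGt a l12).
- move=> a v w z Vv Vw Vz; rewrite /B.
  rewrite -(pairing2P oOm a (fl _ Vv) (fl _ Vw) (W1D_VL Vz)).
  apply: (f_equal (fun g => pairing g (sgrad z))); apply/funext => x.
  by rewrite sgradP scalerDr !scalerA mulrC.
- move=> v w Vv Vw; apply: eq_Rintegral => x _.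
  by rewrite dotZl dotC -dotZl.
- move=> v Vv; apply: le_trans (co _ Vv); rewrite mulr_ge0 ?sqr_ge0//.
  exact: ltW.
- by rewrite divr_ge0 ?sqr_ge0// ltW.
- exact: FP.
- move=> v Vv; rewrite -real_normK ?num_real//.
  apply: (@le_trans _ _ ((M * VN 2 (sgrad v)) ^+ 2)).
    by rewrite ler_pXn2r ?nnegrE ?mulr_ge0 ?VN_ge0//; exact: FM.
  rewrite exprMn -mulrA ler_wpM2l ?sqr_ge0// ler_pdivlMl//.
  exact: co.
- move=> v_ Vv_ Bv_.
  (* Coercivity gives [ul * VN ^+ 2 <= 4 ^- k.+1 + 4 ^- k <= 2 * 4 ^- k] for consecutive terms. *)
  pose K0 := Num.sqrt (2 / ul).
  have dv k : VN 2 (sgrad (v_ k.+1 - v_ k)) <= K0 * 2 ^- k.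
    rewrite -(@ler_pXn2r _ 2) ?nnegrE ?VN_ge0 ?mulr_ge0 ?sqrtr_ge0 ?invr_ge0 ?exprn_ge0//.
    rewrite exprMn sqr_sqrtr ?divr_ge0 ?(ltW ul0)//.
    rewrite -mulrA mulrCA ler_pdivlMl//.
    apply: le_trans (co _ (W1DB l12 (Vv_ k.+1) (Vv_ k))) _.
    apply: le_trans (Bv_ _ _) _; rewrite exprVn -exprM mulnC exprM.
    have -> : (2 : R) ^+ 2 = 4 by rewrite -natrX.
    rewrite mulr2n mulrDl mul1r lerD2r lef_pV2 ?posrE ?exprn_gt0//.
    by rewrite exprS ler_peMl ?exprn_ge0// ler1n.
  have K00 : 0 <= K0 by exact: sqrtr_ge0.
  have [v Vv [K' K'0 vK']] := W1D_complete uU K00 Vv_ dv.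
  exists v; first exact: Vv.
  have lim : uu * (K' * 2 ^- k) ^+ 2 @[k --> \oo] --> (0 : R).
    rewrite -[X in _ --> X](mulr0 uu); apply: cvgMr.
    rewrite -[X in _ --> X](mulr0 (0 : R)).
    exact: (cvgM (cvg_geometric_half K') (cvg_geometric_half K')).
  apply: squeeze_cvgr lim; last exact: cvg_cst.
  apply: nearW => k; have Vd := W1DB l12 (Vv_ k) Vv; apply/andP; split.
    by apply: le_trans (co _ Vd); rewrite mulr_ge0 ?sqr_ge0// ltW.
  apply: le_trans (up _ Vd) _; rewrite ler_wpM2l//.
    by rewrite (le_trans (ltW ul0)).
  by rewrite ler_pXn2r ?nnegrE ?VN_ge0 ?mulr_ge0 ?invr_ge0 ?exprn_ge0.
Qed.

Lemma solves_exists u h : Uad Om ul uu u -> VL 2 h ->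
  exists z, solves Om Gt u h z.
Proof.
move=> uU h2.
have [a v w Vv Vw|v Vv|z Vz Hz] :=
  lax_milgram (F := fun v => - pairing h (sgrad v)) uU (VN_ge0 Om 2 h).
- rewrite !(pairingC Om h) sgradP (pairing2P oOm a (W1D_VL Vv) (W1D_VL Vw) h2).
  by rewrite opprD mulrN.
- by rewrite normrN; exact: (pairing2_le oOm h2 (W1D_VL Vv)).
- by exists z; split; [exact: Vz|exact: Hz].
Qed.

End existence.

(** * The state and its uniform bound *)

Section state.
Context (R : realType) (n : nat) (Om Gt : set 'rV[R]_n.+2) (ul uu s : R).
Hypotheses (oOm : open Om) (bOm : bounded_set Om) (cGt : closed Gt).
Hypotheses (ul0 : 0 < ul) (ulu : ul <= uu).
Hypothesis reg : regularity_exponent Om Gt ul uu s.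
Variables (f : sob R n.+1 -> R) (fD : 'rV[R]_n.+2 -> R) (ft : sob R n.+1).
Hypotheses (fW : Wdual Om Gt s f) (fDW : Wtrace Gt s fD)
  (ftL : is_lift Om Gt s fD ft).
Local Notation mu := (leb R n.+1).
Local Notation V := (W1D Om Gt 2).
Local Notation VL := (VL Om).
Local Notation VN := (VN Om).
Local Notation pairing := (pairing Om).
Implicit Types (u : 'rV[R]_n.+2 -> R) (v w z : sob R n.+1).

Let l12 : (1 : R) <= 2. Proof. by rewrite ler1n. Qed.
Let s2 : 2 <= s. Proof. by apply: ltW; case: reg. Qed.
Let mOm := domain_measurable oOm.
Let finOm := domain_finite bOm.

Lemma W1norm_le p (M : R) w : 0 < p -> 0 <= M ->
  (Lpnorm mu Om p (Defs.sfun w) <= M%:E)%E ->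
  (Lpnorm mu Om p (fun x => enorm (sgrad w x)) <= M%:E)%E ->
  (W1norm Om p w <= (2 `^ p^-1 * M)%:E)%E.
Proof.
move=> p0 M0 wM gM.
have le_pow (a : \bar R) : (0 <= a)%E -> (a <= M%:E)%E -> (a `^ p <= (M `^ p)%:E)%E.
  move=> a0 aM; rewrite -poweR_EFin; apply: gt0_ler_poweR => //.
  - exact: ltW.
  - by rewrite in_itv/= a0 leey.
  - by rewrite in_itv/= lee_fin M0 leey.
have -> : (2 `^ p^-1 * M)%:E = ((2 * M `^ p)%:E `^ p^-1)%E.
  by rewrite poweR_EFin powRM ?powR_ge0// -powRrM mulfV ?gt_eqF// powRr1.
apply: gt0_ler_poweR.
- by rewrite invr_ge0 ltW.
- by rewrite in_itv/= leey andbT adde_ge0// poweR_ge0.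
- by rewrite in_itv/= leey andbT lee_fin mulr_ge0// powR_ge0.
rewrite mulr2n mulrDl mul1r EFinD; apply: leeD.
  by apply: le_pow => //; exact: Lpnorm_ge0.
by apply: le_pow => //; exact: Lpnorm_ge0.
Qed.

(** [f] is bounded in the norm of W^{1,s'} with s' <= 2. Poincaré's inequality and the inclusion of
    L^2 in L^{s'} on the bounded domain, with constant [c], bound this norm by the L^2 norm of the
    gradient. The dual norm is a supremum over the unit ball, so that [v] has to be scaled into
    it. *)
Lemma Wdual_bound u : Uad Om ul uu u -> exists2 D, 0 <= D &
  forall v, V v -> `|f v| <= D * VN 2 (sgrad v).
Proof.
move=> uU; have [C C0 HC] := poincare oOm bOm ul0 ulu reg uU.
have [p1 p2 _] := conj_exp_bounds s2.
have [flin fn] := fW; set p := conj_exp s in p1 p2 flin.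
have p0 : 0 < p by exact: lt_le_trans p1.
pose D := fine (dual_norm Om Gt s f).
have dn_ge0 : (0 <= dual_norm Om Gt s f)%E.
  apply: (@le_trans _ _ `|f 0|%:E); first by rewrite lee_fin.
  apply: ereal_sup_ubound; exists 0 => //; split; first exact: W1D0.
  by rewrite W1norm0// lee_fin.
have DE : dual_norm Om Gt s f = D%:E by rewrite fineK// ge0_fin_numE.
have D0 : 0 <= D by exact: fine_ge0.
pose c := fine (mu Om) `^ (p^-1 - 2^-1).
have c0 : 0 <= c by exact: powR_ge0.
pose b := 2 `^ p^-1 : R; have b0 : 0 < b by exact: powR_gt0.
exists (D * (b * ((C + 1) * c))).
  by rewrite !mulr_ge0 ?(ltW b0) ?addr_ge0.
move=> v Vv; have Vpv := W1D_subset oOm bOm p1 p2 Vv.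
pose N := VN 2 (sgrad v); have N0 : 0 <= N by exact: VN_ge0.
pose M := (C + 1) * N * c; have M0 : 0 <= M by rewrite !mulr_ge0 ?addr_ge0.
have [mv gmv] := W1_measurable Vv.1.
have vM : (Lpnorm mu Om p (Defs.sfun v) <= M%:E)%E.
  apply: le_trans (Lpnorm_subset mOm finOm p0 p2 mv) _.
  rewrite /M EFinM; apply: lee_wpmul2r; first by rewrite lee_fin.
  apply: le_trans (Lpnorm_le_W1norm Om v (ltr0n _ 2)) _.
  apply: le_trans (HC _ Vv) _; rewrite lee_fin ler_wpM2r// lerDl//.
have gM : (Lpnorm mu Om p (fun x => enorm (sgrad v x)) <= M%:E)%E.
  apply: le_trans (Lpnorm_subset mOm finOm p0 p2 (measurable_enorm gmv)) _.
  rewrite /M EFinM; apply: lee_wpmul2r; first by rewrite lee_fin.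
  by rewrite (VNK oOm l12 (W1D_VL Vv)) lee_fin ler_peMl// lerDr.
have f0 : f 0 = 0.
  have V0 := W1D0 Om Gt p0; have := flin 1 0 0 V0 V0.
  rewrite scaler0 addr0 mul1r => /eqP.
  by rewrite -subr_eq0 opprD addrA subrr sub0r oppr_eq0 => /eqP.
(* [t > 0] has to dominate the norm of [v], which may vanish, hence [e]. *)
suff key e : 0 < e -> `|f v| <= D * (b * (M + e)).
  have -> : D * (b * ((C + 1) * c)) * N = D * (b * M) by rewrite /M; ring.
  apply/ler_addgt0Pr => e e0.
  have De : 0 < e / (D * b + 1) by rewrite divr_gt0// ltr_wpDl// mulr_ge0// ltW.
  apply: le_trans (key _ De) _.
  rewrite mulrDr mulrDr lerD2l !mulrA -mulrA mulrCA ger_pMr//.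
  by rewrite ler_pdivrMr ?ltr_wpDl ?mulr_ge0 ?(ltW b0)// mul1r lerDl.
move=> e0; pose t := b * (M + e).
have Me : 0 < M + e by rewrite ltr_wpDl.
have t0 : 0 < t by rewrite mulr_gt0.
have tv : (W1norm Om p (t^-1 *: v) <= 1)%E.
  have scale (a : lebT R n.+1 -> R) : measurable_fun (Om : set (lebT R n.+1)) a ->
      (Lpnorm mu Om p a <= M%:E)%E ->
      (Lpnorm mu Om p (fun x => (t^-1 * a x)%R) <= (t^-1 * M)%:E)%E.
    move=> ma aM; rewrite (LpnormZ _ mOm _ p0 ma) gtr0_norm ?invr_gt0// EFinM.
    by apply: lee_wpmul2l => //; rewrite lee_fin invr_ge0 ltW.
  have tM0 : 0 <= t^-1 * M by rewrite mulr_ge0// invr_ge0 ltW.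
  have tvM := scale _ mv vM.
  have tgM := scale _ (measurable_enorm gmv) gM.
  have gE : (fun x => enorm (sgrad (t^-1 *: v) x)) =
            (fun x => t^-1 * enorm (sgrad v x)).
    by apply/funext => x; rewrite enormZ gtr0_norm ?invr_gt0.
  rewrite -gE in tgM.
  apply: le_trans (@W1norm_le p (t^-1 * M) (t^-1 *: v) p0 tM0 tvM tgM) _.
  by rewrite lee_fin mulrCA ler_pdivrMl// mulr1 ler_pM2l// lerDl ltW.
have Vt : W1D Om Gt p (t^-1 *: v).
  by have := W1D_linear oOm bOm cGt t^-1 p1 Vpv (W1D0 Om Gt p0); rewrite addr0.
have ft_le : `|f (t^-1 *: v)| <= D.
  rewrite -lee_fin -DE; apply: ereal_sup_ubound.
  by exists (t^-1 *: v).
have ftE : f (t^-1 *: v) = t^-1 * f v.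
  by have := flin t^-1 v 0 Vpv (W1D0 Om Gt p0); rewrite !addr0 f0 addr0.
by move: ft_le; rewrite ftE normrM gtr0_norm ?invr_gt0// ler_pdivrMl// mulrC.
Qed.

(** With [y = z + ft], the unknown [z] has zero trace and represents [f] minus the functional of the
    flux [u grad ft], which is bounded because [ft] lies in W^{1,2}. *)
Lemma state_exists u : Uad Om ul uu u -> exists y, is_state Om Gt ft f u y.
Proof.
move=> uU; have [D D0 HD] := Wdual_bound uU.
have [Wft _ _] := ftL; have Wft2 := W1_subset oOm bOm l12 s2 Wft.
have ft2 := W1_Lv Wft2.
have [uft2 _] := VL_Uad oOm ul0 ulu l12 uU ft2.
have [q1 q2 _] := conj_exp_bounds s2.
pose g := fun x => u x *: sgrad ft x.
have FP a v w : V v -> V w -> f (a *: v + w) - pairing g (sgrad (a *: v + w)) =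
    a * (f v - pairing g (sgrad v)) + (f w - pairing g (sgrad w)).
  move=> Vv Vw.
  rewrite (fW.1 a v w (W1D_subset oOm bOm q1 q2 Vv) (W1D_subset oOm bOm q1 q2 Vw)).
  rewrite !(pairingC Om g) sgradP.
  by rewrite (pairing2P oOm a (W1D_VL Vv) (W1D_VL Vw) uft2); ring.
have FM v : V v -> `|f v - pairing g (sgrad v)| <= (D + VN 2 g) * VN 2 (sgrad v).
  move=> Vv; apply: le_trans (ler_normB _ _) _; rewrite mulrDl.
  apply: lerD; first exact: HD.
  exact: (pairing2_le oOm uft2 (W1D_VL Vv)).
have M0 : 0 <= D + VN 2 g by rewrite addr_ge0// VN_ge0.
have [z Vz Hz] := lax_milgram oOm bOm cGt ul0 ulu reg uU M0 FP FM.
exists (z + ft); split.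
- by have := W1_linear oOm bOm 1 l12 Vz.1 Wft2; rewrite scale1r.
- by rewrite addrK.
move=> v Vv; have uz2 := flux_VL oOm ul0 ulu uU Vz.
have v2 := W1D_VL Vv.
have E : (fun x => u x *: sgrad (z + ft) x) = (fun x => u x *: sgrad z x + g x).
  by apply/funext => x; rewrite /g -scalerDr.
have s2' : VL 2 (fun x => u x *: sgrad (z + ft) x).
  by rewrite E; exact: (VLD oOm l12 uz2 uft2).
rewrite (dformE oOm s2' v2) E (pairing2D oOm uz2 uft2 v2) Hz//.
by rewrite subrK.
Qed.

Lemma stateP u : Uad Om ul uu u -> is_state Om Gt ft f u (state Om Gt ft f u).
Proof. by move=> uU; apply: xgetPex; exact: state_exists. Qed.

Lemma state_bound : exists2 K, 0 <= K & forall u, Uad Om ul uu u ->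
  VL s (sgrad (state Om Gt ft f u)) /\ VN s (sgrad (state Om Gt ft f u)) <= K.
Proof.
have ss : 2 <= s <= s by rewrite lexx s2.
have s0 : 0 < s by exact: lt_le_trans s2.
have s1 : 1 <= s by exact: le_trans s2.
have [_ /(_ s ss)[C C0 HC]] := reg.
have [_ fDfin] := fDW; have [_ ffin] := fW.
pose K := (fine (slob_norm Gt s fD) + fine (dual_norm Om Gt s f)).
have KE : (slob_norm Gt s fD + dual_norm Om Gt s f <= (Num.max 0 K)%:E)%E.
  (* [fine] sends -oo to 0, so this bound asks for no sign; the maximum with 0 then makes the
     constant nonnegative. *)
  have fb (x : \bar R) : (x < +oo)%E -> (x <= (fine x)%:E)%E.
    by case: x => // _; rewrite leNye.
  apply: (@le_trans _ _ K%:E); first by rewrite EFinD; apply: leeD; exact: fb.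
  by rewrite lee_fin le_max lexx orbT.
have K0 : 0 <= Num.max 0 K by rewrite le_max lexx.
exists (C * Num.max 0 K); first by rewrite mulr_ge0.
move=> u uU; have yS := stateP uU; set y := state Om Gt ft f u in yS *.
have yW : (W1norm Om s y <= (C * Num.max 0 K)%:E)%E.
  apply: le_trans (HC _ _ _ _ _ fW fDW ftL uU yS) _.
  by rewrite EFinM; apply: lee_wpmul2l; rewrite ?lee_fin.
have gy := le_trans (Lpnorm_grad_le_W1norm Om y s0) yW.
have [Wy _ _] := yS; have [_ gmy] := W1_measurable Wy.
have ys : VL s (sgrad y).
  apply: (LvP mu mOm (sgrad y) s1).2; split; first exact: gmy.
  split; [exact: (measurable_enorm gmy)|exact: le_lt_trans gy (ltry _)].
by split; [exact: ys|rewrite -lee_fin -(VNK oOm s1 ys)].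
Qed.

End state.

(** * Derivatives of the control-to-state map *)

(** Since [q (s - 2) - 2 s < q (s - 2)], the second summand exceeds [2 s / (s - 2)]. The number
    [4 s / (s - 2)] is the limit of the threshold as q tends to infinity. *)
Lemma critical_exponent_lt (R : realType) (s q qt : R) : 2 < s ->
  2 * s / (s - 2) < q ->
  2 * s / (s - 2) + 2 * s * q / (q * (s - 2) - 2 * s) < qt ->
  4 * s / (s - 2) < qt.
Proof.
move=> s2 hq; apply: le_lt_trans.
have d0 : 0 < s - 2 by rewrite subr_gt0.
have D0 : 0 < q * (s - 2) - 2 * s by rewrite subr_gt0 -ltr_pdivrMr.
have dN : s - 2 != 0 by rewrite gt_eqF.
have -> : 4 * s / (s - 2) = 2 * s / (s - 2) + 2 * s / (s - 2) by field.
rewrite lerD2l ler_pdivrMr// mulrAC ler_pdivlMr// -!mulrA.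
by rewrite ler_pM2l// ler_wpM2l//; nra.
Qed.

(** The origin of [4 s / (s - 2)]: it is the exponent for which two factors in this space and a
    gradient in L^s have their product exactly in L^2. *)
Lemma critical_exponent (R : realType) (s : R) : 2 < s ->
  0 < 4 * s / (s - 2) /\
  (4 * s / (s - 2))^-1 + ((4 * s / (s - 2))^-1 + s^-1) = 2^-1.
Proof.
move=> s2; have d0 : 0 < s - 2 by rewrite subr_gt0.
have s0 : 0 < s by lra.
split; first by rewrite divr_gt0// mulr_gt0.
have dN : s - 2 != 0 by rewrite gt_eqF.
have sN : s != 0 by rewrite gt_eqF.
by field; rewrite dN sN.
Qed.

(* With 1/qt < 1/4 - 1/(2s) the bound below leaves room for 1/m > 0. *)
Lemma room_exponent (R : realType) (s qt : R) : 2 < s -> 4 * s / (s - 2) < qt ->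
  exists m, [/\ 0 < m, qt <= m & 2 * qt^-1 + m^-1 + s^-1 <= 2^-1].
Proof.
move=> s2 hqt; have [qh0 qhE] := critical_exponent s2.
have qt0 := lt_trans qh0 hqt.
have qti : 0 < qt^-1 by rewrite invr_gt0.
have lt_inv : qt^-1 < (4 * s / (s - 2))^-1 by rewrite ltf_pV2.
set b := (_ / _)^-1 in qhE lt_inv.
have e0 : 0 < 2^-1 - s^-1 - 2 * qt^-1 by lra.
(* All the room left is given to [1 / m], unless it exceeds [1 / qt]; then [m = qt] is taken to
   respect [qt <= m]. *)
have [le|lt] := leP qt^-1 (2^-1 - s^-1 - 2 * qt^-1).
  by exists qt; split=> //; lra.
exists (2^-1 - s^-1 - 2 * qt^-1)^-1; split; first by rewrite invr_gt0.
  by rewrite -[leLHS]invrK lef_pV2 ?posrE// ltW.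
by rewrite invrK; lra.
Qed.

Lemma lee_edivr_fin (R : realType) (x : \bar R) (c t : R) : 0 < t ->
  (x <= (c * t)%:E)%E -> (x / t%:E <= c%:E)%E.
Proof.
by move=> t0; rewrite inver gt_eqF// lee_pdivrMr// -EFinM.
Qed.

Lemma edivr_ge0 (R : realType) (x : \bar R) (t : R) : 0 < t ->
  (0 <= x)%E -> (0 <= x / t%:E)%E.
Proof.
by move=> t0 x0; rewrite inver gt_eqF// mule_ge0// lee_fin invr_ge0 ltW.
Qed.

Lemma op_norm_le (R : realType) (X Y : seminormed R) (L : X -> Y) (C : R) :
  0 <= C -> (forall x, sn_dom x -> (sn_norm (L x) <= C%:E * sn_norm x)%E) ->
  (op_norm L <= C%:E)%E.
Proof.
move=> C0 HL; apply: ge_ereal_sup => _ [x [xX x1] <-].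
apply: le_trans (HL _ xX) _.
by rewrite -[leRHS]mule1 lee_wpmul2l ?lee_fin.
Qed.

(** [seminormed] carries no axioms and the supremum of an empty set is -oo, hence the witness [x] in
    the unit ball. *)
Lemma op_norm_ge0 (R : realType) (X Y : seminormed R) (L : X -> Y) (x : X) :
  sn_dom x -> (sn_norm x <= 1)%E -> (0 <= sn_norm (L x))%E -> (0 <= op_norm L)%E.
Proof.
by move=> xX x1 Lx; apply: le_trans Lx _; apply: ereal_sup_ubound; exists x.
Qed.

#[global] Instance feasible_to0_filter (R : realType) (X : seminormed R)
  (U : set X) (u : X) : Filter (feasible_to0 U u).
Proof.
apply: filter_from_filter; first by exists 1 => /=.
move=> d e /= d0 e0; exists (Num.min d e); first by rewrite /= lt_min d0.
by move=> x [Ux [x0]]; rewrite EFin_min lt_min => /andP[xd xe].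
Qed.

(** A power rate is enough: below the threshold [(e / (K + 1)) ^ (1 / theta)] the bound is less than
    [e], the added 1 covering [K = 0]. *)
Lemma feasible_cvg0 (R : realType) (X : seminormed R) (U : set X) (u : X)
    (g : X -> \bar R) (K theta : R) : 0 <= K -> 0 < theta ->
  (forall phi t, U (u + phi) -> 0 < t -> sn_norm phi = t%:E ->
     (0 <= g phi <= (K * t `^ theta)%:E)%E) ->
  g @ feasible_to0 U u --> 0%E.
Proof.
move=> K0 th0 Hg.
have Hg' phi (d : R) : U (u + phi) -> (0 < sn_norm phi)%E -> (sn_norm phi < d%:E)%E ->
    exists2 t, 0 < t < d & (0 <= g phi <= (K * t `^ theta)%:E)%E.
  case E : (sn_norm phi) => [t| |] // Up; rewrite !lte_fin => t0 td.
  by exists t; [rewrite t0|exact: Hg].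
apply/cvge0P.
  by exists 1 => //= phi [Up [p0 p1]]; have [t _ /andP[]] := Hg' _ _ Up p0 p1.
move=> e e0; have eK : 0 < e / (K + 1) by rewrite divr_gt0// ltr_wpDl.
exists ((e / (K + 1)) `^ theta^-1); first exact: powR_gt0.
move=> phi /= [Up [p0 pd]]; have [t /andP[t0 td] /andP[_ gt]] := Hg' _ _ Up p0 pd.
apply: le_lt_trans gt _; rewrite lte_fin.
have : t `^ theta < e / (K + 1).
  have thN : theta != 0 by rewrite gt_eqF.
  have -> : e / (K + 1) = ((e / (K + 1)) `^ theta^-1) `^ theta.
    by rewrite -powRrM mulVf// powRr1// ltW.
  by apply: gt0_ltr_powR; [exact: th0|exact: ltW|exact: powR_ge0|exact: td].
rewrite ltr_pdivlMr ?ltr_wpDl// => /(le_lt_trans _); apply.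
by rewrite mulrC ler_wpM2l ?powR_ge0// lerDl.
Qed.

Lemma dist_le_upper (R : realType) (l r a b : R) : 0 < l ->
  l <= a <= r -> l <= b <= r -> `|b - a| <= r.
Proof.
move=> l0 /andP[a1 a2] /andP[b1 b2]; rewrite ler_norml; apply/andP.
by split; lra.
Qed.

(** * Feasible increments *)

Section feasible_increments.
Context (R : realType) (n : nat) (Om : set 'rV[R]_n.+1) (ul uu : R).
Hypotheses (oOm : open Om) (bOm : bounded_set Om) (ul0 : 0 < ul) (ulu : ul <= uu).
Local Notation mu := (leb R n).
Local Notation SN := (SN Om).
Implicit Types (u phi : 'rV[R]_n.+1 -> R).

Let mOm := domain_measurable oOm.
Let finOm := domain_finite bOm.

Let incrementE u phi x : phi x = (u + phi) x - u x.
Proof. by rewrite -[(u + phi) x]/(u x + phi x) addrC addKr. Qed.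

Lemma increment_measurable u phi : Uad Om ul uu u -> Uad Om ul uu (u + phi) ->
  measurable_fun (Om : set (lebT R n)) (phi : lebT R n -> R).
Proof.
move=> /Uad_measurable mu1 /Uad_measurable mu2.
rewrite (_ : phi = (fun x => (u + phi) x - u x)).
  exact: measurable_funB mu2 mu1.
by apply/funext => x; exact: incrementE.
Qed.

Lemma increment_bounded u phi : Uad Om ul uu u -> Uad Om ul uu (u + phi) ->
  {ae mu, forall x, Om x -> `|phi x| <= uu}.
Proof.
move=> [_ u1] [_ u2]; move: u1 u2; apply: filterS2 => x u1 u2 Ox.
rewrite (incrementE u phi x).
exact: (dist_le_upper ul0 (u1 Ox) (u2 Ox)).
Qed.

(** [feasible_to0] does not place [phi] in L^p. Measurability and the bound by [uu] come from
    writing [phi] as a difference of two admissible controls; boundedness then gives the higher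
    exponent [q]. *)
Lemma increment_interpolation p q t u phi : 0 < p -> p <= q ->
  Uad Om ul uu u -> Uad Om ul uu (u + phi) -> Lpnorm mu Om p phi = t%:E ->
  [/\ Lp mu Om p phi, Lp mu Om q phi &
      SN q phi <= uu `^ (1 - p / q) * t `^ (p / q)].
Proof.
move=> p0 pq uU uphiU pt; have mphi := increment_measurable uU uphiU.
have uu0 : 0 <= uu by exact: le_trans (ltW ul0) ulu.
have := Lpnorm_interpolation mOm p0 pq uu0 mphi (increment_bounded uU uphiU).
rewrite pt poweR_EFin -EFinM => H.
have qphi : Lp mu Om q phi by split; [exact: mphi|exact: le_lt_trans H (ltry _)].
split; [split; [exact: mphi|rewrite pt; exact: ltry]|exact: qphi|].
by rewrite -lee_fin fineK//; exact: Lpnorm_fin_num qphi.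
Qed.

End feasible_increments.

(** * First derivatives: equations and estimates *)

Section derivatives.
Context (R : realType) (n : nat) (Om Gt : set 'rV[R]_n.+2) (ul uu s : R).
Hypotheses (oOm : open Om) (bOm : bounded_set Om) (cGt : closed Gt).
Hypotheses (ul0 : 0 < ul) (ulu : ul <= uu).
Hypothesis reg : regularity_exponent Om Gt ul uu s.
Variables (f : sob R n.+1 -> R) (fD : 'rV[R]_n.+2 -> R) (ft : sob R n.+1).
Hypotheses (fW : Wdual Om Gt s f) (fDW : Wtrace Gt s fD)
  (ftL : is_lift Om Gt s fD ft).
Local Notation mu := (leb R n.+1).
Local Notation vec := ('rV[R]_n.+2 -> 'rV[R]_n.+2).
Local Notation V := (W1D Om Gt 2).
Local Notation VL := (VL Om).
Local Notation VN := (VN Om).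
Local Notation SN := (SN Om).
Local Notation pairing := (pairing Om).
Local Notation solves := (solves Om Gt).
Local Notation st := (state Om Gt ft f).
Local Notation dst := (dstate Om Gt ft f).
Local Notation d2st := (d2state Om Gt ft f).
Implicit Types (u c phi psi : 'rV[R]_n.+2 -> R) (h k : vec) (v w z : sob R n.+1).

Let l12 : (1 : R) <= 2. Proof. by rewrite ler1n. Qed.
Let s2 : 2 <= s. Proof. by apply: ltW; case: reg. Qed.
Let s0 : 0 < s. Proof. exact: lt_le_trans s2. Qed.
Let s1 : 1 <= s. Proof. exact: le_trans s2. Qed.
Let mOm := domain_measurable oOm.
Let finOm := domain_finite bOm.
Let stP u : Uad Om ul uu u -> is_state Om Gt ft f u (st u).
Proof. exact: (stateP oOm bOm cGt ul0 ulu reg fW ftL). Qed.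

Lemma exponent_bounds (x : R) : s^-1 <= x -> x <= 2^-1 ->
  [/\ 2 <= x^-1 <= s, 1 <= x^-1 & 0 < x^-1].
Proof.
move=> sx x2; have x0 : 0 < x by rewrite (lt_le_trans _ sx)// invr_gt0.
have xi2 : 2 <= x^-1 by rewrite -[leLHS]invrK lef_pV2 ?posrE ?invr_gt0.
split; [|exact: le_trans xi2|by rewrite invr_gt0].
by rewrite xi2 -[leRHS]invrK lef_pV2 ?posrE ?invr_gt0.
Qed.

Lemma exponent_ge1 (m : R) : 0 < m -> m^-1 + s^-1 <= 2^-1 -> 1 <= m.
Proof.
move=> m0 ms; have si : 0 < s^-1 by rewrite invr_gt0.
by rewrite -invf_le1//; lra.
Qed.

Lemma VLM2 (m t : R) c h : 0 < m -> 1 <= t -> m^-1 + t^-1 <= 2^-1 ->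
  Lp mu Om m c -> VL t h -> VL 2 (fun x => c x *: h x).
Proof.
move=> m0 t1 mt cm ht; have t0 := lt_le_trans ltr01 t1.
have r0 : 0 < (m^-1 + t^-1)^-1 by rewrite invr_gt0 addr_gt0// invr_gt0.
have r2 : 2 <= (m^-1 + t^-1)^-1.
  by rewrite -[leLHS]invrK lef_pV2 ?posrE ?addr_gt0 ?invr_gt0.
apply: (VL_subset oOm bOm l12 r2).
by apply: (VLM oOm _ m0 t1 _ cm ht); rewrite ?invrK// (le_trans l12).
Qed.

(** Hölder puts the product into L^r with 1/r = 1/m + 1/t and r >= 2; [A] is the constant of the
    inclusion of L^r in L^2 and is the same for all factors. *)
Lemma VNM2 (m t : R) : 0 < m -> 1 <= t -> m^-1 + t^-1 <= 2^-1 ->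
  exists2 A, 0 <= A & forall c h, Lp mu Om m c -> VL t h ->
    VN 2 (fun x => c x *: h x) <= A * (SN m c * VN t h).
Proof.
move=> m0 t1 mt; have t0 := lt_le_trans ltr01 t1.
have r2 : 2 <= (m^-1 + t^-1)^-1.
  by rewrite -[leLHS]invrK lef_pV2 ?posrE ?addr_gt0 ?invr_gt0.
have r1 := le_trans l12 r2.
exists (fine (mu Om) `^ (2^-1 - (m^-1 + t^-1)^-1^-1)); first exact: powR_ge0.
move=> c h cm ht.
have e : m^-1 + t^-1 = (m^-1 + t^-1)^-1^-1 by rewrite invrK.
apply: le_trans (VN_subset oOm bOm l12 r2 (VLM oOm r1 m0 t1 e cm ht)) _.
rewrite mulrC ler_wpM2l ?powR_ge0//.
exact: (VNM oOm r1 m0 t1 e cm ht).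
Qed.

Lemma is_dstate_solves u phi (y : sob R n.+1) z : Uad Om ul uu u ->
  VL 2 (fun x => phi x *: sgrad y x) ->
  is_dstate Om Gt u y phi z <-> solves u (fun x => phi x *: sgrad y x) z.
Proof.
move=> uU py2; split=> [[Vz Hz]|[Vz Hz]]; split; [exact: Vz| |exact: Vz|] => v Vv;
  have uz2 := flux_VL oOm ul0 ulu uU Vz; have v2 := W1D_VL Vv.
  by have := Hz _ Vv; rewrite (dformE oOm uz2 v2) (dformE oOm py2 v2) => -[].
by rewrite (dformE oOm uz2 v2) (dformE oOm py2 v2) Hz.
Qed.

Lemma is_d2state_solves u phi psi (zphi zpsi : sob R n.+1) z : Uad Om ul uu u ->
  VL 2 (fun x => psi x *: sgrad zphi x) ->
  VL 2 (fun x => phi x *: sgrad zpsi x) ->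
  is_d2state Om Gt u zphi zpsi phi psi z <->
  solves u (fun x => psi x *: sgrad zphi x + phi x *: sgrad zpsi x) z.
Proof.
move=> uU p1 p2; split=> [[Vz Hz]|[Vz Hz]]; split; [exact: Vz| |exact: Vz|] => v Vv;
  have uz2 := flux_VL oOm ul0 ulu uU Vz; have v2 := W1D_VL Vv.
  have := Hz _ Vv; rewrite (dformE oOm uz2 v2) (dformE oOm p1 v2) (dformE oOm p2 v2).
  by rewrite (pairing2D oOm p1 p2 v2) opprD => -[].
rewrite (dformE oOm uz2 v2) (dformE oOm p1 v2) (dformE oOm p2 v2) Hz//.
by rewrite (pairing2D oOm p1 p2 v2) opprD EFinB.
Qed.

Lemma solves_unique u h z w : Uad Om ul uu u -> VL 2 h ->
  solves u h z -> solves u h w -> W1norm Om 2 (z - w) = 0%E.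
Proof.
move=> uU h2 sz sw; have ss : (2 : R) <= 2 <= s by rewrite lexx s2.
have [C C0 HC] := solves_estimate oOm bOm ul0 ulu reg ss.
have := solves_linear oOm bOm cGt ul0 ulu (-1) uU h2 h2 sw sz.
have -> : (fun x => -1 *: h x + h x) = fun=> 0.
  by apply/funext => x; rewrite scaleN1r addNr.
rewrite scaleN1r addrC => /(HC _ _ _ uU (VL0 Om l12)).
by rewrite (VN0 Om l12) mulr0 => zw; apply/eqP; rewrite eq_le zw W1norm_ge0.
Qed.

(** Solutions for different coefficients cannot be subtracted directly; the change of coefficient is
    moved into the data, exactly and without linearisation. *)
Lemma solves_change_coefficient u phi h z : Uad Om ul uu u ->
  Uad Om ul uu (u + phi) -> VL 2 h -> VL 2 (fun x => phi x *: sgrad z x) ->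
  solves (u + phi) h z -> solves u (fun x => h x + phi x *: sgrad z x) z.
Proof.
move=> uU uphiU h2 pz2 [Vz Hz]; split; first exact: Vz.
move=> v Vv; have v2 := W1D_VL Vv; have uz2 := flux_VL oOm ul0 ulu uU Vz.
rewrite (pairing2D oOm h2 pz2 v2) opprD -(Hz _ Vv).
have -> : (fun x => (u + phi) x *: sgrad z x) =
          (fun x => u x *: sgrad z x + phi x *: sgrad z x).
  by apply/funext => x; rewrite -scalerDl.
by rewrite (pairing2D oOm uz2 pz2 v2) addrK.
Qed.

(** Source and lift cancel. With the new state on the right, the equation for the increment at the
    old coefficient is exact. *)
Lemma state_increment u phi : Uad Om ul uu u -> Uad Om ul uu (u + phi) ->
  VL 2 (fun x => phi x *: sgrad (st (u + phi)) x) ->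
  solves u (fun x => phi x *: sgrad (st (u + phi)) x) (st (u + phi) - st u).
Proof.
move=> uU uphiU py2.
have [Wy' Vy' Hy'] := stP uphiU; have [Wy Vy Hy] := stP uU.
set y' := st (u + phi) in py2 Wy' Vy' Hy' *; set y := st u in Wy Vy Hy *.
have y'2 := W1_Lv Wy'; have y2 := W1_Lv Wy.
have [uy'2 _] := VL_Uad oOm ul0 ulu l12 uU y'2.
have [uy2 _] := VL_Uad oOm ul0 ulu l12 uU y2.
have [u'y'2 _] := VL_Uad oOm ul0 ulu l12 uphiU y'2.
split.
  rewrite (_ : y' - y = (y' - ft) - (y - ft)); last by rewrite opprB addrA subrK.
  exact: (W1DB oOm bOm cGt l12 Vy' Vy).
move=> v Vv; have v2 := W1D_VL Vv.
have E : (fun x => u x *: sgrad (y' - y) x) =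
    (fun x => -1 *: (u x *: sgrad y x) + u x *: sgrad y' x).
  by apply/funext => x; rewrite scaleN1r [RHS]addrC -scalerBr.
rewrite E (pairing2P oOm _ uy2 uy'2 v2).
have := Hy _ Vv; rewrite (dformE oOm uy2 v2) => -[->].
have := Hy' _ Vv; rewrite (dformE oOm u'y'2 v2) => -[<-].
have -> : (fun x => (u + phi) x *: sgrad y' x) =
          (fun x => u x *: sgrad y' x + phi x *: sgrad y' x).
  by apply/funext => x; rewrite -scalerDl.
by rewrite (pairing2D oOm uy'2 py2 v2); ring.
Qed.

Lemma dstate_solves u phi (m : R) : Uad Om ul uu u -> 0 < m ->
  m^-1 + s^-1 <= 2^-1 -> Lp mu Om m phi ->
  VL 2 (fun x => phi x *: sgrad (st u) x) /\
  solves u (fun x => phi x *: sgrad (st u) x) (dst u phi).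
Proof.
move=> uU m0 ms pm.
have [K K0 HK] := state_bound oOm bOm cGt ul0 ulu reg fW fDW ftL.
have [ys _] := HK _ uU; have py2 := VLM2 m0 s1 ms pm ys; split; first exact: py2.
have [z sz] := solves_exists oOm bOm cGt ul0 ulu reg uU py2.
apply/(is_dstate_solves _ uU py2); apply: xgetPex; exists z.
exact/(is_dstate_solves _ uU py2).
Qed.

(** The first bound is continuity of S'(u). The other two record the integrability of the gradient,
    which is spent when it is multiplied by a second direction. *)
Lemma dstate_estimate (m : R) : 0 < m -> m^-1 + s^-1 <= 2^-1 ->
  exists2 C, 0 <= C & forall u phi, Uad Om ul uu u -> Lp mu Om m phi ->
    [/\ (W1norm Om 2 (dst u phi) <= (C * SN m phi)%:E)%E,
        VL (m^-1 + s^-1)^-1 (sgrad (dst u phi)) &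
        VN (m^-1 + s^-1)^-1 (sgrad (dst u phi)) <= C * SN m phi].
Proof.
move=> m0 ms; have sx : s^-1 <= m^-1 + s^-1 by rewrite lerDr invr_ge0 ltW.
have [r2s r1 r0] := exponent_bounds sx ms.
have ss : (2 : R) <= 2 <= s by rewrite lexx s2.
have [C0 C00 HC0] := solves_estimate oOm bOm ul0 ulu reg ss.
have [C1 C10 HC1] := solves_estimate_grad oOm bOm ul0 ulu reg r2s.
have [A A0 HA] := VNM2 m0 s1 ms.
have [K K0 HK] := state_bound oOm bOm cGt ul0 ulu reg fW fDW ftL.
exists (C0 * A * K + C1 * K); first by rewrite addr_ge0 ?mulr_ge0.
move=> u phi uU pm; have [ys yK] := HK _ uU.
have [py2 sz] := dstate_solves uU m0 ms pm.
have e : m^-1 + s^-1 = (m^-1 + s^-1)^-1^-1 by rewrite invrK.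
have pyr := VLM oOm r1 m0 s1 e pm ys.
have [_ zr zn] := HC1 _ _ _ uU pyr sz.
have S0 := SN_ge0 Om m phi.
split; [|exact: zr|].
- apply: le_trans (HC0 _ _ _ uU py2 sz) _; rewrite lee_fin mulrDl.
  apply: (@le_trans _ _ (C0 * A * K * SN m phi)); last first.
    by rewrite lerDl !mulr_ge0.
  rewrite -!mulrA ler_wpM2l//; apply: le_trans (HA _ _ pm ys) _.
  by rewrite ler_wpM2l// mulrC ler_wpM2r.
- apply: le_trans zn _; rewrite mulrDl.
  apply: (@le_trans _ _ (C1 * K * SN m phi)); last by rewrite lerDr !mulr_ge0.
  rewrite -mulrA ler_wpM2l//; apply: le_trans (VNM oOm r1 m0 s1 e pm ys) _.
  by rewrite mulrC ler_wpM2r.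
Qed.

(** Representatives are chosen separately for each direction, so that linearity can fail on a null
    set; the defect solves the equation with data 0. *)
Lemma dstate_linear (m : R) u (a : R) phi1 phi2 : 0 < m -> m^-1 + s^-1 <= 2^-1 ->
  Uad Om ul uu u -> Lp mu Om m phi1 -> Lp mu Om m phi2 ->
  let z := dst u (a *: phi1 + phi2) - (a *: dst u phi1 + dst u phi2) in
  [/\ W1norm Om 2 z = 0%E, VL (m^-1 + s^-1)^-1 (sgrad z) &
      VN (m^-1 + s^-1)^-1 (sgrad z) = 0].
Proof.
move=> m0 ms uU p1m p2m z.
have sx : s^-1 <= m^-1 + s^-1 by rewrite lerDr invr_ge0 ltW.
have [r2s r1 r0] := exponent_bounds sx ms; have /andP[r2 rs] := r2s.
have m1 := exponent_ge1 m0 ms.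
have p12m : Lp mu Om m (a *: phi1 + phi2).
  exact: (LpD mOm m1 (LpZ mOm a m0 p1m) p2m).
have [py1 s1z] := dstate_solves uU m0 ms p1m.
have [py2 s2z] := dstate_solves uU m0 ms p2m.
have [py12 s12z] := dstate_solves uU m0 ms p12m.
have sl := solves_linear oOm bOm cGt ul0 ulu a uU py1 py2 s1z s2z.
have E : (fun x => a *: (phi1 x *: sgrad (st u) x) + phi2 x *: sgrad (st u) x) =
    (fun x => (a *: phi1 + phi2) x *: sgrad (st u) x).
  by apply/funext => x; rewrite scalerA -scalerDl.
rewrite E in sl.
have sz : solves u (fun=> 0) z.
  have -> : z = -1 *: (a *: dst u phi1 + dst u phi2) + dst u (a *: phi1 + phi2).
    by rewrite scaleN1r addrC.
  have -> : (fun=> 0) = (fun x => -1 *: ((a *: phi1 + phi2) x *: sgrad (st u) x) +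
      (a *: phi1 + phi2) x *: sgrad (st u) x) :> vec.
    by apply/funext => x; rewrite scaleN1r addNr.
  exact: (solves_linear oOm bOm cGt ul0 ulu (-1) uU py12 py12 sl s12z).
have [C C0 HC] := solves_estimate_grad oOm bOm ul0 ulu reg r2s.
have [_ zr zn] := HC _ _ _ uU (VL0 Om r1) sz.
split; [exact: (solves_unique uU py12 s12z sl)|exact: zr|].
by apply/eqP; rewrite eq_le VN_ge0 andbT (le_trans zn)// (VN0 Om r1) mulr0.
Qed.

(** * Second derivative *)

Section second_derivative.
Variable m : R.
Hypotheses (m0 : 0 < m) (ms : m^-1 + (m^-1 + s^-1) <= 2^-1).

Let ms1 : m^-1 + s^-1 <= 2^-1.
Proof. by apply: le_trans ms; rewrite lerDr invr_ge0 ltW. Qed.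

Let r := (m^-1 + s^-1)^-1.

Let r_bounds : [/\ 2 <= r <= s, 1 <= r & 0 < r].
Proof. by apply: exponent_bounds ms1; rewrite lerDr invr_ge0 ltW. Qed.

Let ms2 : m^-1 + r^-1 <= 2^-1. Proof. by rewrite /r invrK. Qed.

Lemma d2state_VL u phi psi : Uad Om ul uu u ->
  Lp mu Om m phi -> Lp mu Om m psi ->
  VL 2 (fun x => psi x *: sgrad (dst u phi) x).
Proof.
move=> uU pm qm; have [C C0 HC] := dstate_estimate m0 ms1.
have [_ zr _] := HC _ _ uU pm; have [_ r1 _] := r_bounds.
exact: (VLM2 m0 r1 ms2 qm zr).
Qed.

Lemma d2state_solves u phi psi : Uad Om ul uu u ->
  Lp mu Om m phi -> Lp mu Om m psi ->
  is_d2state Om Gt u (dst u phi) (dst u psi) phi psi (d2st u phi psi) /\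
  solves u (fun x => psi x *: sgrad (dst u phi) x + phi x *: sgrad (dst u psi) x)
    (d2st u phi psi).
Proof.
move=> uU pm qm; have h1 := d2state_VL uU pm qm; have h2 := d2state_VL uU qm pm.
have [z sz] := solves_exists oOm bOm cGt ul0 ulu reg uU (VLD oOm l12 h1 h2).
have dz : is_d2state Om Gt u (dst u phi) (dst u psi) phi psi (d2st u phi psi).
  apply: xgetPex; exists z; exact/(is_d2state_solves _ uU h1 h2).
by split; [exact: dz|exact/(is_d2state_solves _ uU h1 h2)].
Qed.

Lemma d2state_unique u phi psi z : Uad Om ul uu u ->
  Lp mu Om m phi -> Lp mu Om m psi ->
  is_d2state Om Gt u (dst u phi) (dst u psi) phi psi z ->
  W1norm Om 2 (z - d2st u phi psi) = 0%E.
Proof.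
move=> uU pm qm dz; have h1 := d2state_VL uU pm qm; have h2 := d2state_VL uU qm pm.
have [_ sd] := d2state_solves uU pm qm.
have sz := (is_d2state_solves z uU h1 h2).1 dz.
exact: (solves_unique uU (VLD oOm l12 h1 h2) sz sd).
Qed.

Lemma d2state_estimate : exists2 C, 0 < C & forall u phi psi, Uad Om ul uu u ->
  Lp mu Om m phi -> Lp mu Om m psi ->
  (W1norm Om 2 (d2st u phi psi) <= (C * SN m phi * SN m psi)%:E)%E.
Proof.
have ss : (2 : R) <= 2 <= s by rewrite lexx s2.
have [C0 C00 HC0] := solves_estimate oOm bOm ul0 ulu reg ss.
have [C1 C10 HC1] := dstate_estimate m0 ms1.
have [_ r1 _] := r_bounds.
have [A A0 HA] := VNM2 m0 r1 ms2.
(* The two data terms have the same bound, whence the factor 2; the added 1 makes the constant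
   positive. *)
exists (C0 * A * C1 * 2 + 1); first by rewrite ltr_wpDl// !mulr_ge0.
move=> u phi psi uU pm qm.
have h1 := d2state_VL uU pm qm; have h2 := d2state_VL uU qm pm.
have [_ sd] := d2state_solves uU pm qm.
have [_ zr zn] := HC1 _ _ uU pm; have [_ wr wn] := HC1 _ _ uU qm.
apply: le_trans (HC0 _ _ _ uU (VLD oOm l12 h1 h2) sd) _; rewrite lee_fin.
have P0 := SN_ge0 Om m phi; have Q0 := SN_ge0 Om m psi.
apply: (@le_trans _ _ (C0 * A * C1 * 2 * SN m phi * SN m psi)); last first.
  by rewrite ler_wpM2r// ler_wpM2r// lerDl.
have -> : C0 * A * C1 * 2 * SN m phi * SN m psi =
  C0 * (A * (SN m psi * (C1 * SN m phi)) + A * (SN m phi * (C1 * SN m psi))) by ring.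
rewrite ler_wpM2l//; apply: le_trans (VND oOm l12 h1 h2) _; apply: lerD.
  apply: le_trans (HA _ _ qm zr) _.
  by rewrite ler_wpM2l// ler_wpM2l.
apply: le_trans (HA _ _ pm wr) _.
by rewrite ler_wpM2l// ler_wpM2l.
Qed.

(** Exchanging the directions exchanges the two data terms, so the sets of solutions coincide and
    [xget] picks the same element: an equality, not only one up to null sets. It transfers linearity
    from one argument to the other. *)
Lemma d2stateC u phi psi : d2st u phi psi = d2st u psi phi.
Proof.
have sym a b : [set z | is_d2state Om Gt u (dst u a) (dst u b) a b z] `<=`
    [set z | is_d2state Om Gt u (dst u b) (dst u a) b a z].
  by move=> z [Vz Hz]; exact: (conj Vz (fun v Vv => etrans (Hz v Vv) (addeC _ _))).
apply: (f_equal (fun A => xget 0 A)).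
by apply/seteqP; exact: (conj (sym phi psi) (sym psi phi)).
Qed.

(** The data depend on [phi1] and [phi2] also through their derivatives, which are linear only up to
    a defect. The defect of the second derivatives solves the equation with data [psi] times the
    gradient of that defect, whose norm is 0. *)
Lemma d2state_linear u (a : R) phi1 phi2 psi : Uad Om ul uu u ->
  Lp mu Om m phi1 -> Lp mu Om m phi2 -> Lp mu Om m psi ->
  W1norm Om 2 (d2st u (a *: phi1 + phi2) psi -
               (a *: d2st u phi1 psi + d2st u phi2 psi)) = 0%E.
Proof.
move=> uU p1m p2m qm; have [_ r1 _] := r_bounds.
have m1 := exponent_ge1 m0 ms1.
have p12m : Lp mu Om m (a *: phi1 + phi2).
  exact: (LpD mOm m1 (LpZ mOm a m0 p1m) p2m).
have [_ zr zn] := dstate_linear a m0 ms1 uU p1m p2m.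
set z := (X in sgrad X) in zr zn.
have [_ s1z] := d2state_solves uU p1m qm; have [_ s2z] := d2state_solves uU p2m qm.
have [_ s12z] := d2state_solves uU p12m qm.
have h1 := VLD oOm l12 (d2state_VL uU p1m qm) (d2state_VL uU qm p1m).
have h2 := VLD oOm l12 (d2state_VL uU p2m qm) (d2state_VL uU qm p2m).
have h12 := VLD oOm l12 (d2state_VL uU p12m qm) (d2state_VL uU qm p12m).
have sl := solves_linear oOm bOm cGt ul0 ulu a uU h1 h2 s1z s2z.
have hl := VL_linear oOm a l12 h1 h2.
have := solves_linear oOm bOm cGt ul0 ulu (-1) uU hl h12 sl s12z.
(* The terms with the gradient of [dst u psi] cancel exactly. *)
have id4 (p q1 q2 : R) (X12 X1 X2 W : 'rV[R]_n.+2) :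
    -1 *: (a *: (p *: X1 + q1 *: W) + (p *: X2 + q2 *: W)) +
    (p *: X12 + (a * q1 + q2) *: W) = p *: (X12 - (a *: X1 + X2)).
  by apply/rowP => i; rewrite !mxE; ring.
have -> : -1 *: (a *: d2st u phi1 psi + d2st u phi2 psi) +
    d2st u (a *: phi1 + phi2) psi = d2st u (a *: phi1 + phi2) psi -
    (a *: d2st u phi1 psi + d2st u phi2 psi) by rewrite scaleN1r addrC.
rewrite (_ : (fun x => -1 *: _ + _) = (fun x => psi x *: sgrad z x)); last first.
  by apply/funext => x; exact: id4.
move=> sz; have ss : (2 : R) <= 2 <= s by rewrite lexx s2.
have [C C0 HC] := solves_estimate oOm bOm ul0 ulu reg ss.
have [A A0 HA] := VNM2 m0 r1 ms2.
have := HC _ _ _ uU (VLM2 m0 r1 ms2 qm zr) sz.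
move=> Wz; apply/eqP; rewrite eq_le W1norm_ge0 andbT; apply: le_trans Wz _.
rewrite lee_fin mulr_ge0_le0//; apply: le_trans (HA _ _ qm zr) _.
by rewrite zn !mulr0.
Qed.

End second_derivative.

(* With y' = S(u + phi), y = S(u), z' = S'(u + phi)[psi], z = S'(u)[psi], the
   remainder solves the equation at u with data
   psi grad (y' - y - z_{u,phi}) + phi grad (z' - z). One factor phi is measured
   in L^m, the other one and psi in L^qt. *)
Lemma dstate_remainder_estimate u (qt m : R) : Uad Om ul uu u ->
  0 < qt -> 0 < m -> 2 * qt^-1 + m^-1 + s^-1 <= 2^-1 ->
  exists2 K, 0 <= K & forall phi psi, Uad Om ul uu (u + phi) ->
    Lp mu Om qt phi -> Lp mu Om m phi -> Lp mu Om qt psi ->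
    (W1norm Om 2 (dst (u + phi) psi - dst u psi - d2st u phi psi)%R <=
     (K * SN m phi * SN qt phi * SN qt psi)%:E)%E.
Proof.
move=> uU qt0 m0 qms.
have tau0 : 0 < qt^-1 by rewrite invr_gt0.
have theta0 : 0 < m^-1 by rewrite invr_gt0.
have sigma0 : 0 < s^-1 by rewrite invr_gt0.
have b1 : qt^-1 + s^-1 <= 2^-1 by lra.
have bb : m^-1 + s^-1 <= 2^-1 by lra.
have b2 : qt^-1 + m^-1 + s^-1 <= 2^-1 by lra.
have qq2 : qt^-1 + (qt^-1 + s^-1) <= 2^-1 by lra.
(* The three exponents of the argument: [r1] for grad z', [rb] for grad (y' - y), and [r2] for both
   grad (y' - y - z_{u,phi}) and grad (z' - z). *)
have [r1s r11 r10] : [/\ 2 <= (qt^-1 + s^-1)^-1 <= s, 1 <= (qt^-1 + s^-1)^-1 &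
    0 < (qt^-1 + s^-1)^-1] by apply: exponent_bounds; [lra|exact: b1].
have [rbs rb1 rb0] : [/\ 2 <= (m^-1 + s^-1)^-1 <= s, 1 <= (m^-1 + s^-1)^-1 &
    0 < (m^-1 + s^-1)^-1] by apply: exponent_bounds; [lra|exact: bb].
have [r2s r21 r20] : [/\ 2 <= (qt^-1 + m^-1 + s^-1)^-1 <= s,
    1 <= (qt^-1 + m^-1 + s^-1)^-1 & 0 < (qt^-1 + m^-1 + s^-1)^-1].
  by apply: exponent_bounds; [lra|exact: b2].
set r1 := (qt^-1 + s^-1)^-1 in r1s r11 r10.
set rb := (m^-1 + s^-1)^-1 in rbs rb1 rb0.
set r2 := (qt^-1 + m^-1 + s^-1)^-1 in r2s r21 r20.
have e_b : m^-1 + s^-1 = rb^-1 by rewrite invrK.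
have e_qb : qt^-1 + rb^-1 = r2^-1 by rewrite !invrK addrA.
have e_m1 : m^-1 + r1^-1 = r2^-1 by rewrite !invrK addrCA addrA.
have q2 : qt^-1 + r2^-1 <= 2^-1 by rewrite invrK; lra.
have m1r : m^-1 + r1^-1 <= 2^-1 by rewrite invrK; lra.
have ss : (2 : R) <= 2 <= s by rewrite lexx s2.
have [C0 C00 HC0] := solves_estimate oOm bOm ul0 ulu reg ss.
have [C1 C10 HC1] := dstate_estimate qt0 b1.
have [Cb Cb0 HCb] := solves_estimate_grad oOm bOm ul0 ulu reg rbs.
have [C2 C20 HC2] := solves_estimate_grad oOm bOm ul0 ulu reg r2s.
have [A A0 HA] := VNM2 qt0 r21 q2.
have [K K0 HK] := state_bound oOm bOm cGt ul0 ulu reg fW fDW ftL.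
(* [Cb * K] comes from y' - y, which occurs in both data terms, and [C1] from z'; [C2], [A] and [C0]
   are then spent on the passage to [r2], the last product and the final estimate. *)
pose G := C0 * A * C2 * (2 * (Cb * K) + C1).
have G0 : 0 <= G by rewrite /G !mulr_ge0// addr_ge0 ?mulr_ge0.
exists G; first exact: G0.
move=> phi psi uphiU pq pm qq.
have P0 := SN_ge0 Om qt phi; have Q0 := SN_ge0 Om qt psi; have M0 := SN_ge0 Om m phi.
set u' := u + phi in uphiU *.
have [y's y'K] := HK _ uphiU.
have [_ z'r z'n] := HC1 _ _ uphiU qq.
have [qy'2 sz'] := dstate_solves uphiU qt0 b1 qq.
have [qy2 sz] := dstate_solves uU qt0 b1 qq.
have [py2 szphi] := dstate_solves uU qt0 b1 pq.
set z' := dst u' psi in z'r z'n sz' *; set z := dst u psi in sz *.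
set zphi := dst u phi in szphi *.
set y' := st u' in y's y'K qy'2 sz' *; set y := st u in qy2 py2 sz szphi *.
have py'2 := VLM2 m0 s1 bb pm y's.
have sdy : solves u (fun x => phi x *: sgrad y' x) (y' - y).
  exact: state_increment.
have [_ dyr dyn] := HCb _ _ _ uU (VLM oOm rb1 m0 s1 e_b pm y's) sdy.
have {}dyn : VN rb (sgrad (y' - y)) <= Cb * K * SN m phi.
  apply: le_trans dyn _; rewrite -mulrA ler_wpM2l//.
  apply: le_trans (VNM oOm rb1 m0 s1 e_b pm y's) _.
  by rewrite mulrC ler_wpM2r.
have se : solves u (fun x => phi x *: sgrad (y' - y) x) (y' - y - zphi).
  have := solves_linear oOm bOm cGt ul0 ulu (-1) uU py2 py'2 szphi sdy.
  rewrite [in X in X -> _]scaleN1r [in X in X -> _]addrC.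
  rewrite (_ : (fun x => -1 *: (phi x *: sgrad y x) + phi x *: sgrad y' x) =
    (fun x => phi x *: sgrad (y' - y) x))//.
  by apply/funext => x; rewrite scaleN1r [LHS]addrC -scalerBr.
have [_ er en] := HC2 _ _ _ uU (VLM oOm r21 qt0 rb1 e_qb pq dyr) se.
have {}en : VN r2 (sgrad (y' - y - zphi)) <=
    C2 * (SN qt phi * (Cb * K * SN m phi)).
  apply: le_trans en _; rewrite ler_wpM2l//.
  apply: le_trans (VNM oOm r21 qt0 rb1 e_qb pq dyr) _.
  by rewrite ler_wpM2l.
have pz'2 := VLM2 m0 r11 m1r pm z'r.
have sz'u := solves_change_coefficient uU uphiU qy'2 pz'2 sz'.
have sdz : solves u (fun x => psi x *: sgrad (y' - y) x + phi x *: sgrad z' x)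
    (z' - z).
  have h2 := VLD oOm l12 qy'2 pz'2.
  have := solves_linear oOm bOm cGt ul0 ulu (-1) uU qy2 h2 sz sz'u.
  rewrite [in X in X -> _]scaleN1r [in X in X -> _]addrC.
  rewrite (_ : (fun x => -1 *: (psi x *: sgrad y x) +
      (psi x *: sgrad y' x + phi x *: sgrad z' x)) =
    (fun x => psi x *: sgrad (y' - y) x + phi x *: sgrad z' x))//.
  by apply/funext => x; rewrite addrA scaleN1r (addrC (- _)) -scalerBr.
(* In both products [phi] is measured in L^m, hidden in y' - y or as explicit factor, and [psi] in
   L^qt; so they lie in the same L^[r2]. *)
have qdyr := VLM oOm r21 qt0 rb1 e_qb qq dyr.
have pz'r := VLM oOm r21 m0 r11 e_m1 pm z'r.
have [_ dzr dzn] := HC2 _ _ _ uU (VLD oOm r21 qdyr pz'r) sdz.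
have {}dzn : VN r2 (sgrad (z' - z)) <=
    C2 * (SN qt psi * (Cb * K * SN m phi) + SN m phi * (C1 * SN qt psi)).
  apply: le_trans dzn _; rewrite ler_wpM2l//.
  apply: le_trans (VND oOm r21 qdyr pz'r) _; apply: lerD.
    apply: le_trans (VNM oOm r21 qt0 rb1 e_qb qq dyr) _.
    by rewrite ler_wpM2l.
  apply: le_trans (VNM oOm r21 m0 r11 e_m1 pm z'r) _.
  by rewrite ler_wpM2l.
have [_ sw] := d2state_solves qt0 qq2 uU pq qq.
have w1 := d2state_VL qt0 qq2 uU pq qq; have w2 := d2state_VL qt0 qq2 uU qq pq.
have qe2 := VLM2 qt0 r21 q2 qq er; have pdz2 := VLM2 qt0 r21 q2 pq dzr.
have sr : solves u (fun x => psi x *: sgrad (y' - y - zphi) x +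
    phi x *: sgrad (z' - z) x) (z' - z - d2st u phi psi).
  have dz2 : VL 2 (fun x => psi x *: sgrad (y' - y) x + phi x *: sgrad z' x).
    have /andP[r22 _] := r2s.
    exact: (VL_subset oOm bOm l12 r22 (VLD oOm r21 qdyr pz'r)).
  have -> : z' - z - d2st u phi psi = (-1) *: d2st u phi psi + (z' - z).
    by rewrite scaleN1r addrC.
  rewrite (_ : (fun x => _ + _) =
      (fun x => -1 *: (psi x *: sgrad zphi x + phi x *: sgrad z x) +
        (psi x *: sgrad (y' - y) x + phi x *: sgrad z' x))); last first.
    apply/funext => x; rewrite scaleN1r (addrC (- _)) opprD addrACA.
    by rewrite -!scalerBr.
  exact: (solves_linear oOm bOm cGt ul0 ulu (-1) uU (VLD oOm l12 w1 w2) dz2 sw sdz).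
apply: le_trans (HC0 _ _ _ uU (VLD oOm l12 qe2 pdz2) sr) _; rewrite lee_fin.
have -> : G * SN m phi * SN qt phi * SN qt psi = C0 *
  (A * (SN qt psi * (C2 * (SN qt phi * (Cb * K * SN m phi)))) +
   A * (SN qt phi * (C2 * (SN qt psi * (Cb * K * SN m phi) +
                           SN m phi * (C1 * SN qt psi))))) by rewrite /G; ring.
rewrite ler_wpM2l//; apply: le_trans (VND oOm l12 qe2 pdz2) _; apply: lerD.
  apply: le_trans (HA _ _ qq er) _.
  by rewrite ler_wpM2l// ler_wpM2l.
apply: le_trans (HA _ _ pq dzr) _.
by rewrite ler_wpM2l// ler_wpM2l.
Qed.

Lemma dstate_bounded_linear u (m : R) : Uad Om ul uu u -> 0 < m ->
  m^-1 + s^-1 <= 2^-1 ->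
  @bounded_linear_op R (LpS Om m) (W1S Om 2) (dst u).
Proof.
move=> uU m0 ms; split.
- by move=> phi pm; exact: (dstate_solves uU m0 ms pm).2.1.1.
- by move=> a x y xm ym; have [] := dstate_linear a m0 ms uU xm ym.
have [C C0 HC] := dstate_estimate m0 ms; exists C => phi pm.
have [H _ _] := HC _ _ uU pm; apply: le_trans H _.
by rewrite EFinM -(SNK pm).
Qed.

Section second_derivative_operator.
Variables (u : 'rV[R]_n.+2 -> R) (m : R).
Hypotheses (uU : Uad Om ul uu u) (m0 : 0 < m) (ms : m^-1 + (m^-1 + s^-1) <= 2^-1).

Lemma d2state_bounded_linear phi : Lp mu Om m phi ->
  @bounded_linear_op R (LpS Om m) (W1S Om 2) (d2st u phi).
Proof.
move=> pm; split.
- by move=> psi qm; exact: (d2state_solves m0 ms uU pm qm).2.1.1.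
- move=> a x y xm ym; have := d2state_linear m0 ms a uU xm ym pm.
  by rewrite !(d2stateC u _ phi).
have [C C0 HC] := d2state_estimate m0 ms; exists (C * SN m phi) => psi qm.
apply: le_trans (HC _ _ _ uU pm qm) _.
by rewrite EFinM -(SNK qm).
Qed.

Lemma d2state_bounded_bilinear :
  @bounded_linear_op R (LpS Om m) (opS (LpS Om m) (W1S Om 2)) (d2st u).
Proof.
(* The zero direction is the element of the unit ball that witnesses nonnegativity of the operator
   norm. *)
have L0 : Lp mu Om m (fun=> 0) by apply: Lp0; rewrite gt_eqF.
have N0 : (Lpnorm mu Om m (fun=> 0%R) <= 1)%E by rewrite Lpnorm_cst0 ?gt_eqF.
split.
- exact: d2state_bounded_linear.
- move=> a x y xm ym; apply/eqP; rewrite eq_le; apply/andP; split.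
    apply: op_norm_le => [|psi qm]; first exact: lexx.
    have := d2state_linear m0 ms a uU xm ym qm.
    by rewrite mul0e => H; rewrite -[leRHS]H; exact: lexx.
  by apply: (op_norm_ge0 (x := (fun=> 0) : LpS Om m) L0 N0); exact: W1norm_ge0.
have [C C0 HC] := d2state_estimate m0 ms; exists C => phi pm.
have -> : (C%:E * @sn_norm _ (LpS Om m) phi)%E = (C * SN m phi)%:E.
  by rewrite EFinM -(SNK pm).
apply: op_norm_le => [|psi qm]; first by rewrite mulr_ge0 ?SN_ge0// ltW.
apply: le_trans (HC _ _ _ uU pm qm) _.
by rewrite EFinM -(SNK qm).
Qed.

End second_derivative_operator.

Section differentiability.
Variables (u : 'rV[R]_n.+2 -> R) (qt : R).
Hypotheses (uU : Uad Om ul uu u) (hqt : 4 * s / (s - 2) < qt).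
Local Notation U := (Uad Om ul uu : set (LpS Om qt)).

(** [g] stands for either form of the quotient, with the operator norm or with the explicit supremum
    over directions, so that the limit is proved once. The number [c] is the part of the bound that
    survives the division, a multiple of the L^m norm of [phi], and is at most a multiple of
    [t ^ (qt / m)]. *)
Lemma dstate_remainder_cvg0 (g : LpS Om qt -> \bar R) :
  (forall phi (c t : R), 0 < t -> 0 <= c -> Lp mu Om qt phi -> SN qt phi = t ->
    (forall psi, Lp mu Om qt psi ->
      (W1norm Om 2 (dst (u + phi) psi - dst u psi - d2st u phi psi)%R <=
       (c * t * SN qt psi)%:E)%E) ->
    (0 <= g phi <= c%:E)%E) ->
  g @ feasible_to0 U (u : LpS Om qt) --> 0%E.
Proof.
move=> Hg; have s2' : 2 < s by case: reg.
have [m [m0 qm e]] := room_exponent s2' hqt.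
have qt0 : 0 < qt by apply: lt_trans hqt; exact: (critical_exponent s2').1.
have [K K0 HK] := dstate_remainder_estimate uU qt0 m0 e.
apply: (@feasible_cvg0 _ _ _ _ _ (K * uu `^ (1 - qt / m)) (qt / m)).
- by rewrite mulr_ge0// powR_ge0.
- by rewrite divr_gt0.
move=> phi t uphiU t0 pt.
have [pq pm pn] := increment_interpolation oOm ul0 ulu qt0 qm uU uphiU pt.
have St : SN qt phi = t := f_equal fine pt.
have c0 : 0 <= K * SN m phi by rewrite mulr_ge0 ?SN_ge0.
have /andP[g0 gc] : (0 <= g phi <= (K * SN m phi)%:E)%E.
  apply: (Hg phi _ _ t0 c0 pq St) => psi qq.
  by have := HK _ _ uphiU pq pm qq; rewrite St.
by rewrite g0 (le_trans gc)// lee_fin -mulrA ler_wpM2l.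
Qed.

End differentiability.

End derivatives.

Theorem lemma2p18 (R : realType) (n : nat) (Om Gt Ga : set 'rV[R]_n.+2)
    (alpha ul uu s q qt : R) (f : sob R n.+1 -> R)
    (fD : 'rV[R]_n.+2 -> R) (ft : sob R n.+1) (u : 'rV[R]_n.+2 -> R) :
  domain Om -> bounded_set Om ->
  0 < alpha <= 1 -> C1holder_boundary alpha Om ->
  Gt `<=` boundary Om -> Gt !=set0 -> closed Gt -> (0 < surf R n Gt)%E ->
  Ga `<=` boundary Om -> Ga !=set0 -> closed Ga -> (0 < surf R n Ga)%E ->
  groger_regular (Om `|` Ga) ->
  0 < ul -> ul <= uu ->
  lift_wellposed Om Gt ->
  regularity_exponent Om Gt ul uu s ->
  Wdual Om Gt s f -> Wtrace Gt s fD -> is_lift Om Gt s fD ft ->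
  2 * s / (s - 2) < q ->
  2 * s / (s - 2) + 2 * s * q / (q * (s - 2) - 2 * s) < qt ->
  Uad Om ul uu u ->
  let X := LpS Om qt in
  let Y := W1S Om 2 in
  let U : set X := Uad Om ul uu in
  let dS : X -> opS X Y := dstate Om Gt ft f in
  let z2 : X -> opS X Y := d2state Om Gt ft f u in
  [/\ forall phi psi : X, sn_dom phi -> sn_dom psi ->
        is_d2state Om Gt u (dS u phi) (dS u psi) phi psi (z2 phi psi) /\
        forall z : Y, is_d2state Om Gt u (dS u phi) (dS u psi) phi psi z ->
          sn_norm (z - z2 phi psi) = 0%E,
      frechet_feasible U dS u z2,
      (fun phi : X => ereal_sup
         [set sn_norm (dS ((u : X) + phi) psi - dS u psi - z2 phi psi)%R /
              (sn_norm phi * sn_norm psi)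
         | psi in [set psi : X | sn_dom psi /\ 0 < sn_norm psi]])%E
        @ feasible_to0 U (u : X) --> 0%E &
      exists2 C : R, 0 < C & forall phi psi : X, sn_dom phi -> sn_dom psi ->
        (sn_norm (z2 phi psi) <=
           C%:E * Lpnorm (leb R n.+1) Om (4 * s / (s - 2)) phi *
                  Lpnorm (leb R n.+1) Om (4 * s / (s - 2)) psi)%E].
Proof.
move=> [oOm _ _] bOm _ _ _ _ cGt _ _ _ _ _ _ ul0 ulu _ reg fW fDW ftL hq hqt uU X Y U dS z2.
have s2 : 2 < s by case: reg.
have [qh0 qhE] := critical_exponent s2.
have qh_lt := critical_exponent_lt s2 hq hqt.
have qt0 := lt_trans qh0 qh_lt.
have qt_inv : qt^-1 < (4 * s / (s - 2))^-1 by rewrite ltf_pV2.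
have qts : qt^-1 + (qt^-1 + s^-1) <= 2^-1.
  by rewrite -qhE; apply: lerD; [exact: ltW|rewrite lerD2r ltW].
have qts1 : qt^-1 + s^-1 <= 2^-1.
  by apply: le_trans qts; rewrite lerDr invr_ge0 ltW.
have mOm := domain_measurable oOm; have finOm := domain_finite bOm.
split.
- move=> phi psi pq qq; split.
    exact: (d2state_solves oOm bOm cGt ul0 ulu reg fW fDW ftL qt0 qts uU pq qq).1.
  move=> z; exact: (d2state_unique oOm bOm cGt ul0 ulu reg fW fDW ftL qt0 qts uU pq qq).
- split.
  + by move=> v vU; exact: (dstate_bounded_linear oOm bOm cGt ul0 ulu reg fW fDW ftL vU qt0 qts1).
  + exact: (d2state_bounded_bilinear oOm bOm cGt ul0 ulu reg fW fDW ftL uU qt0 qts).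
  apply: (dstate_remainder_cvg0 oOm bOm cGt ul0 ulu reg fW fDW ftL uU qh_lt).
  move=> phi c t t0 c0 pq St Hphi.
  have -> : @sn_norm _ X phi = t%:E by rewrite -St; exact: SNK pq.
  apply/andP; split; [apply: (edivr_ge0 t0)|apply: (lee_edivr_fin t0)].
    have L0 : Lp (leb R n.+1) Om qt (fun=> 0) by apply: Lp0; rewrite gt_eqF.
    have N0 : (Lpnorm (leb R n.+1) Om qt (fun=> 0%R) <= 1)%E.
      by rewrite Lpnorm_cst0 ?gt_eqF.
    by apply: (op_norm_ge0 (x := (fun=> 0) : LpS Om qt) L0 N0); exact: W1norm_ge0.
  apply: op_norm_le => [|psi qq]; first by rewrite mulr_ge0// ltW.
  by apply: le_trans (Hphi _ qq) _; rewrite EFinM -(SNK qq).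
- apply: (dstate_remainder_cvg0 oOm bOm cGt ul0 ulu reg fW fDW ftL uU qh_lt).
  move=> phi c t t0 c0 pq St Hphi.
  have nphi : @sn_norm _ X phi = t%:E by rewrite -St; exact: SNK pq.
  apply/andP; split.
    (* The supremum is nonnegative because its index set contains [phi] itself, whose norm is
       positive. *)
    apply: (@le_trans _ _ (sn_norm (dS ((u : X) + phi) phi - dS u phi - z2 phi phi)%R /
              (@sn_norm _ X phi * @sn_norm _ X phi))%E); last first.
      by apply: ereal_sup_ubound; exists phi => //; split; [exact: pq|rewrite nphi lte_fin].
    rewrite nphi -EFinM; apply: edivr_ge0; first exact: mulr_gt0.
    exact: W1norm_ge0.
  apply: ge_ereal_sup => _ [psi [qq psi0] <-].
  have npsi : @sn_norm _ X psi = (SN Om qt psi)%:E by exact: SNK qq.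
  rewrite npsi lte_fin in psi0.
  rewrite nphi npsi -EFinM; apply: lee_edivr_fin; first exact: mulr_gt0.
  by rewrite mulrA; exact: Hphi.
(* The bound on the second derivative leaves no factor that must vanish, so the condition on the
   exponents may hold with equality. *)
have qhs : (4 * s / (s - 2))^-1 + ((4 * s / (s - 2))^-1 + s^-1) <= 2^-1 by rewrite qhE.
have [C C0 HC] := d2state_estimate oOm bOm cGt ul0 ulu reg fW fDW ftL qh0 qhs.
exists C => // phi psi pq qq.
have ph := Lp_subset mOm finOm qh0 (ltW qh_lt) pq.
have qh := Lp_subset mOm finOm qh0 (ltW qh_lt) qq.
by rewrite (SNK ph) (SNK qh) -!EFinM; exact: (HC _ _ _ uU ph qh).
Qed.
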